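(* Let $m,n\in\mathbb{N}^*$ and consider the equation $$(t\partial_t)^m u=F\bigl(t,x,((t\partial_t)^j\partial_x^\alpha u)_{(j,\alpha)\in I_m}\bigr)$$ with unknown function $u=u(t,x)$. Assume: $\mathrm{C}_1)$ $F(t,x,Z)$, $Z=(Z_{j,\alpha})_{(j,\alpha)\in I_m}\in\mathbb{C}^N$, is a holomorphic function on $S(\varepsilon(y))\times D_{R_0}\times\{|Z|<L\}$ for a positive-valued continuous function $\varepsilon(y)$ on $\mathbb{R}$ and constants $R_0>0$, $L>0$. $\mathrm{C}_2)$ There exist a constant $s>0$ and holomorphic functions $c_j(x)$ ($0\le j\le m-1$) on $D_{R_0}$ such that for any $\theta>0$, $(j,\alpha)\in I_m$ and $(i,\beta)\in I_m$, as $t\to 0$ in $S_\theta$: i) $\sup_{x\in D_{R_0}}|F(t,x,0)|=O(|t|^s)$; ii) $\sup_{x\in D_{R_0}}\bigl|\frac{\partial F}{\partial Z_{j,0}}(t,x,0)-c_j(x)\bigr|=O(|t|^s)$; iii) $\sup_{x\in D_{R_0}}\bigl|\frac{\partial F}{\partial Z_{j,\alpha}}(t,x,0)\bigr|=O(|t|^s)$ if $|\alpha|>0$; iv) $\sup_{x\in D_{R_0},\,|Z|<L}\bigl|\frac{\partial^2F}{\partial Z_{j,\alpha}\partial Z_{i,\beta}}(t,x,Z)\bigr|=O(1)$. Then the equation has a solution $u(t,x)$ in the class $\widetilde{\mathcal{O}}_+$.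
   Context: $\mathbb{N}=\{0,1,2,\dots\}$, $\mathbb{N}^*=\{1,2,\dots\}$. $I_m=\{(j,\alpha)\in\mathbb{N}\times\mathbb{N}^n: j+|\alpha|\le m,\ j<m\}$ and $N$ is its cardinality. $\mathcal{R}(\mathbb{C}\setminus\{0\})$ is the universal covering space of $\mathbb{C}\setminus\{0\}$, $S_\theta=\{t\in\mathcal{R}(\mathbb{C}\setminus\{0\}): |\arg t|<\theta\}$, $S(\varepsilon(y))=\{t\in\mathcal{R}(\mathbb{C}\setminus\{0\}): 0<|t|<\varepsilon(\arg t)\}$ for a positive-valued continuous function $\varepsilon(y)$ on $\mathbb{R}$, and $D_r=\{x\in\mathbb{C}^n: |x_i|<r,\ i=1,\dots,n\}$. $\widetilde{\mathcal{O}}_+$ is the set of all $v(t,x)$ such that: (i) $v$ is holomorphic on $S(\varepsilon(y))\times D_r$ for some positive-valued continuous function $\varepsilon(y)$ on $\mathbb{R}$ and some $r>0$; (ii) there is $a>0$ such that for any $\tilde r\in(0,r)$ and any $\theta>0$, $\max_{x\in D_{\tilde r}}|v(t,x)|=O(|t|^a)$ as $t\to 0$ in $S_\theta$. *)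

(* Defs.v *)
From HB Require Import structures.
From mathcomp Require Import all_boot all_order all_algebra.
From mathcomp Require Import all_classical all_reals all_analysis.
From mathcomp Require Import complex.

Set Implicit Arguments.
Unset Strict Implicit.
Unset Printing Implicit Defensive.

Import Order.TTheory GRing.Theory Num.Theory.
Import numFieldNormedType.Exports.

Local Open Scope classical_set_scope.
Local Open Scope ring_scope.
Local Open Scope complex_scope.

(* R[i] typed as a numFieldType, so that the topology and the normed module
   structure of a numFieldType are inferred on it (they are not on R[i]). *)
Definition Cplx (R : realType) : numFieldType := R[i].

(* The universal covering space of C \ {0}, realized by exp : C -> C \ {0}:
   the point t with modulus |t| and argument arg t (a real number, not taken
   modulo 2 pi) is represented by log |t| + i arg t.  Since exp is a local
   biholomorphism, the complex structure is that of C. *)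
Definition RC0 (R : realType) : normedModType (Cplx R) := Cplx R.

Section Definitions.
Variable R : realType.
Local Notation C := (Cplx R).

Definition cabs (z : C) : R := Normc.normc z.

Definition rc_abs (t : RC0 R) : R := expR (complex.Re t).

Definition rc_arg (t : RC0 R) : R := complex.Im t.

(* the covering map onto C \ {0} *)
Definition rc_proj (t : RC0 R) : C :=
  (rc_abs t * cos (rc_arg t)) +i* (rc_abs t * sin (rc_arg t)).

Definition sector (theta : R) : set (RC0 R) :=
  [set t | `|rc_arg t| < theta].

Definition pinched (eps : R -> R) : set (RC0 R) :=
  [set t | 0 < rc_abs t < eps (rc_arg t)].

(* Used both for D_r in C^n and for {|Z| < L} in C^N, with |Z| the maximum of
   the |Z_(j, alpha)|. *)
Definition polydisc (d : nat) (r : R) : set 'rV[C]_d :=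
  [set x | forall i, cabs (x 0 i) < r].

(* Complex Frechet differentiability: the scalar field of V is C. *)
Definition holomorphic_on (V : normedModType C) (f : V -> C) (A : set V) :=
  forall p, A p -> differentiable f p.

(* The derivative with respect to the variable t of C \ {0}, that is, the
   limit of difference quotients taken through the covering map (and not with
   respect to the logarithmic coordinate). *)
Definition dt (v : RC0 R -> C) (t : RC0 R) : C :=
  lim ((fun s => (v s - v t) / (rc_proj s - rc_proj t)) @ t^').

Definition tdt (v : RC0 R -> C) (t : RC0 R) : C := rc_proj t * dt v t.

Definition partial (d : nat) (i : 'I_d) (g : 'rV[C]_d -> C) (x : 'rV[C]_d) : C :=
  'D_(delta_mx 0 i) g x.

Definition mpartial (d : nat) (a : 'I_d -> nat) (g : 'rV[C]_d -> C) :
    'rV[C]_d -> C :=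
  foldr (fun i h => iter (a i) (partial i) h) g (enum 'I_d).

(* I_m as a finite type; bounding each alpha_i by m loses nothing, because
   alpha_i <= |alpha| <= m. *)
Definition Idx (m n : nat) : finType :=
  {p : 'I_m * {ffun 'I_n -> 'I_m.+1} | (p.1 + \sum_i p.2 i <= m)%N}.

Definition idx_j (m n : nat) (k : Idx m n) : 'I_m := (val k).1.

Definition idx_a (m n : nat) (k : Idx m n) : 'I_n -> nat :=
  fun i => (val k).2 i.

Definition idx_deg (m n : nat) (k : Idx m n) : nat := (\sum_i idx_a k i)%N.

(* Points Z of C^N are row vectors; the coordinate Z_(j, alpha) is the one of
   number enum_rank (j, alpha). *)
Definition Zvec (m n : nat) : normedModType C := 'rV[C]_#|Idx m n|.

Definition dZ (m n : nat) (k : Idx m n) (G : Zvec m n -> C) : Zvec m n -> C :=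
  partial (enum_rank k) G.

(* ((t d_t)^j d_x^alpha u)_{(j, alpha) in I_m} *)
Definition jet (m n : nat) (u : RC0 R -> 'rV[C]_n -> C) (t : RC0 R)
    (x : 'rV[C]_n) : Zvec m n :=
  \row_k let p : Idx m n := enum_val k in
    iter (idx_j p) tdt (fun s => mpartial (idx_a p) (u s) x) t.

(* extended-real valued, hence +oo when f is unbounded on A *)
Definition sup_on (T : Type) (A : set T) (f : T -> C) : \bar R :=
  ereal_sup [set (cabs (f x))%:E | x in A].

(* f(t) = O(h(t)) as t -> 0 in S_theta *)
Definition bigO_sector (theta : R) (f : RC0 R -> \bar R) (h : RC0 R -> R) :=
  exists K delta : R, 0 < delta /\
    forall t, sector theta t -> rc_abs t < delta -> (f t <= (K * h t)%:E)%E.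

Definition pos_continuous (eps : R -> R) :=
  continuous eps /\ forall y, 0 < eps y.

(* v belongs to the class O~_+ iff this holds for some eps and r. *)
Definition Otilde_plus (n : nat) (eps : R -> R) (r : R)
    (v : RC0 R -> 'rV[C]_n -> C) :=
  [/\ pos_continuous eps, 0 < r,
      holomorphic_on (fun p : RC0 R * 'rV[C]_n => v p.1 p.2)
        (pinched eps `*` @polydisc n r)
    & exists a : R, 0 < a /\
        forall r' theta : R, 0 < r' < r -> 0 < theta ->
          bigO_sector theta (fun t => sup_on (@polydisc n r') (v t))
            (fun t => rc_abs t `^ a)].

(* u solves the equation on S(eps1) x D_r1; in particular the right-hand side
   is only evaluated inside the domain S(eps) x D_R0 x {|Z| < L} of F. *)
Definition solves_on (m n : nat) (F : RC0 R -> 'rV[C]_n -> Zvec m n -> C)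
    (eps : R -> R) (R0 L : R) (eps1 : R -> R) (r1 : R)
    (u : RC0 R -> 'rV[C]_n -> C) :=
  forall t x, pinched eps1 t -> polydisc r1 x ->
    [/\ pinched eps t, polydisc R0 x, polydisc L (jet m u t x)
      & iter m tdt (fun s => u s x) t = F t x (jet m u t x)].

End Definitions.

(* Main.v *)
(* In the coordinate log t, t d_t is a plain derivative and the solution is sought
   on a convex pinched sector in which |t| is so small that, with s = 8h,
   |F(t,x,0)| <= |t|^(7h) and F - sum_j c_j Z_(j,0) is |t|^(2h)-Lipschitz in Z on
   the polydisc |Z| <= |t|^(4h).
   A finite number of corrections first produces an approximate solution whose
   residual is O(|t|^M) with M large: each correction solves exactly the ordinary
   differential operator (t d_t)^m - sum_j c_j(x) (t d_t)^j, factored at x = 0 into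
   operators t d_t - l that are inverted by integration from t = 0 or from a base
   point according to the sign of Re l - b, and perturbed in x by a Neumann series.
   Then the residual is removed by a Cauchy-Kovalevskaya iteration that integrates
   m times from t = 0 on the shrinking domains |x| + kap_k |t|^(2h/m) < r, where
   integration regains the powers of the distance to the boundary which Cauchy's
   estimate loses for each x-derivative.
   Complex analysis (Cauchy estimates, primitives, Weierstrass' theorem) is derived
   from Goursat's bisection argument for Riemann sums. *)

Require Import Defs.
From HB Require Import structures.
From mathcomp Require Import all_boot all_order all_algebra.
From mathcomp Require Import all_classical all_reals all_analysis.
From mathcomp Require Import complex.
From mathcomp Require Import ring lra.

Import Order.TTheory GRing.Theory Num.Theory.
Import numFieldNormedType.Exports.

Local Open Scope classical_set_scope.
Local Open Scope ring_scope.

Set Implicit Arguments.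
Unset Strict Implicit.
Unset Printing Implicit Defensive.

(** The terms [c_j(x) (t d_t)^j u] carry no small factor in [t], so an iteration that integrates
    from [t = 0] does not contract on them by itself. On functions of size [|t|^M], however, one
    integration in [t] gains [1 / M]; this is why the residual is first brought to a high power of
    [|t|]. Each correction of that first phase loses a fixed part of the [x]-disc, which is
    affordable only finitely often. In the second phase [m] integrations cost a factor [|t|^(-2h)],
    exactly what the Lipschitz bound of the nonlinear part pays back. The constants in the
    assumptions depend on the sector, so uniform bounds require a pinched domain, and integrating
    from a base point requires this domain to be convex in [log t]. Multiples of [h] are spent as
    follows: passing from [8h] to [7h] removes the constants of the assumptions, [6h] is left once
    the exponent has been moved off the characteristic roots, and [4h] bounds the jets without a
    constant. *)

Section RealNorms.
Variable R : realType.
Local Notation C := (Cplx R).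

(** * Real-valued moduli and norms *)

Lemma cabs_ge0 (z : C) : 0 <= cabs z.
Proof. by case: z => a b; exact: sqrtr_ge0. Qed.

Lemma cabsM (z w : C) : cabs (z * w) = cabs z * cabs w.
Proof. exact: Normc.normcM. Qed.

Lemma cabsD (z w : C) : cabs (z + w) <= cabs z + cabs w.
Proof. exact: le_normcD. Qed.

Lemma cabsN (z : C) : cabs (- z) = cabs z.
Proof. exact: normcN. Qed.

Lemma cabsB (z w : C) : cabs (z - w) = cabs (w - z).
Proof. by rewrite -cabsN opprB. Qed.

Lemma cabsV (z : C) : cabs z^-1 = (cabs z)^-1.
Proof. exact: Normc.normcV. Qed.

Lemma cabs0 : cabs (0 : C) = 0.
Proof. exact: Normc.normc0. Qed.

Lemma cabs1 : cabs (1 : C) = 1.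
Proof. exact: Normc.normc1. Qed.

Lemma cabs_eq0 (z : C) : cabs z = 0 -> z = 0.
Proof. exact: Normc.eq0_normc. Qed.

Lemma cabsX (z : C) n : cabs (z ^+ n) = cabs z ^+ n.
Proof. by elim: n => [|n IH]; rewrite ?expr0 ?cabs1// !exprS cabsM IH. Qed.

Definition rC (x : R) : C := (x%:C)%C.

Lemma normC_cabs (z : C) : `|z| = rC (cabs z).
Proof. by []. Qed.

Lemma rCD x y : rC (x + y) = rC x + rC y. Proof. by rewrite /rC rmorphD. Qed.
Lemma rCM x y : rC (x * y) = rC x * rC y. Proof. by rewrite /rC rmorphM. Qed.
Lemma rCN x : rC (- x) = - rC x. Proof. by rewrite /rC rmorphN. Qed.
Lemma rCB x y : rC (x - y) = rC x - rC y. Proof. by rewrite /rC rmorphB. Qed.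
Lemma rC0 : rC 0 = 0. Proof. by []. Qed.
Lemma rC1 : rC 1 = 1. Proof. by []. Qed.
Lemma rCn n : rC n%:R = n%:R. Proof. exact: (rmorph_nat (real_complex R)). Qed.
Lemma rCV x : rC x^-1 = (rC x)^-1. Proof. exact: (fmorphV (real_complex R)). Qed.
Lemma rCX x n : rC (x ^+ n) = rC x ^+ n. Proof. exact: (rmorphXn (real_complex R)). Qed.

Lemma rC_le x y : (rC x <= rC y) = (x <= y). Proof. exact: lecR. Qed.
Lemma rC_lt x y : (rC x < rC y) = (x < y). Proof. exact: ltcR. Qed.

Lemma cabs_rC x : cabs (rC x) = `|x|.
Proof. by rewrite /cabs /rC /= expr0n /= addr0 sqrtr_sqr. Qed.

Lemma cabs_nat n : cabs (n%:R : C) = n%:R.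
Proof. by rewrite -rCn cabs_rC ger0_norm. Qed.

Let sqr_leDr (a b : R) : a ^+ 2 <= a ^+ 2 + b ^+ 2.
Proof. by rewrite lerDl sqr_ge0. Qed.

Let sqr_leDl (a b : R) : b ^+ 2 <= a ^+ 2 + b ^+ 2.
Proof. by rewrite lerDr sqr_ge0. Qed.

Let sqrD_le (a b : R) : a ^+ 2 + b ^+ 2 <= (`|a| + `|b|) ^+ 2.
Proof.
rewrite sqrrD !real_normK ?num_real// addrAC lerDl.
by rewrite mulrn_wge0// mulr_ge0.
Qed.

Lemma cabs_ge_Re (z : C) : `|complex.Re z| <= cabs z.
Proof.
by case: z => a b; rewrite /cabs /= -sqrtr_sqr; exact: ler_wsqrtr (sqr_leDr _ _).
Qed.

Lemma cabs_ge_Im (z : C) : `|complex.Im z| <= cabs z.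
Proof.
by case: z => a b; rewrite /cabs /= -sqrtr_sqr; exact: ler_wsqrtr (sqr_leDl _ _).
Qed.

Lemma cabs_le_ReIm (z : C) : cabs z <= `|complex.Re z| + `|complex.Im z|.
Proof.
case: z => a b; rewrite /cabs /= -[leRHS]ger0_norm ?addr_ge0//.
by rewrite -sqrtr_sqr; exact: ler_wsqrtr (sqrD_le _ _).
Qed.

Lemma C_posE (e : C) : 0 < e -> exists2 r : R, 0 < r & e = rC r.
Proof.
case: e => a b; rewrite ltcE /= => /andP[/eqP -> a0].
by exists a.
Qed.

Lemma cabs_sum (I : Type) (r : seq I) (P : pred I) (F : I -> C) :
  cabs (\sum_(i <- r | P i) F i) <= \sum_(i <- r | P i) cabs (F i).
Proof.
elim/big_ind2: _ => [|x1 x2 y1 y2 h1 h2|i _]; rewrite ?cabs0//.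
by rewrite (le_trans (cabsD _ _))// lerD.
Qed.

Section Nrm.
Variable V : normedModType C.

(** The norm of a normed module over the complex numbers is itself a complex number; taking its real
    part moves all estimates to the totally ordered field [R]. *)
Definition nrm (v : V) : R := complex.Re (`|v| : R[i]).

Lemma normr_nrm (v : V) : `|v| = rC (nrm v).
Proof.
rewrite /nrm; have : (0 : C) <= `|v| by exact: normr_ge0.
by case: (`|v| : C) => a b; rewrite lecE /= => /andP[/eqP -> _].
Qed.

Lemma nrm_ge0 (v : V) : 0 <= nrm v.
Proof. by rewrite -rC_le -normr_nrm; exact: normr_ge0. Qed.

Lemma nrmD (v w : V) : nrm (v + w) <= nrm v + nrm w.
Proof. by rewrite -rC_le rCD -!normr_nrm; exact: ler_normD. Qed.

Lemma nrmN (v : V) : nrm (- v) = nrm v.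
Proof. by rewrite /nrm normrN. Qed.

Lemma nrm0 : nrm 0 = 0. Proof. by rewrite /nrm normr0. Qed.

Lemma nrmZ (a : C) (v : V) : nrm (a *: v) = cabs a * nrm v.
Proof.
by apply: (@complexI R); rewrite -[LHS]normr_nrm normrZ normC_cabs normr_nrm -rCM.
Qed.

Lemma nrm_eq0 (v : V) : nrm v = 0 -> v = 0.
Proof. by move=> h; apply: normr0_eq0; rewrite normr_nrm h. Qed.

Lemma nbhs_nrmP (p : V) (A : set V) :
  nbhs p A <-> exists2 d : R, 0 < d & forall q, nrm (q - p) < d -> A q.
Proof.
split.
  move=> /nbhs_ballP[e /= e0 hA]; have [r r0 er] := C_posE e0.
  exists r => // q hq; apply: hA; rewrite -ball_normE /=.
  by rewrite -normrN opprB normr_nrm er rC_lt.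
move=> [d d0 hA]; apply/nbhs_ballP; exists (rC d) => /=.
  by rewrite -rC0 rC_lt.
move=> q; rewrite -ball_normE /= -normrN opprB normr_nrm rC_lt; exact: hA.
Qed.

Lemma open_nrmP (U : set V) : open U <->
  forall p, U p -> exists2 d : R, 0 < d & forall q, nrm (q - p) < d -> U q.
Proof. by rewrite openE; split => h p /h /nbhs_nrmP. Qed.

End Nrm.

Lemma nrmC (z : C) : nrm (z : C) = cabs z.
Proof. by []. Qed.

Lemma nrm_pair (V W : normedModType C) (v : V) (w : W) :
  nrm ((v, w) : (V * W)%type) = Num.max (nrm v) (nrm w).
Proof.
apply: (@complexI R); rewrite -[LHS]normr_nrm prod_normE /= !normr_nrm.
by rewrite !maxElt rC_lt; case: ifP.
Qed.

Lemma mx_norm_coordC n (x : 'rV[C]_n) :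
  (`|x| : C) = mx_norm x.
Proof. by []. Qed.

Lemma nrm_row_coord n (x : 'rV[C]_n) i : cabs (x 0 i) <= nrm x.
Proof.
rewrite -rC_le -normr_nrm -normC_cabs mx_norm_coordC mx_normE.
set M := (X in _ <= X%:num).
have /bigmax_leP[_ /(_ (0, i) isT) h] : M <= M by [].
by move: h; rewrite -num_le.
Qed.

Lemma nrm_row_le n (x : 'rV[C]_n) (e : R) : 0 <= e ->
  (forall i, cabs (x 0 i) <= e) -> nrm x <= e.
Proof.
move=> e0 h; rewrite -rC_le -normr_nrm mx_norm_coordC.
have [->|/mx_norm_neq0[[i j] ->]] := eqVneq (mx_norm x) 0.
  by rewrite -rC0 rC_le.
by rewrite ord1 normC_cabs rC_le /=.
Qed.

Lemma nrm_delta n (i : 'I_n) : nrm (delta_mx 0 i : 'rV[C]_n) = 1.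
Proof.
apply/eqP; rewrite eq_le; apply/andP; split.
  apply: nrm_row_le => // j; rewrite mxE eqxx /=.
  by case: (j == i); rewrite ?cabs1 ?cabs0.
by have := nrm_row_coord (delta_mx 0 i : 'rV[C]_n) i; rewrite mxE !eqxx cabs1.
Qed.

(** Positivity of [r] covers dimension 0, where the condition on coordinates is empty and the norm
    is 0. *)
Lemma polydiscE n (r : R) (x : 'rV[C]_n) : 0 < r ->
  polydisc r x <-> nrm x < r.
Proof.
move=> r0; split => [h|h i]; last exact: le_lt_trans (nrm_row_coord x i) h.
have [h0|/mx_norm_neq0[[i j] hn]] := eqVneq (mx_norm x) 0.
  by rewrite -rC_lt -normr_nrm mx_norm_coordC h0 rC_lt.
rewrite -rC_lt -normr_nrm mx_norm_coordC hn ord1 normC_cabs rC_lt; exact: h.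
Qed.
End RealNorms.

(** * Differentials in epsilon-delta form *)

Section Differentials.
Variable R : realType.
Local Notation C := (Cplx R).
Variables V W : normedModType C.
Implicit Types (f : V -> W) (p v w : V).

Lemma diff_est f p (e : R) : differentiable f p -> 0 < e ->
  exists2 d : R, 0 < d &
    forall h, nrm h < d -> nrm (f (p + h) - f p - 'D_h f p) <= e * nrm h.
Proof.
move=> df e0; have /eqaddoP := diff_locally df.
have re0 : 0 < rC e by rewrite -rC0 rC_lt.
move=> /(_ _ re0) /nbhs_nrmP[d d0 hd]; exists d => // h hh.
have := hd h; rewrite subr0 => /(_ hh) /=; rewrite !normr_nrm -rCM rC_le.
rewrite deriveE//.
have -> // : (f \o shift p - (cst (f p) + 'd f p)) h = f (p + h) - f p - 'd f p h.
by rewrite -[LHS]/(f (h + p) - (f p + 'd f p h)) [h + p]addrC opprD addrA.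
Qed.

Lemma D_lin f p (a : C) v w : differentiable f p ->
  'D_(a *: v + w) f p = a *: 'D_v f p + 'D_w f p.
Proof. by move=> df; rewrite !deriveE// linearP. Qed.

Lemma D_scale f p (a : C) v : differentiable f p ->
  'D_(a *: v) f p = a *: 'D_v f p.
Proof. by move=> df; rewrite !deriveE// linearZ. Qed.

Lemma D_bounded f p : differentiable f p ->
  exists2 K : R, 0 < K & forall v, nrm ('D_v f p) <= K * nrm v.
Proof.
move=> df; have [k /C_posE[K K0 ->] hk] := linear_lipschitz (diff_continuous df).
exists K => // v; rewrite deriveE// -rC_le rCM -!normr_nrm; exact: hk.
Qed.

(** The bound makes the candidate [L] continuous, and uniqueness of the differential identifies it.
    This form serves when [L] is only known as a limit or through an explicit formula. *)
Lemma diff_intro f p (L : V -> W) (K : R) :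
  (forall a v w, L (a *: v + w) = a *: L v + L w) ->
  (forall v, nrm (L v) <= K * nrm v) ->
  (forall e : R, 0 < e -> exists2 d : R, 0 < d &
     forall h, nrm h < d -> nrm (f (p + h) - f p - L h) <= e * nrm h) ->
  differentiable f p /\ forall v, 'D_v f p = L v.
Proof.
move=> linL bL est.
pose Lm := GRing.isLinear.Build C V W *:%R L linL.
pose LL : {linear V -> W} := HB.pack L Lm.
have cL : continuous LL.
  move=> q A /nbhs_nrmP[d d0 hA]; apply/nbhs_nrmP.
  have K0 : 0 < `|K| + 1 by rewrite ltr_pwDr.
  exists (d / (`|K| + 1)); first exact: divr_gt0.
  move=> q' hq; apply: hA; rewrite -linearB.
  apply: le_lt_trans (bL _) _; apply: le_lt_trans (_ : (`|K| + 1) * nrm (q' - q) < d).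
    by rewrite ler_wpM2r ?nrm_ge0// (le_trans (ler_norm _))// lerDl.
  by rewrite mulrC -ltr_pdivlMr.
have lo : f \o shift p = cst (f p) + LL +o_ 0 id.
  apply/eqaddoP => e' /C_posE[e e0 ->].
  have [d d0 hd] := est e e0; apply/nbhs_nrmP; exists d => // h.
  rewrite subr0 => /hd; rewrite !normr_nrm -rCM rC_le.
  have -> // : (f \o shift p - (cst (f p) + LL)) h = f (p + h) - f p - L h.
  by rewrite -[LHS]/(f (h + p) - (f p + L h)) [h + p]addrC opprD addrA.
have dE := diff_unique cL lo.
have df : differentiable f p by apply/diff_locallyP; rewrite dE.
by split=> // v; rewrite deriveE// dE.
Qed.

Lemma diff_cont f p (e : R) : differentiable f p -> 0 < e ->
  exists2 d : R, 0 < d & forall q, nrm (q - p) < d -> nrm (f q - f p) < e.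
Proof.
move=> /differentiable_continuous cf e0.
have /cf /nbhs_nrmP[d d0 hd] : nbhs (f p) [set z | nrm (z - f p) < e].
  by apply/nbhs_nrmP; exists e.
by exists d.
Qed.

End Differentials.

(** * Mean value inequalities *)

Section RealDeriv.
Variable R : realType.

Lemma is_derive_est (f : R -> R) (x l e : R) : is_derive x 1 f l -> 0 < e ->
  exists2 d : R, 0 < d &
    forall h, `|h| < d -> `|f (x + h) - f x - h * l| <= e * `|h|.
Proof.
move=> [df lE] e0; have df' : differentiable f x by exact/derivable1_diffP.
have /eqaddoP := diff_locally df'.
move=> /(_ _ e0) /nbhs_ballP[d /= d0 hd]; exists d => // h hh.
have /hd : ball 0 d h by rewrite -ball_normE /= sub0r normrN.
have -> // : (f \o shift x - (cst (f x) + 'd f x)) h = f (x + h) - f x - h * l.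
rewrite -[LHS]/(f (h + x) - (f x + 'd f x h)) [h + x]addrC opprD addrA.
rewrite -lE deriveE//; congr (_ - _).
by rewrite -[in LHS](mulr1 h) -[h * 1]/(h *: 1) linearZ.
Qed.

Lemma is_derive_intro (f : R -> R) (x l : R) :
  (forall e : R, 0 < e -> exists2 d : R, 0 < d &
    forall h, `|h| < d -> `|f (x + h) - f x - h * l| <= e * `|h|) ->
  is_derive x 1 f l.
Proof.
move=> est.
have lo : (fun h : R => h^-1 *: ((f \o shift x) (h *: 1) - f x)) @ 0^' --> l.
  apply/cvgrPdist_le => e e0; have [d d0 hd] := est e e0.
  apply/nbhs_ballP; exists d => // h; rewrite /ball /= sub0r normrN => hh h0.
  rewrite /= [h *: 1]mulr1 [h + x]addrC.
  have -> : l - h^-1 *: (f (x + h) - f x) = - (h^-1 * (f (x + h) - f x - h * l)).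
    by rewrite mulrBr mulKf// opprB.
  rewrite normrN normrM normfV mulrC ler_pdivrMr ?normr_gt0//; exact: hd.
by split; [apply/cvg_ex; exists l | exact/cvg_lim].
Qed.

(** Comparison with an explicit majorant [Phi] takes the place of estimating integrals
    throughout. *)
Lemma mvt_le (f Phi df dPhi : R -> R) (a b : R) : a <= b ->
  (forall x, a <= x <= b -> is_derive x 1 f (df x)) ->
  (forall x, a <= x <= b -> is_derive x 1 Phi (dPhi x)) ->
  (forall x, a <= x <= b -> df x <= dPhi x) ->
  f b - f a <= Phi b - Phi a.
Proof.
move=> ab hf hP hle.
have hg x : a <= x <= b -> is_derive x 1 (f - Phi) (df x - dPhi x).
  by move=> hx; have := hf x hx; have := hP x hx => ? ?; exact: is_deriveB.
have hc : {within `[a, b], continuous (f - Phi)}.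
  apply: derivable_within_continuous => x; rewrite in_itv /= => /hg hx.
  exact: ex_derive.
have hd : forall x, x \in `]a, b[ -> is_derive x 1 (f - Phi) (df x - dPhi x).
  by move=> x; rewrite in_itv /= => /andP[ax xb]; apply: hg; rewrite !ltW.
have [c] := MVT_segment ab hd hc.
rewrite in_itv /= => hcab hcE; rewrite -subr_le0.
have -> : f b - f a - (Phi b - Phi a) = (f - Phi) b - (f - Phi) a.
  by rewrite -[(f - Phi) b]/(f b - Phi b) -[(f - Phi) a]/(f a - Phi a); ring.
by rewrite hcE mulr_le0_ge0 ?subr_le0 ?subr_ge0 ?hle.
Qed.

End RealDeriv.

Section ComplexMVT.
Variable R : realType.
Local Notation C := (Cplx R).

Lemma ReD (z w : C) : complex.Re (z + w) = complex.Re z + complex.Re w.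
Proof. by case: z w => [a b] [c d]. Qed.

Lemma ReN (z : C) : complex.Re (- z) = - complex.Re z.
Proof. by case: z. Qed.

Lemma ReB (z w : C) : complex.Re (z - w) = complex.Re z - complex.Re w.
Proof. by rewrite ReD ReN. Qed.

Lemma ImD (z w : C) : complex.Im (z + w) = complex.Im z + complex.Im w.
Proof. by case: z w => [a b] [c d]. Qed.

Lemma ImN (z : C) : complex.Im (- z) = - complex.Im z.
Proof. by case: z. Qed.

Lemma ImB (z w : C) : complex.Im (z - w) = complex.Im z - complex.Im w.
Proof. by rewrite ImD ImN. Qed.

Lemma Re_rCM x (z : C) : complex.Re (rC x * z) = x * complex.Re z.
Proof. by case: z => a b; rewrite /rC /= mul0r subr0. Qed.

Lemma Im_rCM x (z : C) : complex.Im (rC x * z) = x * complex.Im z.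
Proof. by case: z => a b; rewrite /rC /= mul0r addr0. Qed.

Lemma cabs_phase (D : C) : exists2 u : C, cabs u = 1 & complex.Re (u * D) = cabs D.
Proof.
have [->|D0] := eqVneq D 0; first by exists 1; rewrite ?cabs1 ?mul1r ?cabs0.
have cD : cabs D != 0 by apply: contra_neq D0 => /cabs_eq0.
exists (rC (cabs D) / D).
  by rewrite cabsM cabs_rC cabsV ger0_norm ?cabs_ge0// divff.
by rewrite divfK.
Qed.

(** A rotation by a complex number of modulus 1 makes the total increment real and nonnegative; the
    real comparison then applies to the real part of the rotated function. *)
Lemma mvtC (phi dphi : R -> C) (Phi dPhi : R -> R) (a b : R) : a <= b ->
  (forall x, a <= x <= b -> forall e : R, 0 < e -> exists2 d : R, 0 < d &
    forall h, `|h| < d -> cabs (phi (x + h) - phi x - rC h * dphi x) <= e * `|h|) ->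
  (forall x, a <= x <= b -> is_derive x 1 Phi (dPhi x)) ->
  (forall x, a <= x <= b -> cabs (dphi x) <= dPhi x) ->
  cabs (phi b - phi a) <= Phi b - Phi a.
Proof.
move=> ab hphi hPhi hle; have [u u1 uE] := cabs_phase (phi b - phi a).
rewrite -uE mulrBr ReB.
apply: (mvt_le (f := fun x => complex.Re (u * phi x))
  (df := fun x => complex.Re (u * dphi x)) ab _ hPhi).
- move=> x hx; apply: is_derive_intro => e e0.
  have [d d0 hd] := hphi x hx e e0; exists d => // h hh.
  rewrite -ReB -Re_rCM -ReB.
  have -> : u * phi (x + h) - u * phi x - rC h * (u * dphi x) =
            u * (phi (x + h) - phi x - rC h * dphi x) by ring.
  by rewrite (le_trans (cabs_ge_Re _))// cabsM u1 mul1r hd.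
- move=> x hx; rewrite (le_trans (ler_norm _))// (le_trans (cabs_ge_Re _))//.
  by rewrite cabsM u1 mul1r hle.
Qed.

Section Lines.
Variable V : normedModType C.

Lemma mvt_line (f : V -> C) (p v : V) (Phi dPhi : R -> R) (a b : R) : a <= b ->
  (forall x, a <= x <= b -> differentiable f (p + rC x *: v)) ->
  (forall x, a <= x <= b -> is_derive x 1 Phi (dPhi x)) ->
  (forall x, a <= x <= b -> cabs ('D_v f (p + rC x *: v)) <= dPhi x) ->
  cabs (f (p + rC b *: v) - f (p + rC a *: v)) <= Phi b - Phi a.
Proof.
move=> ab df hPhi hle.
apply: (mvtC (phi := fun x => f (p + rC x *: v))
  (dphi := fun x => 'D_v f (p + rC x *: v)) ab _ hPhi hle) => x hx e e0.
have e1 : 0 < e / (nrm v + 1) by rewrite divr_gt0// ltr_wpDl// nrm_ge0.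
have [d d0 hd] := diff_est (df x hx) e1.
have v1 : 0 < nrm v + 1 by rewrite ltr_wpDl// nrm_ge0.
exists (d / (nrm v + 1)); first exact: divr_gt0.
move=> h; rewrite ltr_pdivlMr// => hh.
have := hd (rC h *: v); rewrite nrmZ cabs_rC D_scale; last exact: df.
rewrite rCD scalerDl addrA => hd'; apply: le_trans (hd' _) _.
  by apply: le_lt_trans hh; rewrite ler_wpM2l// lerDl.
have -> : e / (nrm v + 1) * (`|h| * nrm v) = e * `|h| * (nrm v / (nrm v + 1)).
  by ring.
apply: ler_piMr; first by rewrite mulr_ge0// ltW.
by rewrite ler_pdivrMr// mul1r lerDl.
Qed.

Lemma lip_line (f : V -> C) (p v : V) (K : R) :
  (forall x, 0 <= x <= 1 -> differentiable f (p + rC x *: v)) ->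
  (forall x, 0 <= x <= 1 -> cabs ('D_v f (p + rC x *: v)) <= K) ->
  cabs (f (p + v) - f p) <= K.
Proof.
move=> df hle.
have := @mvt_line f p v (fun x => x * K) (fun=> K) 0 1 ler01 df _ hle.
rewrite rC1 scale1r rC0 scale0r addr0 mul1r mul0r subr0; apply=> x _.
apply: is_derive_intro => e e0; exists 1 => // h _.
have -> : (x + h) * K - x * K - h * K = 0 by ring.
by rewrite normr0 mulr_ge0// ltW.
Qed.
End Lines.
End ComplexMVT.

(** * Cauchy sequences and geometric convergence *)

Section Completeness.
Variable R : realType.
Local Notation C := (Cplx R).

Lemma half_small (K e : R) : 0 <= K -> 0 < e ->
  exists N, forall n, (N <= n)%N -> K / 2 ^+ n < e.
Proof.
move=> K0 e0; exists (Num.bound (K / e)) => n hn.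
rewrite ltr_pdivrMr ?exprn_gt0// mulrC -ltr_pdivrMr//.
have Ke : 0 <= K / e by rewrite divr_ge0// ltW.
rewrite (lt_le_trans (archi_boundP Ke))//.
rewrite -natrX ler_nat (leq_trans hn)// ltnW// ltn_expl//.
Qed.

Lemma real_cauchy (a : nat -> R) :
  (forall e : R, 0 < e -> exists N, forall i j, (N <= i)%N -> (N <= j)%N ->
     `|a i - a j| <= e) ->
  exists l, forall e : R, 0 < e -> exists N, forall i, (N <= i)%N -> `|a i - l| <= e.
Proof.
move=> ca; have : cvg (a @ \oo).
  apply/cauchy_cvgP/cauchy_exP => e e0.
  have [N hN] := ca (e / 2) (divr_gt0 e0 (ltr0Sn _ _)).
  exists (a N); exists N => // i /= hi; rewrite /ball /=.
  by rewrite (le_lt_trans (hN _ _ _ _))// ltr_pdivrMr// ltr_pMr// ltr1n.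
move=> /cvg_ex[l /cvgrPdist_le hl]; exists l => e e0.
have [N _ hN] := hl e e0; exists N => i hi.
by rewrite distrC; exact: hN.
Qed.

Lemma complex_cauchy (a : nat -> C) :
  (forall e : R, 0 < e -> exists N, forall i j, (N <= i)%N -> (N <= j)%N ->
     cabs (a i - a j) <= e) ->
  exists l, forall e : R, 0 < e -> exists N, forall i, (N <= i)%N ->
     cabs (a i - l) <= e.
Proof.
move=> ca.
have [|l1 h1] := @real_cauchy (fun i => complex.Re (a i)).
  move=> e e0; have [N hN] := ca e e0; exists N => i j hi hj.
  by rewrite -ReB (le_trans (cabs_ge_Re _))// hN.
have [|l2 h2] := @real_cauchy (fun i => complex.Im (a i)).
  move=> e e0; have [N hN] := ca e e0; exists N => i j hi hj.
  by rewrite -ImB (le_trans (cabs_ge_Im _))// hN.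
exists (l1 +i* l2)%C => e e0; have e2 : 0 < e / 2 by rewrite divr_gt0.
have [N1 hN1] := h1 _ e2; have [N2 hN2] := h2 _ e2.
exists (maxn N1 N2) => i; rewrite geq_max => /andP[i1 i2].
rewrite (le_trans (cabs_le_ReIm _))// ReB ImB /= [leRHS](splitr e).
by rewrite lerD ?hN1 ?hN2.
Qed.

(** [K / 2 ^+ k.+1] is the difference of two consecutive values of [K / 2 ^+ k], so the bounds
    telescope exactly and no series has to be summed. *)
Lemma geo_tail (a : nat -> C) (K : R) i j : 0 <= K ->
  (forall k, cabs (a k.+1 - a k) <= K / 2 ^+ k.+1) -> (i <= j)%N ->
  cabs (a j - a i) <= K / 2 ^+ i - K / 2 ^+ j.
Proof.
move=> K0 ha /subnK <-; elim: (j - i)%N => [|n IH].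
  by rewrite add0n !subrr cabs0.
rewrite addSn -[a _.+1 - _](subrKA (a (n + i))%N).
rewrite (le_trans (cabsD _ _))// (le_trans (lerD (ha _) IH))//.
rewrite le_eqVlt; apply/orP; left; apply/eqP.
rewrite exprS invfM; set x := (2 ^+ (n + i))^-1.
by field.
Qed.

Lemma geo_cvg (a : nat -> C) (K : R) : 0 <= K ->
  (forall k, cabs (a k.+1 - a k) <= K / 2 ^+ k.+1) ->
  exists l, forall i, cabs (a i - l) <= K / 2 ^+ i.
Proof.
move=> K0 ha.
have tail i j : (i <= j)%N -> cabs (a j - a i) <= K / 2 ^+ i.
  move=> ij; rewrite (le_trans (geo_tail K0 ha ij))// gerBl.
  by rewrite divr_ge0// exprn_ge0.
have [|l hl] := @complex_cauchy a.
  move=> e e0; have [N hN] := half_small K0 e0; exists N => i j hi hj.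
  have [ij|/ltnW ji] := leqP i j.
    by rewrite cabsB (le_trans (tail _ _ ij))// ltW// hN.
  by rewrite (le_trans (tail _ _ ji))// ltW// hN.
exists l => i; apply/ler_addgt0Pr => e e0; have [N hN] := hl e e0.
rewrite -(subrKA (a (maxn N i))) addrC (le_trans (cabsD _ _))// addrC lerD//.
  by rewrite cabsB tail// leq_maxr.
by rewrite hN// leq_maxl.
Qed.

Lemma cabs_lim_le (a : nat -> C) l (B : R) :
  (forall e : R, 0 < e -> exists N, forall i, (N <= i)%N -> cabs (a i - l) <= e) ->
  (exists N, forall i, (N <= i)%N -> cabs (a i) <= B) -> cabs l <= B.
Proof.
move=> hl [M hM]; apply/ler_addgt0Pr => e e0; have [N hN] := hl e e0.
rewrite -(subKr (a (maxn N M)) l) (le_trans (cabsD _ _))// cabsN.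
by rewrite lerD ?hM ?hN ?leq_maxl ?leq_maxr.
Qed.

End Completeness.

(** * The covering map as the complex exponential *)

Section Exponential.
Variable R : realType.
Local Notation C := (Cplx R).

(** In the logarithmic coordinate the covering map is the complex exponential. *)
Definition cexp (z : C) : C := rc_proj (z : RC0 R).

Lemma cexpD (z w : C) : cexp (z + w) = cexp z * cexp w.
Proof.
case: z w => [a b] [c d]; rewrite /cexp /rc_proj /rc_abs /rc_arg /=.
apply/eqP; rewrite eq_complex /= expRD cosD sinD.
by apply/andP; split; apply/eqP; ring.
Qed.

Lemma cexp0 : cexp 0 = 1.
Proof.
rewrite /cexp /rc_proj /rc_abs /rc_arg /= expR0 cos0 sin0.
by rewrite mulr0 mulr1.
Qed.

Lemma cabs_cexp (z : C) : cabs (cexp z) = expR (complex.Re z).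
Proof.
case: z => a b; rewrite /cexp /rc_proj /rc_abs /rc_arg /cabs /=.
rewrite !exprMn -mulrDr cos2Dsin2 mulr1 sqrtr_sqr ger0_norm//.
Qed.

Lemma cexp_neq0 (z : C) : cexp z != 0.
Proof.
apply/negP => /eqP h; have := cabs_cexp z; rewrite h cabs0 => /eqP.
by rewrite eq_sym expR_eq0.
Qed.

Lemma cexp_2pi (z : C) : cexp (z + (0 +i* (pi *+ 2))%C) = cexp z.
Proof.
rewrite cexpD [X in _ * X](_ : _ = 1) ?mulr1//.
rewrite /cexp /rc_proj /rc_abs /rc_arg /= expR0 cos2pi sin2pi.
by rewrite mulr0 mulr1.
Qed.

Lemma cexp_est0 (e : R) : 0 < e -> exists2 d : R, 0 < d &
  forall h : C, cabs h < d -> cabs (cexp h - 1 - h) <= e * cabs h.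
Proof.
move=> e0.
(* The errors below add up to [6 * e' * cabs h], whence the [8]; [e' <= 1] keeps the factor [expR a]
   below 2. *)
have e1 : 0 < Num.min (e / 8) 1 by rewrite lt_min ltr01 divr_gt0.
set e' := Num.min (e / 8) 1 in e1 *.
have e'e : e' <= e / 8 by rewrite ge_min lexx.
have e'1 : e' <= 1 by rewrite ge_min lexx orbT.
have [d1 d10 h1] := is_derive_est (is_derive_expR (0 : R)) e1.
have [d2 d20 h2] := is_derive_est (is_derive_sin (0 : R)) e1.
have [d3 d30 h3] := is_derive_est (is_derive_cos (0 : R)) e1.
exists (Num.min (Num.min d1 d2) (Num.min d3 (e' / 2))).
  by rewrite !lt_min d10 d20 d30 divr_gt0.
move=> h; rewrite !lt_min => /andP[/andP[hd1 hd2] /andP[hd3 hd4]].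
have := cabs_ge_Re h; have := cabs_ge_Im h.
set a := complex.Re h; set b := complex.Im h => hb ha.
have := h1 a (le_lt_trans ha hd1); have := h2 b (le_lt_trans hb hd2).
have := h3 b (le_lt_trans hb hd3).
rewrite !add0r expR0 sin0 cos0 !(oppr0, mulr0, mulr1, addr0) => H3 H2 H1.
set k := cabs h in hd1 hd2 hd3 hd4 ha hb *.
have k0 : 0 <= k := cabs_ge0 h.
have Ea : `|expR a - 1| <= 2 * k.
  have -> : expR a - 1 = (expR a - 1 - a) + a by ring.
  rewrite (le_trans (ler_normD _ _))//.
  have : `|expR a - 1 - a| <= k.
    by rewrite (le_trans H1)// (le_trans _ ha)// ler_piMl.
  by lra.
have Eb : `|expR a| <= 2.
  have -> : expR a = (expR a - 1) + 1 by ring.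
  rewrite (le_trans (ler_normD _ _))// normr1.
  by lra.
have H2' : `|sin b - b| <= e' * k by rewrite (le_trans H2)// ler_pM2l.
have H3' : `|cos b - 1| <= e' * k by rewrite (le_trans H3)// ler_pM2l.
have H1' : `|expR a - 1 - a| <= e' * k by rewrite (le_trans H1)// ler_pM2l.
rewrite (le_trans (cabs_le_ReIm _))// !ReB !ImB.
rewrite /cexp /rc_proj /rc_abs /rc_arg -/a -/b /=.
have -> : expR a * cos b - 1 - a = expR a * (cos b - 1) + (expR a - 1 - a) by ring.
have -> : expR a * sin b - 0 - b = expR a * (sin b - b) + (expR a - 1) * b by ring.
have X1 : `|expR a * (cos b - 1)| <= 2 * (e' * k).
  by rewrite normrM ler_pM.
have X2 : `|expR a * (sin b - b)| <= 2 * (e' * k).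
  by rewrite normrM ler_pM.
have X3 : `|(expR a - 1) * b| <= e' * k.
  rewrite normrM; apply: (le_trans (ler_pM _ _ Ea hb)) => //.
  rewrite -mulrA mulrA [2 * _]mulrC ler_wpM2r// -ler_pdivlMr//.
  exact: ltW.
have X4 := ler_normD (expR a * (cos b - 1)) (expR a - 1 - a).
have X5 := ler_normD (expR a * (sin b - b)) ((expR a - 1) * b).
have X6 : e' * k <= e / 8 * k by rewrite ler_wpM2r.
have X7 : 6 * (e / 8 * k) <= e * k.
  have -> : 6 * (e / 8 * k) = 6 / 8 * (e * k) by field.
  by rewrite ler_piMl ?mulr_ge0// ?ltW//; lra.
lra.
Qed.

Lemma cexp_diff (z : C) : differentiable (cexp : C -> C) z /\
  forall h : C, 'D_h (cexp : C -> C) z = h * cexp z.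
Proof.
apply: (@diff_intro R C C cexp z (fun h => h * cexp z) (cabs (cexp z))).
- by move=> a v w; rewrite -[a *: v]/(a * v) -[a *: (v * _)]/(a * (v * _)); ring.
- by move=> v; rewrite !nrmC cabsM mulrC.
move=> e e0; have c0 : 0 < cabs (cexp z) by rewrite cabs_cexp expR_gt0.
have [d d0 hd] := cexp_est0 (divr_gt0 e0 c0); exists d => // h hh.
rewrite !nrmC cexpD.
have -> : cexp z * cexp h - cexp z - h * cexp z = (cexp h - 1 - h) * cexp z by ring.
by rewrite cabsM -ler_pdivlMr// mulrAC hd.
Qed.

End Exponential.

(** * Goursat's lemma for Riemann sums around parallelograms *)

Section Goursat.
Variable R : realType.
Local Notation C := (Cplx R).
Implicit Types (h : C -> C) (z v w : C).

Lemma D_1 h (p u : C) : differentiable h p -> 'D_u h p = u * 'D_1 h p.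
Proof. by move=> dh; rewrite -[u in LHS]mulr1; exact: D_scale. Qed.

(** Left Riemann sum along the segment from [z] to [z + v]. With [2 ^ N] pieces, halving the segment
    splits the sum exactly. *)
Definition edge_sum h N z v : C :=
  \sum_(k < 2 ^ N) h (z + k%:R / 2 ^+ N * v) * (v / 2 ^+ N).

Lemma edge_sumS h N z v :
  edge_sum h N.+1 z v = edge_sum h N z (v / 2) + edge_sum h N (z + v / 2) (v / 2).
Proof.
have n0 : (2 : C) ^+ N != 0 by rewrite expf_neq0// pnatr_eq0.
rewrite /edge_sum expnS mul2n -addnn big_split_ord /=.
congr (_ + _); apply: eq_bigr => k _; congr (h _ * _); rewrite ?natrD ?natrX ?exprS;
  by field; rewrite n0.
Qed.

Definition loop_sum h N z v w : C :=
  edge_sum h N z v + edge_sum h N (z + v) w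
  - edge_sum h N (z + w) v - edge_sum h N z w.

Lemma loop_sumS h N z v w :
  loop_sum h N.+1 z v w = loop_sum h N z (v / 2) (w / 2)
  + loop_sum h N (z + v / 2) (v / 2) (w / 2)
  + loop_sum h N (z + w / 2) (v / 2) (w / 2)
  + loop_sum h N (z + v / 2 + w / 2) (v / 2) (w / 2).
Proof.
rewrite /loop_sum !edge_sumS.
have e1 : z + v / 2 + v / 2 = z + v by field.
have e2 : z + w / 2 + w / 2 = z + w by field.
have e3 : z + v / 2 + w / 2 + v / 2 = z + v + w / 2 by field.
have e4 : z + v / 2 + w / 2 + w / 2 = z + w + v / 2 by field.
have e5 : z + w / 2 + v / 2 = z + v / 2 + w / 2 by ring.
rewrite e1 e2 e3 e4 e5; ring.
Qed.

Lemma edge_sumB h h' N z v :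
  edge_sum (fun q => h q - h' q) N z v = edge_sum h N z v - edge_sum h' N z v.
Proof. by rewrite /edge_sum -sumrB; apply: eq_bigr => k _; rewrite mulrBl. Qed.

(** Translating an edge by [w] changes the sum by [b * w * v], which is symmetric in [v] and [w]:
    the contributions of the two pairs of opposite edges cancel, at every [N]. *)
Lemma edge_sum_affine a b p N z v w :
  edge_sum (fun q => a + b * (q - p)) N (z + w) v =
  edge_sum (fun q => a + b * (q - p)) N z v + b * w * v.
Proof.
have n0 : (2 : C) ^+ N != 0 by rewrite expf_neq0// pnatr_eq0.
rewrite [RHS]addrC; apply/eqP; rewrite -subr_eq /edge_sum -sumrB.
apply/eqP; transitivity (\sum_(k < 2 ^ N) (b * w * (v / 2 ^+ N))).
  by apply: eq_bigr => k _; ring.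
by rewrite sumr_const card_ord -[LHS]mulr_natl natrX; field; rewrite n0.
Qed.

Lemma loop_sum_affine a b p N z v w :
  loop_sum (fun q => a + b * (q - p)) N z v w = 0.
Proof. by rewrite /loop_sum !edge_sum_affine; ring. Qed.

Lemma unit_frac N (k : 'I_(2 ^ N)) : exists2 s : R, 0 <= s <= 1 &
  (k%:R / 2 ^+ N : C) = rC s.
Proof.
exists (k%:R / 2 ^+ N); last by rewrite rCM rCV rCX !rCn.
rewrite divr_ge0 ?exprn_ge0//= ler_pdivrMr ?exprn_gt0// mul1r -natrX ler_nat.
exact/ltnW.
Qed.

Lemma edge_sum_le h N z v (B : R) : 0 <= B ->
  (forall s : R, 0 <= s <= 1 -> cabs (h (z + rC s * v)) <= B) ->
  cabs (edge_sum h N z v) <= B * cabs v.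
Proof.
move=> B0 hB; rewrite (le_trans (cabs_sum _ _ _))//.
apply: (@le_trans _ _ (\sum_(k < 2 ^ N) B * (cabs v / 2 ^+ N))).
  apply: ler_sum => k _; have [s s01 ->] := unit_frac k.
  rewrite cabsM cabsM cabsV cabsX cabs_nat ler_wpM2r ?hB//.
  by rewrite divr_ge0 ?cabs_ge0// exprn_ge0.
rewrite sumr_const card_ord -[leLHS]mulr_natl natrX.
by rewrite mulrCA [X in _ * X]mulrC divfK// expf_neq0// pnatr_eq0.
Qed.

(** Subtracting the first-order Taylor polynomial at [p] does not change the loop sum, and what
    remains is at most [e * r] on all four edges. *)
Lemma loop_sum_local h p z v w N (e r : R) : 0 <= e -> 0 <= r ->
  differentiable h p ->
  (forall q, cabs (q - p) <= r ->
     cabs (h q - h p - 'D_(q - p) h p) <= e * cabs (q - p)) ->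
  (forall s t : R, 0 <= s <= 1 -> 0 <= t <= 1 ->
     cabs (z + rC s * v + rC t * w - p) <= r) ->
  cabs (loop_sum h N z v w) <= 2 * (e * r) * (cabs v + cabs w).
Proof.
move=> e0 r0 dh est inr.
pose g q := h p + 'D_1 h p * (q - p).
have -> : loop_sum h N z v w = loop_sum (fun q => h q - g q) N z v w.
  rewrite {2}/loop_sum !edge_sumB.
  transitivity (loop_sum h N z v w - loop_sum g N z v w).
    by rewrite loop_sum_affine subr0.
  rewrite /loop_sum; ring.
have dE q : cabs (q - p) <= r -> cabs (h q - g q) <= e * r.
  move=> qr; have := est q qr.
  rewrite D_1// => H.
  have -> : h q - g q = h q - h p - (q - p) * 'D_1 h p by rewrite /g; ring.
  by rewrite (le_trans H)// ler_wpM2l.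
have er0 : 0 <= e * r by rewrite mulr_ge0.
have z01 : 0 <= (0 : R) <= 1 by rewrite lexx ler01.
have o01 : 0 <= (1 : R) <= 1 by rewrite lexx ler01.
have E1 : cabs (edge_sum (fun q => h q - g q) N z v) <= e * r * cabs v.
  apply: edge_sum_le => // s hs; apply: dE.
  by have := inr s 0 hs z01; rewrite rC0 mul0r addr0.
have E2 : cabs (edge_sum (fun q => h q - g q) N z w) <= e * r * cabs w.
  apply: edge_sum_le => // s hs; apply: dE.
  by have := inr 0 s z01 hs; rewrite rC0 mul0r addr0.
have E3 : cabs (edge_sum (fun q => h q - g q) N (z + w) v) <= e * r * cabs v.
  apply: edge_sum_le => // s hs; apply: dE.
  by have := inr s 1 hs o01; rewrite rC1 mul1r [_ + w]addrAC.
have E4 : cabs (edge_sum (fun q => h q - g q) N (z + v) w) <= e * r * cabs w.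
  apply: edge_sum_le => // s hs; apply: dE.
  by have := inr 1 s o01 hs; rewrite rC1 mul1r.
move: E1 E2 E3 E4; rewrite /loop_sum.
set a1 := edge_sum _ _ z v; set a2 := edge_sum _ _ z w.
set a3 := edge_sum _ _ _ v; set a4 := edge_sum _ _ _ w.
have := cabsD (a1 + a4 - a3) (- a2); have := cabsD (a1 + a4) (- a3).
have := cabsD a1 a4; rewrite !cabsN; lra.
Qed.

Variables (h : C -> C) (l : R).
Hypothesis dh : forall z, complex.Re z <= l -> differentiable h z.

(** The threshold is divided by 4 at each level, like the area. It is required only for large [N],
    because a subdivision lowers [N] by one. *)
Let small (c : R) v w j z := exists N0, forall N, (N0 <= N)%N ->
  cabs (loop_sum h N z (v / 2 ^+ j) (w / 2 ^+ j)) < c / 4 ^+ j.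

Let small_split c v w j z :
  small c v w j.+1 z -> small c v w j.+1 (z + v / 2 ^+ j.+1) ->
  small c v w j.+1 (z + w / 2 ^+ j.+1) ->
  small c v w j.+1 (z + v / 2 ^+ j.+1 + w / 2 ^+ j.+1) -> small c v w j z.
Proof.
move=> [N1 H1] [N2 H2] [N3 H3] [N4 H4].
exists (maxn (maxn N1 N2) (maxn N3 N4)).+1 => -[//|N].
rewrite ltnS !geq_max => /andP[/andP[n1 n2] /andP[n3 n4]].
have hE (u : C) : u / 2 ^+ j / 2 = u / 2 ^+ j.+1 by rewrite exprSr invfM mulrA.
rewrite loop_sumS !hE.
have := H1 N n1; have := H2 N n2; have := H3 N n3; have := H4 N n4.
have -> : c / 4 ^+ j = 4 * (c / 4 ^+ j.+1) :> R.
  by rewrite exprS invfM; field; rewrite expf_neq0.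
set a1 := loop_sum _ _ _ _ _; set a2 := loop_sum _ _ _ _ _.
set a3 := loop_sum _ _ _ _ _; set a4 := loop_sum _ _ _ _ _.
have := cabsD (a4 + a3 + a2) a1; have := cabsD (a4 + a3) a2; have := cabsD a4 a3.
lra.
Qed.

(* Discrete form of Goursat's lemma: the left Riemann sums of [h] around a
   parallelogram are additive under subdivision into four and vanish exactly on
   affine functions, so the usual bisection works with sums instead of
   integrals. *)
Lemma goursat z v w : complex.Re z <= l -> complex.Re v <= 0 ->
  complex.Re w <= 0 ->
  forall c : R, 0 < c -> exists N0, forall N, (N0 <= N)%N ->
    cabs (loop_sum h N z v w) < c.
Proof.
move=> zl v0 w0 c c0; apply: contrapT => nsmall.
have ns0 : ~ small c v w 0 z.
  by move=> [N0 H]; apply: nsmall; exists N0 => N /H; rewrite !expr0 !divr1.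
pose v_ j := v / 2 ^+ j; pose w_ j := w / 2 ^+ j.
(* The corner of the first of the four quarters that fails to be small; by [small_split] the last
   one fails if the others do not. *)
pose nxt j (z : C) :=
  if ~~ `[< small c v w j.+1 z >] then z
  else if ~~ `[< small c v w j.+1 (z + v_ j.+1) >] then z + v_ j.+1
  else if ~~ `[< small c v w j.+1 (z + w_ j.+1) >] then z + w_ j.+1
  else z + v_ j.+1 + w_ j.+1.
pose zs := fix zs j : C := if j is j'.+1 then nxt j' (zs j') else z.
have zsS j : zs j.+1 = nxt j (zs j) by [].
have ns j : ~ small c v w j (zs j).
  elim: j => [//|j IH]; rewrite zsS /nxt; case: asboolP => //= H1.
  case: asboolP => //= H2; case: asboolP => //= H3 H4; apply: IH.
  exact: small_split H1 H2 H3 H4.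
have sz (u : C) j : cabs (u / 2 ^+ j) = cabs u / 2 ^+ j.
  by rewrite cabsM cabsV cabsX cabs_nat.
set K := cabs v + cabs w.
have K0 : 0 <= K by rewrite addr_ge0 ?cabs_ge0.
have zd j : cabs (zs j.+1 - zs j) <= K / 2 ^+ j.+1.
  have p0 : 0 <= (2 ^+ j.+1 : R)^-1 by rewrite invr_ge0 exprn_ge0.
  have av : cabs (v_ j.+1) <= K / 2 ^+ j.+1.
    by rewrite sz ler_wpM2r// lerDl cabs_ge0.
  have aw : cabs (w_ j.+1) <= K / 2 ^+ j.+1.
    by rewrite sz ler_wpM2r// lerDr cabs_ge0.
  rewrite zsS /nxt; case: ifP => _; first by rewrite subrr cabs0 mulr_ge0.
  case: ifP => _; first by rewrite addrC addKr.
  case: ifP => _; first by rewrite addrC addKr.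
  have -> : zs j + v_ j.+1 + w_ j.+1 - zs j = v_ j.+1 + w_ j.+1 by ring.
  by rewrite (le_trans (cabsD _ _))// !sz -mulrDl.
have [p hp] := geo_cvg K0 zd.
(* Both sides point to the left, so all chosen corners stay in the half plane where [h] is
   holomorphic. *)
have zsl j : complex.Re (zs j) <= l.
  have rs (u : C) i : complex.Re u <= 0 -> complex.Re (u / 2 ^+ i) <= 0.
    move=> u0; rewrite [u / _]mulrC -(rCn R 2) -rCX -rCV Re_rCM.
    by rewrite mulr_ge0_le0// invr_ge0 exprn_ge0.
  elim: j => [//|j IH]; rewrite zsS /nxt.
  have := rs v j.+1 v0; have := rs w j.+1 w0; rewrite -/(v_ _) -/(w_ _).
  case: ifP => _; first by [].
  case: ifP => _; first by rewrite ReD; lra.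
  case: ifP => _; first by rewrite ReD; lra.
  by rewrite !ReD; lra.
have pl : complex.Re p <= l.
  apply/ler_addgt0Pr => e e0; have [N hN] := half_small K0 e0.
  have := cabs_ge_Re (zs N - p); rewrite ReB ler_norml => /andP[H _].
  have := hp N; have := hN N (leqnn _); have := zsl N; move: H; lra.
have dp := dh pl.
(* The local bound at level [J] is [4 * e * K ^+ 2 / 4 ^+ J], which this [e] makes at most half of
   [c / 4 ^+ J]; [K + 1] also covers [K = 0]. *)
pose e := c / (8 * (K + 1) ^+ 2).
have K1 : 0 < K + 1 by rewrite ltr_pwDr.
have e0 : 0 < e by rewrite divr_gt0// mulr_gt0// exprn_gt0.
have [d d0 hd] := diff_est dp e0.
have K2 : 0 <= 2 * K by rewrite mulr_ge0.
have [J hJ] := half_small K2 d0.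
apply: (ns J); exists 0%N => N _.
have HJ := hJ J (leqnn _).
apply: (@le_lt_trans _ _ (2 * (e * (2 * K / 2 ^+ J)) * (K / 2 ^+ J))).
  have -> : K / 2 ^+ J = cabs (v / 2 ^+ J) + cabs (w / 2 ^+ J).
    by rewrite !sz -mulrDl.
  apply: (@loop_sum_local h p) => //; first exact: ltW.
  - by rewrite divr_ge0 ?mulr_ge0// exprn_ge0.
  - move=> q qr; have := hd (q - p); rewrite !nrmC => /(_ (le_lt_trans qr HJ)).
    by rewrite [p + _]addrC subrK.
  move=> s t /andP[s0 s1] /andP[t0 t1].
  have -> : zs J + rC s * (v / 2 ^+ J) + rC t * (w / 2 ^+ J) - p =
    (zs J - p) + (rC s * (v / 2 ^+ J) + rC t * (w / 2 ^+ J)) by ring.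
  have sc (x : R) (u : C) : 0 <= x -> x <= 1 ->
      cabs (rC x * (u / 2 ^+ J)) <= cabs u / 2 ^+ J.
    move=> x0 x1; rewrite cabsM cabs_rC ger0_norm// sz ler_piMl//.
    by rewrite divr_ge0 ?cabs_ge0// exprn_ge0.
  have -> : 2 * K / 2 ^+ J = K / 2 ^+ J + (cabs v / 2 ^+ J + cabs w / 2 ^+ J).
    by rewrite -[in RHS]mulrDl -mulrDl -/K; congr (_ / _); ring.
  rewrite (le_trans (cabsD _ _))// lerD// (le_trans (cabsD _ _))// lerD ?sc//.
have -> : 2 * (e * (2 * K / 2 ^+ J)) * (K / 2 ^+ J) =
          (c / 4 ^+ J) * (1 / 2 * (K ^+ 2 / (K + 1) ^+ 2)).
  have -> : (4 : R) ^+ J = 2 ^+ J * 2 ^+ J by rewrite -exprMn; congr (_ ^+ J); ring.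
  by rewrite /e; field; rewrite expf_neq0 ?pnatr_eq0// gt_eqF.
rewrite gtr_pMr; last by rewrite divr_gt0// exprn_gt0.
have : K ^+ 2 / (K + 1) ^+ 2 <= 1.
  by rewrite ler_pdivrMr ?exprn_gt0// mul1r lerXn2r ?nnegrE ?lerDl// ltW.
lra.
Qed.

End Goursat.

(** * Cauchy's estimate and Lipschitz bounds *)

Section CauchyEstimate.
Variable R : realType.
Local Notation C := (Cplx R).

(* Averages over circles: for [q] holomorphic on a punctured disc and continuous at
   the centre, [q \o exp] is [2 pi i]-periodic on a half plane, and Goursat's lemma
   on a rectangle of height [2 pi] compares the averages on two circles. *)
Lemma circle_max (q : C -> C) (q0 : C) (b B : R) : 0 < b ->
  (forall z : C, z != 0 -> cabs z <= b -> differentiable q z) ->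
  (forall e : R, 0 < e -> exists2 d : R, 0 < d &
     forall z : C, z != 0 -> cabs z < d -> cabs (q z - q0) <= e) ->
  (forall z : C, cabs z = b -> cabs (q z) <= B) ->
  cabs q0 <= B.
Proof.
move=> b0 dq q0c qB.
pose h (z : C) := q (cexp z); pose l := ln b.
have bE : expR l = b by rewrite lnK.
have dh (z : C) : complex.Re z <= l -> differentiable h z.
  move=> zl; have -> : h = q \o (@cexp R) by [].
  apply: differentiable_comp; first exact: (cexp_diff z).1.
  by apply: dq; rewrite ?cexp_neq0// cabs_cexp -bE ler_expR.
pose w : C := (0 +i* (pi *+ 2))%C.
have w0 : 0 < cabs w.
  apply: lt_le_trans (cabs_ge_Im _); rewrite /w /= normr_gt0.
  by rewrite mulrn_eq0 /= gt_eqF// pi_gt0.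
have B0 : 0 <= B.
  by rewrite (le_trans (cabs_ge0 _) (qB (rC b) _))// cabs_rC gtr0_norm.
apply/ler_addgt0Pr => e e0.
have e2 : 0 < e / 2 by rewrite divr_gt0.
have [d d0 hd] := q0c _ e2.
(* The left side of the rectangle has modulus [expR (l - K) < d], where [q] is within [e / 2] of
   [q0]. *)
pose K := Num.max 0 (l - ln d + 1).
have K0 : 0 <= K by rewrite le_max lexx.
have lK : l - K < ln d.
  have : l - ln d + 1 <= K by rewrite le_max lexx orbT.
  lra.
pose z := rC l; pose v := rC (- K).
have zl : complex.Re z <= l by [].
have v0 : complex.Re v <= 0 by rewrite /v /= oppr_le0.
have rw0 : complex.Re w <= 0 by [].
have c0 : 0 < e / 2 * cabs w by rewrite mulr_gt0.
have [N hN] := goursat dh zl v0 rw0 c0.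
have := hN N (leqnn _).
(* By periodicity the two horizontal sides cancel, leaving the two vertical ones, that is, the two
   circles. *)
have per (p u : C) : edge_sum h N (p + w) u = edge_sum h N p u.
  apply: eq_bigr => k _; rewrite /h; congr (q _ * _).
  by rewrite addrAC cexp_2pi.
rewrite /loop_sum per.
have n0 : (2 : C) ^+ N != 0 by rewrite expf_neq0// pnatr_eq0.
have cst : edge_sum (fun=> q0) N (z + v) w = q0 * w.
  rewrite /edge_sum sumr_const card_ord -[LHS]mulr_natl natrX.
  by field; rewrite n0.
have E1 : cabs (edge_sum h N z w) <= B * cabs w.
  apply: edge_sum_le => // s _; apply: qB; rewrite cabs_cexp -bE; congr expR.
  by rewrite ReD Re_rCM /= mulr0 addr0.
have E2 : cabs (edge_sum h N (z + v) w - q0 * w) <= e / 2 * cabs w.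
  rewrite -cst -edge_sumB; apply: edge_sum_le => [|s _]; first exact: ltW.
  apply: hd; first exact: cexp_neq0.
  rewrite cabs_cexp -(@lnK _ d) ?posrE// ltr_expR !ReD Re_rCM /= mulr0 addr0.
  by rewrite addrC addrC.
set a1 := edge_sum h N z v; set a2 := edge_sum h N (z + v) w.
set a3 := edge_sum h N z w.
rewrite -/a2 -/a3 in E1 E2 *.
have -> : a1 + a2 - a1 - a3 = a2 - a3 by ring.
move=> E3.
have : cabs q0 * cabs w <= (B + e) * cabs w.
  rewrite -cabsM; have -> : q0 * w = a3 + (a2 - a3) - (a2 - q0 * w) by ring.
  have := cabsD (a3 + (a2 - a3)) (- (a2 - q0 * w)); have := cabsD a3 (a2 - a3).
  rewrite cabsN; have -> : (B + e) * cabs w = B * cabs w + e / 2 * cabs w + e / 2 * cabs w.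
    by field.
  lra.
by rewrite ler_pM2r.
Qed.

(** The bound on circles is applied to the difference quotient [(g z - g 0) / z], whose value at the
    centre is the derivative. Its numerator is at most [2 * B], whence the factor 2; radii below [b]
    then tend to [b]. *)
Lemma cauchy_disc (g : C -> C) (b B : R) : 0 < b ->
  (forall z, cabs z < b -> differentiable g z) ->
  (forall z, cabs z < b -> cabs (g z) <= B) ->
  cabs ('D_1 g (0 : C)) <= 2 * B / b.
Proof.
move=> b0 dg gB.
have dg0 : differentiable g (0 : C) by apply: dg; rewrite cabs0.
have B0 : 0 <= B by rewrite (le_trans (cabs_ge0 _) (gB 0 _))// cabs0.
have main (b' : R) : 0 < b' -> b' < b -> cabs ('D_1 g (0 : C)) <= 2 * B / b'.
  move=> b'0 b'b.
  apply: (@circle_max (fun z => (g z - g 0) * z^-1) _ b' (2 * B / b') b'0).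
  - move=> z z0 zb.
    apply: (@differentiableM _ _ (fun z => g z - g 0) (fun z : C => z^-1)).
      apply: differentiableB; last exact: differentiable_cst.
      by apply: dg; exact: le_lt_trans b'b.
    exact: differentiable_Rinv.
  - move=> e e0; have [d d0 hd] := diff_est dg0 e0; exists d => // z z0 zd.
    have := hd z zd; rewrite add0r D_1// !nrmC => H.
    have cz : 0 < cabs z.
      by rewrite lt_neqAle cabs_ge0 andbT eq_sym; apply: contra_neq z0 => /cabs_eq0.
    have -> : (g z - g 0) * z^-1 - 'D_1 g (0 : C) = (g z - g 0 - z * 'D_1 g (0 : C)) * z^-1.
      by rewrite [RHS]mulrBl mulrAC divff// mul1r.
    by rewrite cabsM cabsV ler_pdivrMr.
  - move=> z zb; rewrite cabsM cabsV zb ler_pM2r ?invr_gt0//.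
    have := cabsD (g z) (- g 0); rewrite cabsN.
    have : cabs (g z) <= B by apply: gB; rewrite zb.
    have : cabs (g 0) <= B by apply: gB; rewrite cabs0.
    lra.
apply/ler_addgt0Pr => e e0.
have BE : 0 < 2 * B / b + e by rewrite ltr_wpDl// divr_ge0 ?mulr_ge0// ltW.
(* The second entry is the radius at which [2 * B / b'] equals [2 * B / b + e]; the first keeps [b']
   positive when [B = 0]. *)
pose b' := Num.max (b / 2) (2 * B / (2 * B / b + e)).
have b'0 : 0 < b' by rewrite lt_max divr_gt0.
have b'b : b' < b.
  rewrite gt_max; apply/andP; split; first by rewrite ltr_pdivrMr// ltr_pMr// ltr1n.
  rewrite ltr_pdivrMr// mulrDr mulrCA divff ?gt_eqF// mulr1 ltrDl.
  exact: mulr_gt0.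
rewrite (le_trans (main b' b'0 b'b))// ler_pdivrMr//.
have : 2 * B / (2 * B / b + e) <= b' by rewrite le_max lexx orbT.
by rewrite ler_pdivrMr// [X in _ <= X]mulrC.
Qed.

Section Vector.
Variable V : normedModType C.
Implicit Types (f : V -> C) (p v w h : V).

Lemma line_diff f p v (z : C) : differentiable f (p + z *: v) ->
  differentiable (fun z : C => f (p + z *: v)) z /\
  'D_1 (fun z : C => f (p + z *: v)) z = 'D_v f (p + z *: v).
Proof.
move=> df; have [K K0 hK] := D_bounded df.
suff H : differentiable (fun z : C => f (p + z *: v)) z /\
    forall u : C, 'D_u (fun z : C => f (p + z *: v)) z = 'D_(u *: v) f (p + z *: v).
  by split; [exact: H.1 | rewrite H.2 scale1r].
apply: (@diff_intro R C C _ _ _ (K * nrm v)).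
- move=> a x y; rewrite !D_scale// -[a *: x]/(a * x) -[a *: (x *: _)]/(a * (x * _)).
  rewrite -[(_ + _) *: _]/((a * x + y) * _) -[y *: 'D_v f _]/(y * _); ring.
- by move=> u; rewrite (le_trans (hK _))// nrmZ nrmC mulrCA mulrC.
move=> e e0; have v1 : 0 < nrm v + 1 by rewrite ltr_wpDl// nrm_ge0.
have [d d0 hd] := diff_est df (divr_gt0 e0 v1).
exists (d / (nrm v + 1)); first exact: divr_gt0.
move=> u; rewrite !nrmC ltr_pdivlMr// => hu.
have := hd (u *: v); rewrite nrmZ scalerDl addrA => H.
apply: le_trans (H _) _.
  by apply: le_lt_trans hu; rewrite ler_wpM2l ?cabs_ge0// lerDl.
have -> : e / (nrm v + 1) * (cabs u * nrm v) = e * cabs u * (nrm v / (nrm v + 1)).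
  by ring.
apply: ler_piMr; first by rewrite mulr_ge0 ?cabs_ge0// ltW.
by rewrite ler_pdivrMr// mul1r lerDl.
Qed.

Lemma cauchy_dir f p v (b B : R) : 0 < b ->
  (forall z : C, cabs z < b -> differentiable f (p + z *: v)) ->
  (forall z : C, cabs z < b -> cabs (f (p + z *: v)) <= B) ->
  cabs ('D_v f p) <= 2 * B / b.
Proof.
move=> b0 df fB.
have -> : 'D_v f p = 'D_1 (fun z : C => f (p + z *: v)) (0 : C).
  have [|_ ->] := @line_diff f p v 0; first by apply: df; rewrite cabs0.
  by rewrite scale0r addr0.
by apply: cauchy_disc b0 _ fB => z /df /line_diff[].
Qed.

Lemma cauchy_ball f p v (d B : R) : 0 < d ->
  (forall q, nrm (q - p) < d -> differentiable f q) ->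
  (forall q, nrm (q - p) < d -> cabs (f q) <= B) ->
  cabs ('D_v f p) <= 2 * B / d * nrm v.
Proof.
move=> d0 df fB.
have dfp : differentiable f p by apply: df; rewrite subrr nrm0.
have [v0|v0] := eqVneq (nrm v) 0.
  rewrite v0 mulr0 (nrm_eq0 v0) -(scale0r (0 : V)) D_scale// scale0r cabs0//.
have nv : 0 < nrm v by rewrite lt_neqAle eq_sym v0 nrm_ge0.
have -> : 2 * B / d * nrm v = 2 * B / (d / nrm v) by field; rewrite v0 gt_eqF.
have inb (z : C) : cabs z < d / nrm v -> nrm (p + z *: v - p) < d.
  by rewrite ltr_pdivlMr// addrC addKr nrmZ.
apply: cauchy_dir; first exact: divr_gt0.
  by move=> z /inb; exact: df.
by move=> z /inb; exact: fB.
Qed.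

(** The segment between two points of the half ball stays in it, and around each of its points a
    ball of radius [d / 2] is left for Cauchy's estimate. *)
Lemma lip_ball f p (d B : R) q q' : 0 < d ->
  (forall q, nrm (q - p) < d -> differentiable f q) ->
  (forall q, nrm (q - p) < d -> cabs (f q) <= B) ->
  nrm (q - p) < d / 2 -> nrm (q' - p) < d / 2 ->
  cabs (f q - f q') <= 4 * B / d * nrm (q - q').
Proof.
move=> d0 df fB hq hq'.
have d2 : 0 < d / 2 by rewrite divr_gt0.
have seg (x : R) : 0 <= x <= 1 -> nrm (q' + rC x *: (q - q') - p) < d / 2.
  move=> /andP[x0 x1].
  have -> : q' + rC x *: (q - q') - p = rC (1 - x) *: (q' - p) + rC x *: (q - p).
    have -> : q - q' = (q - p) - (q' - p) by rewrite opprB addrA subrK.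
    rewrite addrAC rCB rC1 scalerBl scale1r [rC x *: (_ - (_ - _))]scalerBr.
    by rewrite [_ - rC x *: (q' - p) in LHS]addrC addrA.
  rewrite (le_lt_trans (nrmD _ _))// !nrmZ !cabs_rC !ger0_norm ?subr_ge0//.
  set A' := nrm (q' - p) in hq' *; set A := nrm (q - p) in hq *.
  have [xe|xne] := eqVneq x 0; first by rewrite xe subr0 mul1r mul0r addr0.
  have xp : 0 < x by rewrite lt_neqAle eq_sym xne.
  have : x * A < x * (d / 2) by rewrite ltr_pM2l.
  have : (1 - x) * A' <= (1 - x) * (d / 2) by rewrite ler_wpM2l ?subr_ge0// ltW.
  lra.
have inb (x : R) (h : V) : 0 <= x <= 1 -> nrm (h - (q' + rC x *: (q - q'))) < d / 2 ->
    nrm (h - p) < d.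
  move=> /seg hx hh; rewrite -(subrKA (q' + rC x *: (q - q'))).
  by rewrite (le_lt_trans (nrmD _ _))// [ltRHS](splitr d) ltrD.
have -> : f q - f q' = f (q' + (q - q')) - f q' by rewrite [q' + _]addrC subrK.
apply: lip_line => x hx.
  by apply: df; apply: (inb x) => //; rewrite subrr nrm0.
have -> : 4 * B / d = 2 * B / (d / 2) by field; rewrite gt_eqF.
apply: cauchy_ball => // h hh; [apply: df | apply: fB]; exact: inb hh.
Qed.

End Vector.
End CauchyEstimate.

#[local] Opaque derive.

(** * Locally uniform limits of holomorphic functions *)

Section Weierstrass.
Variable R : realType.
Local Notation C := (Cplx R).
Variable V : normedModType C.
Implicit Types (f g : V -> C) (p q v w : V) (U : set V).

Let lin_close (a x y z u1 u2 u : C) (e : R) : z = a * x + y ->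
  cabs (z - u) <= e / 3 -> cabs (x - u1) <= e / 3 / (cabs a + 1) ->
  cabs (y - u2) <= e / 3 -> cabs (u - (a * u1 + u2)) <= e.
Proof.
have a1 : 0 < cabs a + 1 by rewrite ltr_wpDl// cabs_ge0.
move=> -> hA; rewrite ler_pdivlMr// => hB hD.
have -> : u - (a * u1 + u2) = - (a * x + y - u) + a * (x - u1) + (y - u2) by ring.
have := cabsD (- (a * x + y - u) + a * (x - u1)) (y - u2).
have := cabsD (- (a * x + y - u)) (a * (x - u1)); rewrite cabsN cabsM.
have := cabs_ge0 (x - u1); lra.
Qed.

Lemma cabs_tri (a b c : C) (e1 e2 : R) :
  cabs (a - b) <= e1 -> cabs (a - c) <= e2 -> cabs (b - c) <= e1 + e2.
Proof.
move=> h1 h2; have -> : b - c = (a - c) - (a - b) by ring.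
by rewrite (le_trans (cabsD _ _))// cabsN addrC lerD.
Qed.

(** Locally uniform convergence; the radius is fixed before the accuracy. *)
Definition luc (fk : nat -> V -> C) f U := forall p, U p ->
  exists2 d : R, 0 < d & forall e : R, 0 < e -> exists N, forall k, (N <= k)%N ->
    forall q, nrm (q - p) < d -> cabs (fk k q - f q) <= e.

Lemma open_nrm U p : open U -> U p ->
  exists2 d : R, 0 < d & forall q, nrm (q - p) < d -> U q.
Proof. by move=> /open_nrmP; exact. Qed.

Lemma D_sub f g p v : differentiable f p -> differentiable g p ->
  'D_v (fun q => f q - g q) p = 'D_v f p - 'D_v g p.
Proof. by move=> df dg; rewrite -deriveB//; exact: diff_derivable. Qed.

Lemma D_close f g p q v (d e : R) : 0 < d ->
  (forall q, nrm (q - p) < d -> differentiable f q) ->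
  (forall q, nrm (q - p) < d -> differentiable g q) ->
  (forall q, nrm (q - p) < d -> cabs (f q - g q) <= e) ->
  nrm (q - p) < d / 2 ->
  cabs ('D_v f q - 'D_v g q) <= 4 * e / d * nrm v.
Proof.
move=> d0 df dg fg hq; have d2 : 0 < d / 2 by rewrite divr_gt0.
have inb q' : nrm (q' - q) < d / 2 -> nrm (q' - p) < d.
  move=> h; rewrite -(subrKA q) (le_lt_trans (nrmD _ _))// [ltRHS](splitr d).
  exact: ltrD.
have qd : nrm (q - p) < d by apply: inb; rewrite subrr nrm0.
rewrite -D_sub; [|exact: df|exact: dg].
have -> : 4 * e / d = 2 * e / (d / 2) by field; rewrite gt_eqF.
apply: cauchy_ball; first exact: d2.
  by move=> q' /inb h; apply: differentiableB; [exact: df | exact: dg].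
by move=> q' /inb h; exact: fg.
Qed.

Variables (fk : nat -> V -> C) (f : V -> C) (U : set V).
Hypotheses (oU : open U) (hol : forall k, holomorphic_on (fk k) U)
  (cv : luc fk f U).

Let unif p : U p -> exists2 d : R, 0 < d & (forall q, nrm (q - p) < d -> U q) /\
  forall e : R, 0 < e -> exists N, forall k, (N <= k)%N ->
    forall q, nrm (q - p) < d -> cabs (fk k q - f q) <= e.
Proof.
move=> Up; have [d1 d10 h1] := open_nrm oU Up; have [d2 d20 h2] := cv Up.
exists (Num.min d1 d2); first by rewrite lt_min d10.
split=> [q|e e0]; first by rewrite lt_min => /andP[/h1].
have [N hN] := h2 e e0; exists N => k Nk q; rewrite lt_min => /andP[_]; exact: hN.
Qed.

Let cau p (d e : R) N : (forall k, (N <= k)%N ->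
    forall q, nrm (q - p) < d -> cabs (fk k q - f q) <= e / 2) ->
  forall k j, (N <= k)%N -> (N <= j)%N ->
    forall q, nrm (q - p) < d -> cabs (fk k q - fk j q) <= e.
Proof.
move=> H k j hk hj q hq; rewrite -(subrKA (f q)) (le_trans (cabsD _ _))//.
by rewrite [leRHS](splitr e) lerD ?H// cabsB H.
Qed.

(** By Cauchy's estimate the differentials at [p] form a Cauchy sequence, with a bounded linear
    limit [L]. The first-order estimate for [f] is inherited from a single [fk N], because
    [fk N - f] has a small Lipschitz constant at [p]. *)
Lemma weierstrass_pt p : U p -> differentiable f p /\
  forall v, forall e : R, 0 < e -> exists N, forall k, (N <= k)%N ->
    cabs ('D_v (fk k) p - 'D_v f p) <= e.
Proof.
move=> Up; have [d d0 [hU hcv]] := unif Up.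
have df k q : nrm (q - p) < d -> differentiable (fk k) q by move=> /hU /hol.
have Dcau (e : R) : 0 < e -> exists N, forall k j, (N <= k)%N -> (N <= j)%N ->
    (forall q, nrm (q - p) < d -> cabs (fk k q - fk j q) <= e) /\
    forall v, cabs ('D_v (fk k) p - 'D_v (fk j) p) <= 4 * e / d * nrm v.
  move=> e0; have [N hN] := hcv (e / 2) (divr_gt0 e0 (ltr0Sn _ _)).
  exists N => k j hk hj; split; first exact: (cau hN).
  move=> v; apply: (D_close _ d0 (df k) (df j) (cau hN hk hj)).
  by rewrite subrr nrm0 divr_gt0.
have exL v : exists l, forall e : R, 0 < e -> exists N, forall i, (N <= i)%N ->
     cabs ('D_v (fk i) p - l) <= e.
  apply: complex_cauchy => e e0.
  have v1 : 0 < nrm v + 1 by rewrite ltr_wpDl// nrm_ge0.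
  pose e' := e * d / (4 * (nrm v + 1)).
  have e'0 : 0 < e' by rewrite !(divr_gt0, mulr_gt0).
  have [N hN] := Dcau e' e'0; exists N => i j hi hj.
  rewrite (le_trans ((hN i j hi hj).2 v))//.
  have -> : 4 * e' / d * nrm v = e * (nrm v / (nrm v + 1)).
    by rewrite /e'; field; rewrite !gt_eqF.
  by apply: ler_piMr; [exact: ltW | rewrite ler_pdivrMr// mul1r lerDl].
pose L v := projT1 (cid (exL v)).
have hL v : forall e : R, 0 < e -> exists N, forall i, (N <= i)%N ->
    cabs ('D_v (fk i) p - L v) <= e := projT2 (cid (exL v)).
(* Since [f] is not yet known to be differentiable, the Lipschitz bound on [fk k - f] is obtained as
   the limit in [j] of those on [fk k - fk j]. *)
have Lclose (e : R) : 0 < e -> exists N, forall k, (N <= k)%N ->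
    (forall q, nrm (q - p) < d -> cabs (fk k q - f q) <= e) /\
    (forall q, nrm (q - p) < d / 2 ->
       cabs ((fk k q - f q) - (fk k p - f p)) <= 4 * e / d * nrm (q - p)) /\
    forall v, cabs ('D_v (fk k) p - L v) <= 4 * e / d * nrm v.
  move=> e0; have [N hN] := Dcau e e0; have [M hM] := hcv e e0.
  exists (maxn M N) => k; rewrite geq_max => /andP[kM kN]; split; first exact: hM.
  split=> [q hq|v]; apply/ler_addgt0Pr => e1 e10.
    have [N2 hN2] := hcv (e1 / 2) (divr_gt0 e10 (ltr0Sn _ _)).
    pose j := maxn N N2.
    have -> : fk k q - f q - (fk k p - f p) =
      ((fk k q - fk j q) - (fk k p - fk j p)) + ((fk j q - f q) - (fk j p - f p)).
      by ring.
    rewrite (le_trans (cabsD _ _))// lerD//.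
      apply: (@lip_ball _ _ (fun q => fk k q - fk j q) p d e q p d0 _ _ hq).
      - by move=> q' hq'; apply: differentiableB; exact: df.
      - by apply: (hN k j kN _).1; rewrite leq_maxl.
      - by rewrite subrr nrm0 divr_gt0.
    have := cabsD (fk j q - f q) (- (fk j p - f p)); rewrite cabsN.
    have : cabs (fk j q - f q) <= e1 / 2.
      apply: hN2; first by rewrite leq_maxr.
      by rewrite (lt_le_trans hq)// ler_pdivrMr// ler_pMr// ler1n.
    have : cabs (fk j p - f p) <= e1 / 2.
      by apply: hN2; rewrite ?leq_maxr// subrr nrm0.
    lra.
  have [N2 hN2] := hL v e1 e10; pose j := maxn N N2.
  rewrite -(subrKA ('D_v (fk j) p)) (le_trans (cabsD _ _))// lerD//.
    by apply: (hN _ _ _ _).2 => //; rewrite leq_maxl.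
  by apply: hN2; rewrite leq_maxr.
have Llin a v w : L (a *: v + w) = a *: L v + L w.
  apply/eqP; rewrite -subr_eq0; apply/eqP/cabs_eq0/eqP; rewrite eq_le cabs_ge0 andbT.
  apply/ler_addgt0Pr => e e0; rewrite add0r.
  have a1 : 0 < cabs a + 1 by rewrite ltr_wpDl// cabs_ge0.
  have e3 : 0 < e / 3 by rewrite divr_gt0.
  have e4 : 0 < e / 3 / (cabs a + 1) by rewrite divr_gt0.
  have [N1 h1] := hL (a *: v + w) _ e3; have [N2 h2] := hL v _ e4.
  have [N3 h3] := hL w _ e3.
  pose k := maxn N1 (maxn N2 N3).
  have dp : differentiable (fk k) p by apply: df; rewrite subrr nrm0.
  have k1 : (N1 <= k)%N by rewrite leq_maxl.
  have k2 : (N2 <= k)%N by rewrite leq_max leq_maxl orbT.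
  have k3 : (N3 <= k)%N by rewrite leq_max leq_maxr orbT.
  exact: (lin_close (D_lin a v w dp) (h1 k k1) (h2 k k2) (h3 k k3)).
have [N1 hN1] := Lclose 1 ltr01.
have pd : nrm (p - p) < d by rewrite subrr nrm0.
have [K K0 hK] := D_bounded (df N1 p pd).
have [_ [_ H1]] := hN1 N1 (leqnn _).
have bL v : cabs (L v) <= (K + 4 * 1 / d) * nrm v.
  have := cabsD ('D_v (fk N1) p) (- ('D_v (fk N1) p - L v)); rewrite cabsN.
  rewrite opprB addrC subrK mulrDl; have := H1 v; have := hK v; rewrite nrmC; lra.
have [dfp DL] : differentiable f p /\ forall v, 'D_v f p = L v.
  apply: (diff_intro Llin bL) => e e0.
  pose e' := e * d / 16; have e'0 : 0 < e' by rewrite divr_gt0// mulr_gt0.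
  have [N hN] := Lclose e' e'0; have [_ [A1 A2]] := hN N (leqnn _).
  have [r r0 hr] := diff_est (df N p pd) (divr_gt0 e0 (ltr0Sn _ 3)).
  exists (Num.min r (d / 2)); first by rewrite lt_min r0 divr_gt0.
  move=> h; rewrite lt_min => /andP[h1 h2].
  have := hr h h1; have := A2 h; have := A1 (p + h).
  have -> : p + h - p = h by rewrite addrC addKr.
  move=> /(_ h2); rewrite !nrmC.
  have -> : 4 * e' / d = e / 4 by rewrite /e'; field; rewrite gt_eqF.
  set a1 := fk N (p + h); set a2 := f (p + h); set a3 := fk N p; set a4 := f p.
  set a5 := 'D_h (fk N) p => B1 B2 B3.
  have -> : a2 - a4 - L h = - (a1 - a2 - (a3 - a4)) + ((a1 - a3 - a5) + (a5 - L h)).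
    by ring.
  have := cabsD (- (a1 - a2 - (a3 - a4))) ((a1 - a3 - a5) + (a5 - L h)).
  have := cabsD (a1 - a3 - a5) (a5 - L h); rewrite cabsN.
  have eh : 0 <= e * nrm h by rewrite mulr_ge0 ?nrm_ge0// ltW.
  lra.
by split=> // v e e0; rewrite DL; exact: hL.
Qed.

Lemma weierstrass : holomorphic_on f U.
Proof. by move=> p /weierstrass_pt[]. Qed.

Lemma weierstrass_D v : luc (fun k => 'D_v (fk k)) ('D_v f) U.
Proof.
move=> p Up; have [d d0 [hU hcv]] := unif Up.
exists (d / 2); first by rewrite divr_gt0.
move=> e e0; have v1 : 0 < nrm v + 1 by rewrite ltr_wpDl// nrm_ge0.
pose e' := e * d / (16 * (nrm v + 1)).
have e'0 : 0 < e' by rewrite !(divr_gt0, mulr_gt0).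
have [N hN] := hcv (e' / 2) (divr_gt0 e'0 (ltr0Sn _ _)).
exists N => k Nk q hq.
have hqd : nrm (q - p) < d by rewrite (lt_le_trans hq)// ler_pdivrMr// ler_pMr// ler1n.
have [_ /(_ v (e / 2)) H] := weierstrass_pt (hU q hqd).
have [M hM] := H (divr_gt0 e0 (ltr0Sn _ _)); pose j := maxn N M.
rewrite -(subrKA ('D_v (fk j) q)) (le_trans (cabsD _ _))// [leRHS](splitr e).
rewrite lerD//; last by rewrite hM// leq_maxr.
rewrite (le_trans (@D_close (fk k) (fk j) p q v d e' d0 _ _ _ hq))//.
- by move=> q' /hU /hol.
- by move=> q' /hU /hol.
- by apply: (cau hN) => //; rewrite leq_maxl.
have -> : 4 * e' / d * nrm v = e / 4 * (nrm v / (nrm v + 1)).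
  by rewrite /e'; field; rewrite !gt_eqF.
apply: (@le_trans _ _ (e / 4)); last lra.
by apply: ler_piMr; [rewrite divr_ge0 ?ltW | rewrite ler_pdivrMr// mul1r lerDl].
Qed.

End Weierstrass.

(** * Directional derivatives are holomorphic and commute *)

Section Derivatives.
Variable R : realType.
Local Notation C := (Cplx R).
Variable V : normedModType C.
Implicit Types (f g : V -> C) (p q v w : V) (U : set V).

(** The difference quotients are holomorphic in [q]; if they converge locally uniformly along the
    steps [t0 / 2 ^+ k], Weierstrass' theorem makes the derivative holomorphic. *)
Definition dquot f v (t : R) q : C := (f (q + rC t *: v) - f q) * rC t^-1.

Lemma holo_shift f q v (t : R) : differentiable f (q + rC t *: v) ->
  differentiable (fun q => f (q + rC t *: v)) q /\
  forall w, 'D_w (fun q => f (q + rC t *: v)) q = 'D_w f (q + rC t *: v).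
Proof.
move=> df; have [K K0 hK] := D_bounded df.
apply: (@diff_intro _ _ _ _ _ _ K) => //; first by move=> *; exact: D_lin.
move=> e e0; have [d d0 hd] := diff_est df e0; exists d => // h hh.
by rewrite [q + h + _]addrAC; exact: hd.
Qed.

Lemma dquot_diff f v (t : R) q : differentiable f q ->
  differentiable f (q + rC t *: v) -> differentiable (dquot f v t) q /\
  forall w, 'D_w (dquot f v t) q = dquot ('D_w f) v t q.
Proof.
move=> df df'; have [d1 d2] := holo_shift df'; split.
  apply: (@differentiableM _ _ (fun q => f (q + rC t *: v) - f q) (cst (rC t^-1))).
    exact: differentiableB.
  exact: differentiable_cst.
move=> w; rewrite /dquot.
have d3 : differentiable (fun q => f (q + rC t *: v) - f q) q.
  exact: differentiableB.
have := @deriveM _ _ (fun q => f (q + rC t *: v) - f q) (cst (rC t^-1)) q w.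
have -> : (fun q => f (q + rC t *: v) - f q) * cst (rC t^-1) =
  (fun q => (f (q + rC t *: v) - f q) * rC t^-1) by [].
move=> ->; [|exact: diff_derivable|exact: derivable_cst].
rewrite derive_cst scaler0 add0r D_sub// d2 -[_ *: _]/(rC t^-1 * _) mulrC//.
Qed.

Lemma dquot_cvg f v q (t0 e : R) : 0 < t0 -> 0 < e -> differentiable f q ->
  exists N, forall k, (N <= k)%N ->
    cabs (dquot f v (t0 / 2 ^+ k) q - 'D_v f q) <= e.
Proof.
move=> t00 e0 df; have v1 : 0 < nrm v + 1 by rewrite ltr_wpDl// nrm_ge0.
have [d d0 hd] := diff_est df (divr_gt0 e0 v1).
have K0 : 0 <= t0 * nrm v by rewrite mulr_ge0 ?nrm_ge0// ltW.
have [N hN] := half_small K0 d0; exists N => k Nk.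
set t := t0 / 2 ^+ k; have tp : 0 < t by rewrite divr_gt0// exprn_gt0.
have := hd (rC t *: v); rewrite nrmZ cabs_rC gtr0_norm// D_scale//.
rewrite -[_ *: 'D_v f q]/(rC t * _) nrmC => H.
have -> : dquot f v t q - 'D_v f q = (f (q + rC t *: v) - f q - rC t * 'D_v f q) * rC t^-1.
  have e1 : rC t * rC t^-1 = 1 by rewrite -rCM divff ?gt_eqF.
  by rewrite /dquot [RHS]mulrBl [rC t * _]mulrC -[in RHS]mulrA e1 mulr1.
rewrite cabsM cabs_rC normfV gtr0_norm// ler_pdivrMr//.
rewrite (le_trans (H _))//; first by rewrite /t mulrAC hN.
have -> : e / (nrm v + 1) * (t * nrm v) = e * t * (nrm v / (nrm v + 1)) by ring.
apply: ler_piMr; first by rewrite mulr_ge0// ltW.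
by rewrite ler_pdivrMr// mul1r lerDl.
Qed.

Let half_alg (a b c u : C) :
  (b - a) * (u * 2) - (c - a) * u = 2^-1 * ((b - a) * (u * 2) - (c - b) * (u * 2)).
Proof. by field. Qed.

(** Halving the step changes the quotient by half the increment of a quotient between two points at
    distance [t / 2] times the norm of [v]: a Lipschitz bound on quotients thus gives geometric
    convergence. *)
Lemma dquot_half f v (t : R) q : t != 0 ->
  dquot f v (t / 2) q - dquot f v t q =
  rC (2^-1) * (dquot f v (t / 2) q - dquot f v (t / 2) (q + rC (t / 2) *: v)).
Proof.
move=> t0; rewrite /dquot -addrA -scalerDl -rCD -splitr.
rewrite invfM invrK !rCM rCV rCn.
set a := f q; set b := f (q + _); set c := f (q + _).
exact: half_alg.
Qed.

Variables (f : V -> C) (U : set V).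
Hypotheses (oU : open U) (hf : holomorphic_on f U).

(** A Lipschitz bound for [f] bounds all quotients by the same constant; Cauchy's estimate turns it
    into a common Lipschitz bound for the quotients, and [dquot_half] into a geometric rate. *)
Lemma dquot_luc p v : U p -> exists d t0 : R, [/\ 0 < d, 0 < t0,
  forall q, nrm (q - p) < d -> U q,
  forall k q, nrm (q - p) < d -> U (q + rC (t0 / 2 ^+ k) *: v) &
  luc (fun k => dquot f v (t0 / 2 ^+ k)) ('D_v f) [set q | nrm (q - p) < d]].
Proof.
move=> Up; have [d1 d10 h1] := open_nrm oU Up.
have [d2 d20 h2] := diff_cont (hf Up) ltr01.
pose d := Num.min d1 d2; have d0 : 0 < d by rewrite lt_min d10.
have inU q : nrm (q - p) < d -> U q by rewrite lt_min => /andP[/h1].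
have df q : nrm (q - p) < d -> differentiable f q by move=> /inU /hf.
pose B := cabs (f p) + 1; have B0 : 0 <= B by rewrite addr_ge0 ?cabs_ge0.
have fB q : nrm (q - p) < d -> cabs (f q) <= B.
  rewrite lt_min => /andP[_ /h2]; rewrite nrmC => H.
  rewrite -(subrK (f p) (f q)) (le_trans (cabsD _ _))// addrC lerD// ltW//.
have v1 : 0 < nrm v + 1 by rewrite ltr_wpDl// nrm_ge0.
(* All steps move points by at most [d / 16]: from the ball of radius [d / 16] they stay within
   [d / 8], half the radius on which the quotients are bounded. *)
pose t0 := d / 16 / (nrm v + 1).
have t00 : 0 < t0 by rewrite !divr_gt0.
have t0v (k : nat) : t0 / 2 ^+ k * nrm v <= d / 16.
  have -> : t0 / 2 ^+ k * nrm v = d / 16 * (2 ^+ k)^-1 * (nrm v / (nrm v + 1)).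
    by rewrite /t0; ring.
  apply: (@le_trans _ _ (d / 16 * (2 ^+ k)^-1)).
    apply: ler_piMr; last by rewrite ler_pdivrMr// mul1r lerDl.
    by rewrite mulr_ge0 ?invr_ge0 ?exprn_ge0// divr_ge0// ltW.
  apply: ler_piMr; first by rewrite divr_ge0// ltW.
  by rewrite invf_le1 ?exprn_gt0// exprn_ege1// ler1n.
have tk0 k : 0 < t0 / 2 ^+ k by rewrite divr_gt0// exprn_gt0.
have sh k q : nrm (q + rC (t0 / 2 ^+ k) *: v - p) <= nrm (q - p) + d / 16.
  rewrite addrAC (le_trans (nrmD _ _))// lerD2l nrmZ cabs_rC gtr0_norm ?t0v//.
exists (d / 16), t0; split=> //.
- by rewrite divr_gt0.
- by move=> q hq; apply: inU; lra.
- by move=> k q hq; apply: inU; have := sh k q; lra.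
pose C1 := 4 * B / d * nrm v.
have C10 : 0 <= C1 by rewrite mulr_ge0 ?nrm_ge0// divr_ge0 ?mulr_ge0// ltW.
pose K := 4 * C1 / (d / 4) * (2 * t0 * nrm v).
have K0 : 0 <= K.
  apply: mulr_ge0; last exact: mulr_ge0 (ltW (mulr_gt0 _ _)) (nrm_ge0 v).
  by apply: divr_ge0; [exact: mulr_ge0 | exact/ltW/divr_gt0].
have step q : nrm (q - p) < d / 16 -> forall k,
    cabs (dquot f v (t0 / 2 ^+ k.+1) q - dquot f v (t0 / 2 ^+ k) q) <= K / 2 ^+ k.+1.
  move=> hq k.
  have -> : t0 / 2 ^+ k.+1 = t0 / 2 ^+ k / 2 by rewrite exprSr invfM mulrA.
  rewrite dquot_half ?gt_eqF//.
  have -> : t0 / 2 ^+ k / 2 = t0 / 2 ^+ k.+1 by rewrite exprSr invfM mulrA.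
  set t := t0 / 2 ^+ k.+1.
  rewrite cabsM cabs_rC ger0_norm ?invr_ge0//.
  have H : cabs (dquot f v t q - dquot f v t (q + rC t *: v)) <=
      4 * C1 / (d / 4) * nrm (q - (q + rC t *: v)).
    apply: (@lip_ball _ _ (dquot f v t) p (d / 4)).
    - by rewrite divr_gt0.
    - move=> q' hq'; apply: (dquot_diff _ _).1; apply: df; first lra.
      by have := sh k.+1 q'; rewrite -/t; lra.
    - move=> q' hq'; rewrite /dquot cabsM cabs_rC normfV gtr0_norm ?tk0//.
      rewrite ler_pdivrMr ?tk0//.
      apply: (@le_trans _ _ (4 * B / d * nrm (q' + rC t *: v - q'))).
        apply: (@lip_ball _ _ f p) => //; last lra.
        by have := sh k.+1 q'; rewrite -/t; lra.
      by rewrite [_ - q']addrC addKr nrmZ cabs_rC gtr0_norm ?tk0// /C1 mulrCA mulrC.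
    - lra.
    - by have := sh k.+1 q; rewrite -/t; lra.
  apply: (@le_trans _ _ (2^-1 * (4 * C1 / (d / 4) * nrm (q - (q + rC t *: v))))).
    by rewrite ler_pM2l ?invr_gt0.
  rewrite opprD addrA subrr add0r nrmN nrmZ cabs_rC gtr0_norm ?tk0//.
  have -> : K / 2 ^+ k.+1 = 2 * (4 * C1 / (d / 4) * (t * nrm v)) by rewrite /K /t; ring.
  have : 0 <= 4 * C1 / (d / 4) * (t * nrm v).
    apply: mulr_ge0; last exact: mulr_ge0 (ltW (tk0 _)) (nrm_ge0 v).
    by apply: divr_ge0; [exact: mulr_ge0 | exact/ltW/divr_gt0].
  lra.
move=> q0 /= hq0; have r0 : 0 < d / 16 - nrm (q0 - p) by rewrite subr_gt0.
exists (d / 16 - nrm (q0 - p)) => // e e0.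
have [N hN] := half_small K0 e0; exists N => k Nk q hq.
have hq' : nrm (q - p) < d / 16.
  rewrite -(subrKA q0) (le_lt_trans (nrmD _ _))//; lra.
rewrite (le_trans _ (ltW (hN k Nk)))//.
apply/ler_addgt0Pr => e1 e10.
have dfq : differentiable f q by apply: df; lra.
have [M hM] := @dquot_cvg f v q t0 e1 t00 e10 dfq.
pose j := maxn k M.
rewrite -(subrKA (dquot f v (t0 / 2 ^+ j) q)) (le_trans (cabsD _ _))// lerD//.
  rewrite cabsB (le_trans (geo_tail K0 (step q hq') (leq_maxl k M)))//.
  by rewrite gerBl divr_ge0// exprn_ge0.
by rewrite hM// leq_maxr.
Qed.

Lemma ball_open p (d : R) : open [set q : V | nrm (q - p) < d].
Proof.
apply/open_nrmP => q /= hq; exists (d - nrm (q - p)); first by rewrite subr_gt0.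
move=> q' hq'; rewrite -(subrKA q) (le_lt_trans (nrmD _ _))//; lra.
Qed.

Lemma dquot_holo p v (d t0 : R) : (forall q, nrm (q - p) < d -> U q) ->
  (forall k q, nrm (q - p) < d -> U (q + rC (t0 / 2 ^+ k) *: v)) ->
  forall k, holomorphic_on (dquot f v (t0 / 2 ^+ k)) [set q | nrm (q - p) < d].
Proof.
by move=> h1 h2 k q /= hq; apply: (dquot_diff _ _).1; apply: hf; [exact: h1|exact: h2].
Qed.

Lemma holo_D v : holomorphic_on ('D_v f) U.
Proof.
move=> p Up; have [d [t0 [d0 t00 h1 h2 h3]]] := dquot_luc v Up.
have := weierstrass (@ball_open p d) (dquot_holo h1 h2) h3.
by apply; rewrite /= subrr nrm0.
Qed.

End Derivatives.

(** The [w]-derivative of the [v]-quotient of [f] is the [v]-quotient of the [w]-derivative. In the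
    limit the left side converges by Weierstrass' theorem, the right side because ['D_w f] is
    holomorphic. *)
Lemma holo_DC (R : realType) (V : normedModType (Cplx R)) (f : V -> Cplx R)
    (U : set V) p v w :
  open U -> holomorphic_on f U -> U p -> 'D_w ('D_v f) p = 'D_v ('D_w f) p.
Proof.
move=> oU hf Up; have [d [t0 [d0 t00 h1 h2 h3]]] := dquot_luc oU hf v Up.
have pd : nrm (p - p) < d by rewrite subrr nrm0.
have [_ /(_ w) H] :=
  weierstrass_pt (@ball_open _ _ p d) (dquot_holo hf h1 h2) h3 pd.
apply/eqP; rewrite -subr_eq0; apply/eqP/cabs_eq0/eqP; rewrite eq_le cabs_ge0 andbT.
apply/ler_addgt0Pr => e e0; rewrite add0r.
have e2 : 0 < e / 2 by rewrite divr_gt0.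
have [N hN] := H _ e2.
have [M hM] := @dquot_cvg _ _ ('D_w f) v p t0 (e / 2) t00 e2 (@holo_D _ _ f U oU hf w p Up).
have := hN (maxn N M) (leq_maxl _ _); have := hM (maxn N M) (leq_maxr _ _).
have [_ ->] := @dquot_diff _ _ f v (t0 / 2 ^+ maxn N M) p (hf _ Up) (hf _ (h2 _ _ pd)).
move=> h4 h5; rewrite [leRHS](splitr e); exact: cabs_tri h5 h4.
Qed.

(** * Dyadic Riemann sums on the unit interval *)

Section RiemannSums.
Variable R : realType.
Local Notation C := (Cplx R).

(* Left Riemann sum over the dyadic subdivision of [0, 1] into [2 ^ N] pieces. *)
Fixpoint rsum N (phi : R -> C) : C :=
  if N is N'.+1 then
    (rsum N' (fun s => phi (s / 2)) + rsum N' (fun s => phi ((s + 1) / 2))) / 2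
  else phi 0.

Lemma half01 (s : R) : 0 <= s <= 1 -> 0 <= s / 2 <= 1 /\ 0 <= (s + 1) / 2 <= 1.
Proof. by move=> ?; split; lra. Qed.

Lemma cabs_half (z w : C) : cabs ((z + w) / 2) <= (cabs z + cabs w) / 2.
Proof.
rewrite cabsM cabsV cabs_nat ler_wpM2r ?invr_ge0//; exact: cabsD.
Qed.

Lemma rsum_le N (phi : R -> C) (B : R) :
  (forall s, 0 <= s <= 1 -> cabs (phi s) <= B) -> cabs (rsum N phi) <= B.
Proof.
elim: N phi => [|N IH] phi h /=; first by apply: h; lra.
rewrite (le_trans (cabs_half _ _))//.
have := IH (fun s => phi (s / 2)) (fun s hs => h _ (half01 hs).1).
have := IH (fun s => phi ((s + 1) / 2)) (fun s hs => h _ (half01 hs).2).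
lra.
Qed.

Lemma rsum_step N (phi : R -> C) (K : R) :
  (forall s s', 0 <= s <= 1 -> 0 <= s' <= 1 -> cabs (phi s - phi s') <= K * `|s - s'|) ->
  cabs (rsum N.+1 phi - rsum N phi) <= K / 2 ^+ N.+1.
Proof.
elim: N phi K => [|N IH] phi K h.
  have -> : rsum 1 phi - rsum 0 phi = (0 + (phi ((0 + 1) / 2) - phi (0 / 2))) / 2.
    by rewrite /= !mul0r; field.
  rewrite (le_trans (cabs_half _ _))// cabs0 expr1.
  have : cabs (phi ((0 + 1) / 2) - phi (0 / 2)) <= K * `|(0 + 1) / 2 - 0 / 2|.
    by apply: h; lra.
  have : 0 <= K.
    have := h 1 0; rewrite subr0 normr1 mulr1 => H.
    by apply: le_trans (cabs_ge0 _) (H _ _); lra.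
  by rewrite ger0_norm; lra.
have -> : rsum N.+2 phi - rsum N.+1 phi =
  ((rsum N.+1 (fun s => phi (s / 2)) - rsum N (fun s => phi (s / 2))) +
   (rsum N.+1 (fun s => phi ((s + 1) / 2)) - rsum N (fun s => phi ((s + 1) / 2)))) / 2.
  by rewrite -[rsum N.+2 phi]/((rsum N.+1 _ + rsum N.+1 _) / 2)
    -[rsum N.+1 phi]/((rsum N _ + rsum N _) / 2); ring.
rewrite (le_trans (cabs_half _ _))//.
have half (s s' : R) : `|s / 2 - s' / 2| = 2^-1 * `|s - s'|.
  by rewrite -mulrBl normrM [X in _ * X]ger0_norm ?invr_ge0// mulrC.
have := IH (fun s => phi (s / 2)) (K / 2) _.
have := IH (fun s => phi ((s + 1) / 2)) (K / 2) _.
have -> : K / 2 ^+ N.+2 = K / 2 / 2 ^+ N.+1 by rewrite [in LHS]exprS invfM mulrA.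
set a := cabs _; set b := cabs _ => H1 H2.
suff : b <= K / 2 / 2 ^+ N.+1 /\ a <= K / 2 / 2 ^+ N.+1 by lra.
split.
- apply: H2 => s s' hs hs'; rewrite -mulrA -half h ?(half01 _).1//.
- apply: H1 => s s' hs hs'; have -> : s - s' = (s + 1) - (s' + 1) by ring.
  by rewrite -mulrA -half h ?(half01 _).2.
Qed.

(** On either half the rescaled pair, with [Psi] doubled, satisfies the hypothesis with [K / 2]: the
    square contributes 1/4 and the doubling 2. So the error halves at each subdivision. *)
Lemma rsum_ftc N (Psi psi : R -> C) (K : R) :
  (forall s s', 0 <= s <= 1 -> 0 <= s' <= 1 ->
    cabs (Psi s' - Psi s - rC (s' - s) * psi s) <= K * `|s' - s| ^+ 2) ->
  cabs (rsum N psi - (Psi 1 - Psi 0)) <= K / 2 ^+ N.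
Proof.
elim: N Psi psi K => [|N IH] Psi psi K h.
  have := h 0 1; rewrite subr0 rC1 mul1r normr1 expr1n mulr1 expr0 divr1 cabsB /=.
  by apply; lra.
have -> : rsum N.+1 psi - (Psi 1 - Psi 0) =
  ((rsum N (fun s => psi (s / 2)) - (2 * Psi (1 / 2) - 2 * Psi (0 / 2))) +
   (rsum N (fun s => psi ((s + 1) / 2)) -
     (2 * Psi ((1 + 1) / 2) - 2 * Psi ((0 + 1) / 2)))) / 2.
  have -> : (1 + 1) / 2 = 1 :> R by field.
  by rewrite add0r mul0r /=; field.
rewrite (le_trans (cabs_half _ _))//.
have := IH (fun s => 2 * Psi (s / 2)) (fun s => psi (s / 2)) (K / 2) _.
have := IH (fun s => 2 * Psi ((s + 1) / 2)) (fun s => psi ((s + 1) / 2)) (K / 2) _.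
have -> : K / 2 ^+ N.+1 = K / 2 / 2 ^+ N by rewrite [in LHS]exprS invfM mulrA.
rewrite /=.
set a := cabs _; set b := cabs _ => H1 H2.
have est (x x' y : R) (u v w : C) : x' - x = 2 * y ->
    cabs (u - v - rC y * w) <= K * `|y| ^+ 2 ->
    cabs (2 * u - 2 * v - rC (x' - x) * w) <= K / 2 * `|x' - x| ^+ 2.
  move=> -> H; rewrite rCM rCn.
  have -> : 2 * u - 2 * v - 2 * rC y * w = 2 * (u - v - rC y * w) by ring.
  rewrite cabsM cabs_nat normrM normr_nat exprMn.
  have -> : K / 2 * (2 ^+ 2 * `|y| ^+ 2) = 2 * (K * `|y| ^+ 2) by field.
  by rewrite ler_pM2l.
suff : b <= K / 2 / 2 ^+ N /\ a <= K / 2 / 2 ^+ N by lra.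
split.
- apply: H2 => s s' hs hs'; apply: (est _ _ (s' / 2 - s / 2)); first by field.
  by apply: h; apply: (half01 _).1.
- apply: H1 => s s' hs hs'; apply: (est _ _ ((s' + 1) / 2 - (s + 1) / 2)).
    by field.
  by apply: h; apply: (half01 _).2.
Qed.

(** Supplies the quadratic remainder that [rsum_ftc] asks for: the mean value inequality is applied
    to [Psi] minus its linear part at [a]. *)
Lemma taylor_lip (Psi psi : R -> C) (K : R) (a b : R) : 0 <= K ->
  (forall s, 0 <= s <= 1 -> forall e : R, 0 < e -> exists2 d : R, 0 < d &
    forall h, `|h| < d -> cabs (Psi (s + h) - Psi s - rC h * psi s) <= e * `|h|) ->
  (forall s s', 0 <= s <= 1 -> 0 <= s' <= 1 -> cabs (psi s - psi s') <= K * `|s - s'|) ->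
  0 <= a <= 1 -> 0 <= b <= 1 ->
  cabs (Psi b - Psi a - rC (b - a) * psi a) <= K * `|b - a| ^+ 2.
Proof.
move=> K0 dPsi lip ha hb; pose y := b - a.
have seg (x : R) : 0 <= x <= 1 -> 0 <= a + x * y <= 1.
  rewrite /y; move: ha hb => /andP[a0 a1] /andP[b0 b1] /andP[x0 x1].
  have -> : a + x * (b - a) = (1 - x) * a + x * b by ring.
  have x1' : 0 <= 1 - x by rewrite subr_ge0.
  rewrite addr_ge0 ?mulr_ge0//=.
  have : (1 - x) * a <= (1 - x) * 1 by rewrite ler_wpM2l.
  have : x * b <= x * 1 by rewrite ler_wpM2l.
  lra.
have H := @mvtC R (fun x => Psi (a + x * y) - rC (x * y) * psi a)
  (fun x => rC y * (psi (a + x * y) - psi a))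
  (fun x => (K * `|y| ^+ 2) * x) (fun=> K * `|y| ^+ 2) 0 1 ler01.
have -> : Psi b - Psi a - rC (b - a) * psi a =
  Psi (a + 1 * y) - rC (1 * y) * psi a - (Psi (a + 0 * y) - rC (0 * y) * psi a).
  by rewrite !mul1r !mul0r addr0 subr0 /y [a + _]addrC subrK addrAC.
have -> : K * `|b - a| ^+ 2 = K * `|y| ^+ 2 * 1 - K * `|y| ^+ 2 * 0 by rewrite /y; ring.
apply: H.
- move=> x hx e e0; have y1 : 0 < `|y| + 1 by rewrite ltr_wpDl.
  have [d d0 hd] := dPsi _ (seg x hx) _ (divr_gt0 e0 y1).
  exists (d / (`|y| + 1)); first exact: divr_gt0.
  move=> h; rewrite ltr_pdivlMr// => hh.
  have -> : Psi (a + (x + h) * y) - rC ((x + h) * y) * psi a -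
    (Psi (a + x * y) - rC (x * y) * psi a) - rC h * (rC y * (psi (a + x * y) - psi a)) =
    Psi (a + x * y + h * y) - Psi (a + x * y) - rC (h * y) * psi (a + x * y).
    by rewrite mulrDl addrA !(rCD, rCM); ring.
  rewrite (le_trans (hd _ _))// normrM.
    by apply: le_lt_trans hh; rewrite ler_wpM2l// lerDl.
  have -> : e / (`|y| + 1) * (`|h| * `|y|) = e * `|h| * (`|y| / (`|y| + 1)) by ring.
  apply: ler_piMr; first by rewrite mulr_ge0// ltW.
  by rewrite ler_pdivrMr// mul1r lerDl.
- move=> x _; apply: is_derive_intro => e e0; exists 1 => // h _.
  have -> : K * `|y| ^+ 2 * (x + h) - K * `|y| ^+ 2 * x - h * (K * `|y| ^+ 2) = 0 by ring.
  by rewrite normr0 mulr_ge0// ltW.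
- move=> x hx; rewrite cabsM cabs_rC expr2 mulrCA ler_wpM2l//.
  rewrite (le_trans (lip _ _ (seg x hx) ha))// addrC addKr normrM.
  rewrite ler_wpM2l// ler_piMl//; case/andP: hx => x0 x1; by rewrite ger0_norm.
Qed.

End RiemannSums.

(** * Integrals depending holomorphically on a parameter *)

Section Integral.
Variable R : realType.
Local Notation C := (Cplx R).
Variable V : normedModType C.

Lemma rsum_holo N (H : R -> V -> C) p :
  (forall s, 0 <= s <= 1 -> differentiable (H s) p) ->
  differentiable (fun q => rsum N (H ^~ q)) p /\
  forall v, 'D_v (fun q => rsum N (H ^~ q)) p = rsum N (fun s => 'D_v (H s) p).
Proof.
elim: N H => [|N IH] H dH /=; first by split=> //; apply: dH; lra.
have [d1 e1] := IH (fun s => H (s / 2)) (fun s hs => dH _ (half01 hs).1).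
have [d2 e2] := IH (fun s => H ((s + 1) / 2)) (fun s hs => dH _ (half01 hs).2).
set g1 := fun q => rsum N _ in d1 e1; set g2 := fun q => rsum N _ in d2 e2.
have d3 : differentiable (g1 + g2) p by exact: differentiableD.
split.
  apply: (@differentiableM _ _ (g1 + g2) (cst (2^-1))) => //.
move=> v; have := @deriveM _ _ (g1 + g2) (cst (2^-1)) p v (diff_derivable d3)
   (derivable_cst _ _ _).
rewrite derive_cst scaler0 add0r deriveD ?e1 ?e2; [|exact: diff_derivable..].
by move=> E; rewrite mulrC; exact: E.
Qed.

Variables (H : R -> V -> C) (U : set V).
Hypotheses (oU : open U) (hH : forall s, 0 <= s <= 1 -> holomorphic_on (H s) U)
  (lH : forall p, U p -> exists2 d : R, 0 < d & exists2 K : R, 0 <= K &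
    forall q, nrm (q - p) < d -> forall s s', 0 <= s <= 1 -> 0 <= s' <= 1 ->
      cabs (H s q - H s' q) <= K * `|s - s'|).

Let RS N q := rsum N (H ^~ q).

Let RS_holo N : holomorphic_on (RS N) U.
Proof. by move=> p Up; apply: (rsum_holo _ _).1 => s hs; exact: hH. Qed.

Let RS_lim q : U q -> exists l, forall e : R, 0 < e -> exists N, forall i, (N <= i)%N ->
  cabs (RS i q - l) <= e.
Proof.
move=> Uq; have [d d0 [K K0 hK]] := lH Uq.
have qd : nrm (q - q) < d by rewrite subrr nrm0.
have [l hl] := geo_cvg K0 (fun N => rsum_step N (hK q qd)).
exists l => e e0; have [N hN] := half_small K0 e0; exists N => i hi.
by rewrite (le_trans (hl i))// ltW// hN.
Qed.

(** [J] is the limit of the Riemann sums over [[0, 1]]. The last clause differentiates under the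
    integral sign and evaluates the outcome at once from a primitive in [s], so the integral of the
    derivative needs no name. *)
Lemma integral_holo : exists J : V -> C, [/\ holomorphic_on J U,
  forall p (B : R), U p -> (forall s, 0 <= s <= 1 -> cabs (H s p) <= B) ->
    cabs (J p) <= B &
  forall p v (Psi : C -> C), U p ->
    (forall s, 0 <= s <= 1 -> differentiable Psi (rC s) /\
       'D_1 Psi (rC s) = 'D_v (H s) p) ->
    'D_v J p = Psi 1 - Psi 0].
Proof.
pose J q := if pselect (U q) is left Uq then projT1 (cid (RS_lim Uq)) else 0.
have hJ q : U q -> forall e : R, 0 < e -> exists N, forall i, (N <= i)%N ->
    cabs (RS i q - J q) <= e.
  rewrite /J => Uq; case: pselect => // Uq'; exact: (projT2 (cid (RS_lim Uq'))).
have cv : luc RS J U.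
  move=> p Up; have [d1 d10 h1] := open_nrm oU Up.
  have [d2 d20 [K K0 hK]] := lH Up.
  exists (Num.min d1 d2); first by rewrite lt_min d10.
  move=> e e0; have [N hN] := half_small K0 e0; exists N => k Nk q.
  rewrite lt_min => /andP[q1 q2].
  rewrite (le_trans _ (ltW (hN k Nk)))//.
  apply/ler_addgt0Pr => e1 e10; have [M hM] := hJ q (h1 q q1) e1 e10.
  pose j := maxn k M.
  rewrite -(subrKA (RS j q)) (le_trans (cabsD _ _))// lerD//; last first.
    by rewrite hM// leq_maxr.
  rewrite cabsB (le_trans (geo_tail K0 (fun N => rsum_step N (hK q q2)) (leq_maxl k M)))//.
  by rewrite gerBl divr_ge0// exprn_ge0.
exists J; split.
- exact: weierstrass oU RS_holo cv.
- move=> p B Up hB; apply: cabs_lim_le (hJ p Up) _.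
  by exists 0%N => i _; apply: rsum_le.
move=> p v Psi Up hPsi.
have [_ /(_ v) hD] := weierstrass_pt oU RS_holo cv Up.
have [d d0 [K K0 hK]] := lH Up.
have [d1 d10 h1] := open_nrm oU Up.
pose r := Num.min d d1; have r0 : 0 < r by rewrite lt_min d0.
pose K' := 4 * K / r * nrm v.
have K'0 : 0 <= K'.
  apply: mulr_ge0 (nrm_ge0 v); apply: divr_ge0; [exact: mulr_ge0 | exact: ltW].
have lipD s s' : 0 <= s <= 1 -> 0 <= s' <= 1 ->
    cabs ('D_v (H s) p - 'D_v (H s') p) <= K' * `|s - s'|.
  move=> hs hs'.
  have -> : K' * `|s - s'| = 4 * (K * `|s - s'|) / r * nrm v by rewrite /K'; ring.
  apply: (@D_close _ _ _ _ p p v r _ r0).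
  - by move=> q; rewrite lt_min => /andP[_ /h1]; exact: hH.
  - by move=> q; rewrite lt_min => /andP[_ /h1]; exact: hH.
  - by move=> q; rewrite lt_min => /andP[hq _]; exact: hK.
  - by rewrite subrr nrm0 divr_gt0.
have dPsi s : 0 <= s <= 1 -> forall e : R, 0 < e -> exists2 d : R, 0 < d &
    forall h, `|h| < d ->
      cabs (Psi (rC (s + h)) - Psi (rC s) - rC h * 'D_v (H s) p) <= e * `|h|.
  move=> hs e e0; have [dP <-] := hPsi s hs.
  have [t t0 ht] := diff_est dP e0; exists t => // h hh.
  have := ht (rC h); rewrite !nrmC cabs_rC D_1// rCD; exact.
have ftc N := rsum_ftc N (fun s s' hs hs' => taylor_lip K'0 dPsi lipD hs hs').
apply/eqP; rewrite -subr_eq0; apply/eqP/cabs_eq0/eqP; rewrite eq_le cabs_ge0 andbT.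
apply/ler_addgt0Pr => e e0; rewrite add0r.
have e2 : 0 < e / 2 by rewrite divr_gt0.
have [N1 hN1] := hD _ e2; have [N2 hN2] := half_small K'0 e2.
pose N := maxn N1 N2.
have := hN1 N (leq_maxl _ _); have := hN2 N (leq_maxr _ _); have := ftc N.
have [_ ->] := rsum_holo N (fun s hs => hH hs Up).
rewrite rC1 rC0 => H1 H2 H3.
rewrite [leRHS](splitr e); apply: cabs_tri H3 _.
exact: le_trans H1 (ltW H2).
Qed.

End Integral.

(** * Primitives along a direction, from minus infinity or from a base point *)

Section Primitives.
Variable R : realType.
Local Notation C := (Cplx R).
Variables (V : normedModType C) (e : V).

Lemma lip_seg (f : V -> C) (a b : V) (d B : R) : 0 < d ->
  (forall x q, 0 <= x <= 1 -> nrm (q - (b + rC x *: (a - b))) < d ->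
     differentiable f q /\ cabs (f q) <= B) ->
  cabs (f a - f b) <= 2 * B / d * nrm (a - b).
Proof.
move=> d0 H; have -> : f a - f b = f (b + (a - b)) - f b by rewrite [b + _]addrC subrK.
apply: lip_line => x hx; have h0 : nrm (b + rC x *: (a - b) - (b + rC x *: (a - b))) < d.
- by rewrite subrr nrm0.
- exact: (H x _ hx h0).1.
- by rewrite subrr nrm0.
- by apply: cauchy_ball => // q /(H x q hx)[].
Qed.

Section Left.
Variables (U : set V) (f : V -> C) (mu : R).

Definition shiftl (q : V) (t : R) : V := q - rC t *: e.

Lemma shiftlD q s t : shiftl (shiftl q s) t = shiftl q (s + t).
Proof. by rewrite /shiftl rCD scalerDl opprD addrA. Qed.

Lemma shiftl0 q : shiftl q 0 = q.
Proof. by rewrite /shiftl rC0 scale0r subr0. Qed.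

Lemma shiftlN q t : q + rC (- t) *: e = shiftl q t.
Proof. by rewrite /shiftl rCN scaleNr. Qed.

Lemma D_shiftl (g : V -> C) q t : differentiable g (shiftl q t) ->
  differentiable (fun q => g (shiftl q t)) q /\
  forall w, 'D_w (fun q => g (shiftl q t)) q = 'D_w g (shiftl q t).
Proof.
move=> dg; have -> : (fun q => g (shiftl q t)) = (fun q => g (q + rC (- t) *: e)).
  by apply/funext => q'; rewrite shiftlN.
by rewrite -shiftlN; apply: holo_shift; rewrite shiftlN.
Qed.

Hypotheses (oU : open U) (lU : forall p t, U p -> 0 <= t -> U (shiftl p t))
  (hf : holomorphic_on f U) (mu0 : 0 < mu)
  (gf : forall p, U p -> exists2 d : R, 0 < d & exists B : R, forall q t,
     nrm (q - p) < d -> 0 <= t -> cabs (f (shiftl q t)) <= B * expR (- (mu * t))).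

Let T := mu^-1.
Let T0 : 0 < T. Proof. by rewrite invr_gt0. Qed.

Let unif p : U p -> exists2 d : R, 0 < d & exists2 B : R, 0 <= B &
  forall q t, nrm (q - p) < d -> 0 <= t ->
    U (shiftl q t) /\ cabs (f (shiftl q t)) <= B * expR (- (mu * t)).
Proof.
move=> Up; have [d1 d10 h1] := open_nrm oU Up; have [d2 d20 [B hB]] := gf Up.
exists (Num.min d1 d2); first by rewrite lt_min d10.
exists B.
  have := hB p 0; rewrite mulr0 oppr0 expR0 mulr1 subrr nrm0 => H.
  exact: le_trans (cabs_ge0 _) (H d20 (lexx _)).
move=> q t; rewrite lt_min => /andP[q1 q2] t0; split; last exact: hB.
by apply: lU => //; exact: h1.
Qed.

Let B1 (B t : R) : 0 <= B -> 0 <= t -> B * expR (- (mu * t)) <= B.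
Proof.
by move=> B0 t0; rewrite ler_piMr// expR_le1 oppr_le0 mulr_ge0// ltW.
Qed.

(** Integrand for the stretch of length [T] that ends at [q], rescaled to [[0, 1]]. *)
Let H (s : R) (q : V) : C := rC T * f (shiftl q (s * T)).

Let D_H s q : 0 <= s -> U q -> differentiable (H s) q /\
  forall w, 'D_w (H s) q = rC T * 'D_w f (shiftl q (s * T)).
Proof.
move=> s0 Uq; have df : differentiable f (shiftl q (s * T)).
  by apply/hf/lU => //; rewrite mulr_ge0// ltW.
have [d1 d2] := D_shiftl df; split.
  by apply: (@differentiableM _ _ (cst (rC T)) (fun q => f (shiftl q (s * T)))).
move=> w; have := @deriveM _ _ (cst (rC T)) (fun q => f (shiftl q (s * T))) q w
   (derivable_cst _ _ _) (diff_derivable d1).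
by rewrite derive_cst scaler0 addr0 d2; exact.
Qed.

Let exJ : exists J : V -> C, [/\ holomorphic_on J U,
  forall p B, U p -> (forall s, 0 <= s <= 1 -> cabs (H s p) <= B) -> cabs (J p) <= B &
  forall p, U p -> 'D_e J p = f p - f (shiftl p T)].
Proof.
have [||J [J1 J2 J3]] := @integral_holo R V H U oU.
- by move=> s /andP[s0 _] q /(D_H s0)[].
- move=> p Up; have [d d0 [B B0 hB]] := unif Up.
  exists (d / 2); first by rewrite divr_gt0.
  exists (T * (2 * B / (d / 2)) * (T * nrm e)).
    have X : 0 <= 2 * B / (d / 2).
      by apply: divr_ge0; [exact: mulr_ge0 | rewrite divr_ge0// ltW].
    exact: mulr_ge0 (mulr_ge0 (ltW T0) X) (mulr_ge0 (ltW T0) (nrm_ge0 e)).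
  move=> q hq s s' /andP[s0 s1] /andP[s'0 s'1].
  rewrite /H -mulrBr cabsM cabs_rC gtr0_norm// -!mulrA ler_pM2l//.
  have E : shiftl q (s * T) - shiftl q (s' * T) = rC (s' * T - s * T) *: e.
    by rewrite /shiftl rCB scalerBl opprB addrC addrA subrK.
  have := @lip_seg f (shiftl q (s * T)) (shiftl q (s' * T)) (d / 2) B.
  rewrite E nrmZ cabs_rC -mulrBl normrM (gtr0_norm T0) [`|s' - s|]distrC => X.
  rewrite (le_trans (X _ _))//; first by rewrite divr_gt0.
    move=> x y /andP[x0 x1].
    have -> : shiftl q (s' * T) + rC x *: (rC ((s' - s) * T) *: e) =
       shiftl q (s' * T - x * ((s' - s) * T)).
      by rewrite scalerA -rCM -shiftlD -[RHS]shiftlN opprK.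
    set t := s' * T - _; have t0 : 0 <= t.
      have -> : t = ((1 - x) * s' + x * s) * T by rewrite /t; ring.
      have x1' : 0 <= 1 - x by rewrite subr_ge0.
      by rewrite mulr_ge0 ?addr_ge0 ?mulr_ge0// ltW.
    move=> hy; have -> : y = shiftl (y + rC t *: e) t by rewrite /shiftl addrK.
    have hy' : nrm (y + rC t *: e - p) < d.
      rewrite -(subrKA q) (le_lt_trans (nrmD _ _))// [ltRHS](splitr d) ltrD//.
      by move: hy; rewrite /shiftl opprB addrA.
    have [U1 f1] := hB _ _ hy' t0; split; first exact: hf.
    exact: le_trans f1 (B1 B0 t0).
  by rewrite le_eqVlt; apply/orP; left; apply/eqP; ring.
exists J; split=> // p Up.
rewrite (J3 p e (fun z => - f (p - (z * rC T) *: e)) Up).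
  by rewrite opprK mul0r scale0r subr0 mul1r addrC.
move=> s /andP[s0 s1].
have df : differentiable f (shiftl p (s * T)).
  by apply/hf/lU => //; rewrite mulr_ge0// ltW.
have := @line_diff R V f p (- rC T *: e) (rC s).
have -> : p + rC s *: (- rC T *: e) = shiftl p (s * T).
  by rewrite scalerA mulrN -rCM scaleNr.
move=> /(_ df)[d1 d2].
have -> : (fun z : C => - f (p - (z * rC T) *: e)) =
    - (fun z : C => f (p + z *: (- rC T *: e))).
  by apply/funext => z; rewrite -[RHS]/(- f _) scalerA mulrN scaleNr.
split; first exact: differentiableN.
rewrite deriveN; last exact: diff_derivable.
by rewrite d2 (D_H s0 Up).2 D_scale// -[_ *: _]/(- rC T * _) mulNr opprK.
Qed.

(** The integral from minus infinity is summed over consecutive stretches of length [T = 1 / mu]. On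
    the stretch of number [n] the decay of [f] gives a factor [exp (- n) <= 2 ^- n], hence geometric
    convergence, and the derivatives telescope. The last clause compares [v] with [Phi] on a long
    segment, at whose far end [v] is negligible and [Phi] nonnegative. *)
Lemma primitive_left : exists v : V -> C, [/\ holomorphic_on v U,
  forall p, U p -> 'D_e v p = f p &
  forall p (Phi dPhi : R -> R), U p ->
    (forall x : R, x <= 0 -> is_derive x 1 Phi (dPhi x)) ->
    (forall x : R, x <= 0 -> 0 <= Phi x) ->
    (forall x : R, x <= 0 -> cabs (f (p + rC x *: e)) <= dPhi x) ->
    cabs (v p) <= Phi 0].
Proof.
have [J [J1 J2 J3]] := exJ.
pose fix vn (n : nat) (q : V) {struct n} : C := if n is n'.+1 then vn n' q + J (shiftl q (n'%:R * T)) else 0.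
have vnS n : vn n.+1 = vn n + (fun q => J (shiftl q (n%:R * T))) by [].
have nT0 (n : nat) : 0 <= n%:R * T by rewrite mulr_ge0// ltW.
have [vn1 vn2] : (forall n, holomorphic_on (vn n) U) /\
    forall n q, U q -> 'D_e (vn n) q = f q - f (shiftl q (n%:R * T)).
  have dJ n q : U q -> differentiable J (shiftl q (n%:R * T)).
    by move=> Uq; apply/J1/lU.
  have h1 n : holomorphic_on (vn n) U.
    elim: n => [|n IH] q Uq; first exact: differentiable_cst.
    rewrite vnS; apply: differentiableD; first exact: IH.
    exact: (D_shiftl (dJ n q Uq)).1.
  split=> // n; elim: n => [|n IH] q Uq.
    rewrite mul0r shiftl0 subrr; exact: derive_cst.
  have [d1 d2] := D_shiftl (dJ n q Uq).
  rewrite vnS deriveD; [|exact/diff_derivable/h1|exact: diff_derivable].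
  rewrite IH// d2 J3; last exact: lU.
  rewrite shiftlD; have -> : n%:R * T + T = n.+1%:R * T by rewrite -natr1; ring.
  ring.
have vstep q (B : R) : U q -> 0 <= B ->
    (forall t, 0 <= t -> cabs (f (shiftl q t)) <= B * expR (- (mu * t))) ->
    forall n, cabs (vn n.+1 q - vn n q) <= 2 * T * B / 2 ^+ n.+1.
  move=> Uq B0 hB n; rewrite vnS -[(_ + _) q]/(vn n q + _) addrC addKr.
  apply: J2; first exact: lU.
  move=> s /andP[s0 s1]; rewrite /H shiftlD cabsM cabs_rC gtr0_norm//.
  have st0 : 0 <= s * T by rewrite mulr_ge0// ltW.
  have -> : 2 * T * B / 2 ^+ n.+1 = T * (B / 2 ^+ n).
    by rewrite exprS; field; rewrite expf_neq0.
  rewrite ler_pM2l// (le_trans (hB _ (addr_ge0 (nT0 n) st0)))// ler_wpM2l//.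
  have -> : mu * (n%:R * T + s * T) = n%:R * 1 + s.
    by rewrite /T; field; rewrite gt_eqF.
  rewrite opprD expRD; apply: (@le_trans _ _ (expR (- (n%:R * 1)))).
    by rewrite ler_piMr ?expR_ge0// expR_le1 oppr_le0.
  rewrite expRN lef_pV2 ?posrE ?expR_gt0 ?exprn_gt0// expRM_natl.
  rewrite lerXn2r ?nnegrE ?expR_ge0//.
  by have := expR_ge1Dx (1 : R); have -> : 1 + 1 = 2 :> R by ring.
have TB (B : R) : 0 <= B -> 0 <= 2 * T * B by move=> B0; exact: mulr_ge0 (mulr_ge0 (ler0n _ 2) (ltW T0)) B0.
have lim q : U q -> exists l, forall B : R, 0 <= B ->
    (forall t, 0 <= t -> cabs (f (shiftl q t)) <= B * expR (- (mu * t))) ->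
    forall i, cabs (vn i q - l) <= 2 * T * B / 2 ^+ i.
  move=> Uq; have [d d0 [B B0 hB]] := unif Uq.
  have qd : nrm (q - q) < d by rewrite subrr nrm0.
  have [l hl] := geo_cvg (TB _ B0) (vstep q B Uq B0 (fun t t0 => (hB q t qd t0).2)).
  exists l => B' B'0 hB' i; apply/ler_addgt0Pr => e1 e10.
  have [N hN] := half_small (TB _ B0) e10; pose j := maxn i N.
  rewrite -(subrKA (vn j q)) (le_trans (cabsD _ _))// lerD//.
    rewrite cabsB.
    rewrite (le_trans (geo_tail (TB _ B'0) (vstep q B' Uq B'0 hB') (leq_maxl i N)))//.
    by rewrite gerBl divr_ge0 ?TB// exprn_ge0.
  by rewrite (le_trans (hl j))// ltW// hN// leq_maxr.
pose v q := if pselect (U q) is left Uq then projT1 (cid (lim q Uq)) else 0.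
have hv q : U q -> forall B : R, 0 <= B ->
    (forall t, 0 <= t -> cabs (f (shiftl q t)) <= B * expR (- (mu * t))) ->
    forall i, cabs (vn i q - v q) <= 2 * T * B / 2 ^+ i.
  rewrite /v => Uq; case: pselect => // Uq'; exact: (projT2 (cid (lim q Uq'))).
have cv : luc vn v U.
  move=> p Up; have [d d0 [B B0 hB]] := unif Up; exists d => // e1 e10.
  have [N hN] := half_small (TB _ B0) e10; exists N => k Nk q hq.
  have Uq : U q by have [] := hB q 0 hq (lexx _); rewrite shiftl0.
  rewrite (le_trans _ (ltW (hN k Nk)))//; apply: hv => //.
  by move=> t t0; exact: (hB q t hq t0).2.
have holv := weierstrass oU vn1 cv.
have Dv p : U p -> 'D_e v p = f p.
  move=> Up; have [_ /(_ e) hD] := weierstrass_pt oU vn1 cv Up.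
  have [d d0 [B B0 hB]] := unif Up.
  apply/eqP; rewrite -subr_eq0; apply/eqP/cabs_eq0/eqP; rewrite eq_le cabs_ge0 andbT.
  apply/ler_addgt0Pr => e1 e10; rewrite add0r.
  have e2 : 0 < e1 / 2 by rewrite divr_gt0.
  have [N1 hN1] := hD _ e2; have [N2 hN2] := half_small B0 e2.
  pose n := maxn N1 N2; have := hN1 n (leq_maxl _ _); rewrite vn2// => A1.
  have pd : nrm (p - p) < d by rewrite subrr nrm0.
  have A2 : cabs (f (shiftl p (n%:R * T))) <= e1 / 2.
    apply: le_trans (hB p _ pd (nT0 n)).2 _.
    rewrite (le_trans _ (ltW (hN2 n (leq_maxr _ _))))// ler_wpM2l//.
    have -> : mu * (n%:R * T) = n%:R * 1 by rewrite /T; field; rewrite gt_eqF.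
    rewrite expRN lef_pV2 ?posrE ?expR_gt0 ?exprn_gt0// expRM_natl.
    rewrite lerXn2r ?nnegrE ?expR_ge0//.
    by have := expR_ge1Dx (1 : R); have -> : 1 + 1 = 2 :> R by ring.
  rewrite [leRHS](splitr e1); apply: cabs_tri A1 _.
  by rewrite addrC addKr cabsN.
exists v; split=> // p Phi dPhi Up hPhi Phi0 hf'.
apply/ler_addgt0Pr => e1 e10.
have [d d0 [B B0 hB]] := unif Up.
have [n /(_ n (leqnn _)) hn] := half_small (TB _ B0) e10.
have pd : nrm (p - p) < d by rewrite subrr nrm0.
have nTN : - (n%:R * T) <= 0 by rewrite oppr_le0.
have inU x : x <= 0 -> U (p + rC x *: e).
  by move=> x0; rewrite -(opprK x) shiftlN; apply: lU => //; rewrite oppr_ge0.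
have := @mvt_line R V v p e Phi dPhi (- (n%:R * T)) 0 nTN.
rewrite rC0 scale0r addr0 shiftlN => M.
have {}M : cabs (v p - v (shiftl p (n%:R * T))) <= Phi 0 - Phi (- (n%:R * T)).
  apply: M => x /andP[_ x0]; [exact/holv/inU | exact: hPhi |].
  by rewrite Dv; [exact: hf' | exact: inU].
have A : cabs (v (shiftl p (n%:R * T))) <= 2 * T * (B / 2 ^+ n).
  have B'0 : 0 <= B / 2 ^+ n by rewrite divr_ge0// exprn_ge0.
  have := hv (shiftl p (n%:R * T)) (lU Up (nT0 n)) _ B'0.
  move=> /(_ _ 0%N); rewrite expr0 divr1 /= sub0r cabsN; apply=> t t0.
  rewrite shiftlD (le_trans (hB p _ pd (addr_ge0 (nT0 n) t0)).2)//.
  have -> : mu * (n%:R * T + t) = n%:R * 1 + mu * t.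
    by rewrite /T; field; rewrite gt_eqF.
  rewrite opprD expRD mulrA ler_wpM2r ?expR_ge0// ler_wpM2l//.
  rewrite expRN lef_pV2 ?posrE ?expR_gt0 ?exprn_gt0// expRM_natl.
  rewrite lerXn2r ?nnegrE ?expR_ge0//.
  by have := expR_ge1Dx (1 : R); have -> : 1 + 1 = 2 :> R by ring.
have := Phi0 _ nTN.
have := cabsD (v p - v (shiftl p (n%:R * T))) (v (shiftl p (n%:R * T))).
rewrite subrK; rewrite mulrA in A; lra.
Qed.

End Left.

Section Segment.
Variables (U : set V) (f : V -> C) (l : V -> C).
Hypotheses (oU : open U) (hf : holomorphic_on f U)
  (dl : forall p, differentiable l p /\ 'D_e l p = 1)
  (lE : forall p (z : C), l (p + z *: e) = l p + z).

(** [A s p] runs from the projection of [p] along [e] onto the zero set of [l], at [s = 0], to [p],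
    at [s = 1]. *)
Let A (s : R) (p : V) : V := p - (rC (1 - s) * l p) *: e.

Hypothesis locA : forall p, U p -> exists2 d : R, 0 < d & exists B : R,
  forall q s q', nrm (q - p) < d -> 0 <= s <= 1 -> nrm (q' - A s q) < d ->
    U q' /\ cabs (f q') <= B.

Let UA p s : U p -> 0 <= s <= 1 -> U (A s p).
Proof.
move=> Up hs; have [d d0 [B hB]] := locA Up.
by apply: (hB p s _ _ hs _).1; rewrite subrr nrm0.
Qed.

Let A_line s p (z : C) : A s (p + z *: e) = A s p + (rC s * z) *: e.
Proof.
rewrite /A lE mulrDr scalerDl opprD addrA [p + _ - _]addrAC -[LHS]addrA.
by congr (_ + _); rewrite -scalerBl; congr (_ *: _); rewrite rCB rC1; ring.
Qed.

Let dA s p : differentiable (A s) p.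
Proof.
apply: differentiableB => //.
apply: (@differentiableZl _ _ _ (fun p => rC (1 - s) * l p) e).
by apply: (@differentiableM _ _ (cst (rC (1 - s))) l) => //; have [] := dl p.
Qed.

Let H (s : R) (p : V) : C := f (A s p) * l p.

Let dH s p : U p -> 0 <= s <= 1 -> differentiable (H s) p.
Proof.
move=> Up hs; apply: (@differentiableM _ _ (f \o A s) l); last by have [] := dl p.
by apply: differentiable_comp; [exact: dA | exact/hf/UA].
Qed.

Let DH s p : U p -> 0 <= s <= 1 ->
  'D_e (H s) p = rC s * 'D_e f (A s p) * l p + f (A s p).
Proof.
move=> Up hs.
have dH0 : differentiable (H s) (p + (0 : C) *: e) by rewrite scale0r addr0; exact: dH.
have [_] := line_diff dH0; rewrite scale0r addr0 => <-.
have df0 : differentiable f (A s p + (0 : C) *: (rC s *: e)).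
  by rewrite scale0r addr0; exact/hf/UA.
have [d1] := line_diff df0; rewrite scale0r addr0 D_scale; last exact/hf/UA.
rewrite -[_ *: 'D_e _ _]/(rC s * _) => d2.
have d3 : differentiable (fun z : C => l p + z) (0 : C).
  by apply: (@differentiableD _ _ _ (cst (l p)) id).
have -> : (fun z : C => H s (p + z *: e)) =
    (fun z : C => f (A s p + z *: (rC s *: e))) * (fun z : C => l p + z).
  by apply/funext => z; rewrite /H A_line lE [rC s * z]mulrC -scalerA.
rewrite deriveM; [|exact: diff_derivable..].
rewrite d2 addr0 scale0r addr0.
have -> : 'D_1 (fun z : C => l p + z) (0 : C) = 1.
  have -> : (fun z : C => l p + z) = cst (l p) + id by [].
  by rewrite deriveD// derive_cst derive_id add0r.
rewrite -[f (A s p) *: 1]/(f (A s p) * 1) -[l p *: _]/(l p * _); ring.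
Qed.

Lemma primitive_segment : exists v : V -> C, [/\ holomorphic_on v U,
  forall p, U p -> 'D_e v p = f p &
  forall p (Phi dPhi : R -> R), U p ->
    (forall x : R, 0 <= x <= 1 -> is_derive x 1 Phi (dPhi x)) ->
    (forall x : R, 0 <= x <= 1 ->
       cabs (l p) * cabs (f (p - (rC (1 - x) * l p) *: e)) <= dPhi x) ->
    cabs (v p) <= Phi 1 - Phi 0].
Proof.
have [||J [J1 J2 J3]] := @integral_holo R V H U oU.
- by move=> s hs p Up; exact: dH.
- move=> p Up; have [d d0 [B hB]] := locA Up.
  have [d' d'0 hd'] := diff_cont (dl p).1 ltr01.
  pose L := cabs (l p) + 1; have L0 : 0 <= L by rewrite addr_ge0 ?cabs_ge0.
  exists (Num.min d d'); first by rewrite lt_min d0.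
  have h11 : 0 <= (1 : R) <= 1 by rewrite ler01 lexx.
  have B0 : 0 <= B.
    have p1 : nrm (p - p) < d by rewrite subrr nrm0.
    have p2 : nrm (A 1 p - A 1 p) < d by rewrite subrr nrm0.
    exact: le_trans (cabs_ge0 _) (hB p 1 _ p1 h11 p2).2.
  have X : 0 <= 2 * B / d by apply: divr_ge0; [exact: mulr_ge0 | exact: ltW].
  exists (2 * B / d * (L * nrm e) * L).
    exact: mulr_ge0 (mulr_ge0 X (mulr_ge0 L0 (nrm_ge0 e))) L0.
  move=> q; rewrite lt_min => /andP[hq hq'] s s' hs hs'.
  have lq : cabs (l q) <= L.
    have := hd' q hq'; rewrite nrmC => h.
    by rewrite -(subrK (l p) (l q)) (le_trans (cabsD _ _))// addrC lerD2l ltW.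
  have E x y : A x q - A y q = rC (x - y) *: (l q *: e).
    rewrite /A opprB addrC addrA subrK -scalerBl scalerA; congr (_ *: _).
    by rewrite !rCB; ring.
  rewrite /H -mulrBl cabsM.
  have := @lip_seg f (A s q) (A s' q) d B d0.
  rewrite E !nrmZ cabs_rC => Y.
  apply: (@le_trans _ _ (2 * B / d * (`|s - s'| * (cabs (l q) * nrm e)) * cabs (l q))).
    rewrite ler_wpM2r ?cabs_ge0//; apply: Y => x q' hx hq1.
    suff [U1 f1] : U q' /\ cabs (f q') <= B by split=> //; exact: hf.
    apply: (hB q (s' + x * (s - s'))) => //.
      move: hx hs hs' => /andP[x0 x1] /andP[s0 s1] /andP[t0 t1].
      have -> : s' + x * (s - s') = (1 - x) * s' + x * s by ring.
      have x1' : 0 <= 1 - x by rewrite subr_ge0.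
      have : (1 - x) * s' <= (1 - x) * 1 by rewrite ler_wpM2l.
      have : x * s <= x * 1 by rewrite ler_wpM2l.
      by have := mulr_ge0 x1' t0; have := mulr_ge0 x0 s0; lra.
    move: hq1; rewrite scalerA -rCM.
    have := E (s' + x * (s - s')) s'.
    rewrite [s' + _ - s']addrC addKr => <-.
    by rewrite [A s' q + _]addrC subrK.
  have -> : 2 * B / d * (`|s - s'| * (cabs (l q) * nrm e)) * cabs (l q) =
            2 * B / d * `|s - s'| * nrm e * (cabs (l q) * cabs (l q)) by ring.
  have -> : 2 * B / d * (L * nrm e) * L * `|s - s'| =
            2 * B / d * `|s - s'| * nrm e * (L * L) by ring.
  apply: ler_wpM2l; first exact: mulr_ge0 (mulr_ge0 X (normr_ge0 _)) (nrm_ge0 e).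
  by apply: ler_pM => //; exact: cabs_ge0.
have DJ p : U p -> 'D_e J p = f p.
  (* The derivative of the integrand along [e] is the derivative in [s] of [s * f (A s p)], whose
     values at 1 and 0 are [f p] and 0. *)
  move=> Up; rewrite (J3 p e (fun z => z * f (p - l p *: e + z *: (l p *: e))) Up).
    by rewrite mul1r mul0r subr0 scale1r subrK.
  move=> s hs; rewrite DH//.
  have AE : p - l p *: e + rC s *: (l p *: e) = A s p.
    by rewrite /A -addrA; congr (_ + _); rewrite scalerA -scaleNr -scalerDl -scaleNr;
      congr (_ *: _); rewrite rCB rC1; ring.
  have df0 : differentiable f (p - l p *: e + rC s *: (l p *: e)).
    by rewrite AE; exact/hf/UA.
  have [d1] := line_diff df0; rewrite AE D_scale; last exact/hf/UA.
  rewrite -[_ *: 'D_e _ _]/(l p * _) => d2.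
  split; first exact: (@differentiableM _ _ id).
  have -> : (fun z : C => z * f (p - l p *: e + z *: (l p *: e))) =
      id * (fun z : C => f (p - l p *: e + z *: (l p *: e))) by [].
  rewrite deriveM; [|exact: derivable_id|exact: diff_derivable].
  rewrite d2 derive_id AE.
  rewrite -[f (A s p) *: 1]/(f (A s p) * 1) -[_ *: _]/(rC s * _); ring.
exists J; split=> // p Phi dPhi Up hPhi hle.
have h01 : 0 <= (0 : R) <= 1 by rewrite ler01 lexx.
(* At the base point the factor [l] makes the integrand vanish, so the comparison along the segment
   starts from 0. *)
have Jb : J (A 0 p) = 0.
  apply/cabs_eq0/eqP; rewrite eq_le cabs_ge0 andbT.
  apply: J2; first exact: UA.
  move=> s _; rewrite /H; have -> : l (A 0 p) = 0.
    by rewrite /A -scaleNr lE subr0 rC1 mul1r subrr.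
  by rewrite mulr0 cabs0.
have AE (x : R) : A 0 p + rC x *: (l p *: e) = A x p.
  rewrite /A subr0 rC1 mul1r scalerA rCB rC1 mulrBl mul1r scalerBl opprB addrA.
  by rewrite addrAC.
have := @mvt_line R V J (A 0 p) (l p *: e) Phi dPhi 0 1 ler01.
rewrite !AE Jb subr0; have -> : A 1 p = p by rewrite /A subrr mul0r scale0r subr0.
apply => //.
- by move=> x hx; rewrite AE; exact/J1/UA.
- move=> x hx; rewrite AE D_scale; last exact/J1/UA.
  by rewrite -[_ *: _]/(l p * _) cabsM DJ; [exact: hle | exact: UA].
Qed.

End Segment.
End Primitives.

(** * Locality of derivatives, and jets in the logarithmic coordinate *)

Section DerivEq.
Variable R : realType.
Local Notation C := (Cplx R).
Variable V : normedModType C.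

Lemma D_eq_on (f g : V -> C) (U : set V) p v : open U -> U p ->
  (forall q, U q -> f q = g q) -> 'D_v f p = 'D_v g p.
Proof.
move=> oU Up fg.
have [->|v0] := eqVneq v 0; first by rewrite !derive0.
apply: near_eq_derive => //; apply/nbhs_nrmP.
have [d d0 h] := open_nrm oU Up; exists d => // q /h; exact: fg.
Qed.

Lemma holo_sub (f : V -> C) (U U' : set V) : U' `<=` U ->
  holomorphic_on f U -> holomorphic_on f U'.
Proof. by move=> UU' hf p /UU'; exact: hf. Qed.

End DerivEq.

Section Jets.
Variable R : realType.
Local Notation C := (Cplx R).
Variable n : nat.
Local Notation V := (RC0 R * 'rV[C]_n)%type.
Implicit Types (u : V -> C) (U : set V) (s : seq 'I_n).

(* In the logarithmic coordinate of [RC0], [t d_t] is the derivative along [et]. *)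
Definition et : V := ((1 : C) : RC0 R, 0).
Definition ex i : V := (0, delta_mx 0 i).

Definition Dt u : V -> C := 'D_et u.
Definition Dx i u : V -> C := 'D_(ex i) u.
Definition DX s u : V -> C := foldr Dx u s.

(** A multi-index as the list of its single differentiations, so that inductions remove one
    derivative at a time. *)
Definition dlist (a : 'I_n -> nat) : seq 'I_n :=
  flatten [seq nseq (a i) i | i <- enum 'I_n].

Lemma size_dlist a : size (dlist a) = (\sum_i a i)%N.
Proof.
rewrite /dlist size_flatten /shape -map_comp sumnE big_map big_enum /=.
by apply: eq_bigr => i _; rewrite /= size_nseq.
Qed.

Lemma partial_pair (h : V -> C) i t x :
  partial i (fun x => h (t, x)) x = Dx i h (t, x).
Proof.
rewrite /partial /Dx; with_strategy transparent [derive] rewrite /derive.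
suff -> : (fun z : C => z^-1 *: ((h \o shift (t, x)) (z *: ex i) - h (t, x))) =
  (fun z : C => z^-1 *: (((fun x => h (t, x)) \o shift x) (z *: delta_mx 0 i) - h (t, x))).
  by [].
apply/funext => z; congr (_ *: (_ - _)) => /=; congr h.
by rewrite -[LHS]/(z *: 0 + t, z *: delta_mx 0 i + x) scaler0 add0r.
Qed.

Lemma mpartial_DX (h : V -> C) a t x :
  mpartial a (fun x => h (t, x)) x = DX (dlist a) h (t, x).
Proof.
rewrite /mpartial /dlist; elim: (enum 'I_n) h x => [//|i s IH] h x /=.
rewrite /DX foldr_cat -/(DX (flatten _) h).
rewrite (_ : foldr _ _ s = fun x => DX (flatten [seq nseq (a i0) i0 | i0 <- s]) h (t, x)).
  set g := DX _ h; elim: (a i) x => [//|k IHk] x /=.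
  rewrite -partial_pair; congr (partial i _ x); apply/funext => y; exact: IHk.
by apply/funext => y; exact: IH.
Qed.

Section Local.
Variable U : set V.
Hypothesis oU : open U.

Lemma holo_DX s u : holomorphic_on u U -> holomorphic_on (DX s u) U.
Proof. by move=> hu; elim: s => [//|i s IH]; exact: holo_D. Qed.

Lemma holo_iterDt j u : holomorphic_on u U -> holomorphic_on (iter j Dt u) U.
Proof. by move=> hu; elim: j => [//|j IH]; exact: holo_D. Qed.

Lemma Dt_DX s u p : holomorphic_on u U -> U p -> Dt (DX s u) p = DX s (Dt u) p.
Proof.
move=> hu; elim: s p => [//|i s IH] p Up /=.
transitivity (Dx i (Dt (DX s u)) p).
  exact: (@holo_DC R _ (DX s u) U p (ex i) et oU (holo_DX s hu) Up).
exact: (@D_eq_on R _ _ _ U p (ex i) oU Up IH).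
Qed.

Lemma iterDt_DX j s u p : holomorphic_on u U -> U p ->
  iter j Dt (DX s u) p = DX s (iter j Dt u) p.
Proof.
move=> hu; elim: j p => [//|j IH] p Up /=.
transitivity (Dt (DX s (iter j Dt u)) p).
  exact: (@D_eq_on R _ _ _ U p et oU Up IH).
exact: (Dt_DX s (holo_iterDt j hu) Up).
Qed.

Lemma luc_iterDt j (uk : nat -> V -> C) u : (forall k, holomorphic_on (uk k) U) ->
  luc uk u U -> luc (fun k => iter j Dt (uk k)) (iter j Dt u) U.
Proof.
move=> hu cv; elim: j => [//|j IH] /=.
by apply: weierstrass_D => // k; exact: holo_iterDt.
Qed.

Lemma luc_DX s (uk : nat -> V -> C) u : (forall k, holomorphic_on (uk k) U) ->
  luc uk u U -> luc (fun k => DX s (uk k)) (DX s u) U.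
Proof.
move=> hu cv; elim: s => [//|i s IH] /=.
by apply: weierstrass_D => // k; exact: holo_DX.
Qed.

End Local.

(** The covering map is its own derivative, so dividing by its increment divides [Dt w] by
    [rc_proj t], which the factor in [tdt] restores. Agreement only near [t] is assumed because the
    iterates of [tdt] are identified only on an open set. *)
Lemma dt_quot (v : RC0 R -> C) (t : RC0 R) (w : V -> C) x :
  (\forall s \near (t : RC0 R), v s = w (s, x)) -> differentiable w (t, x) ->
  tdt v t = Dt w (t, x).
Proof.
move=> /nbhs_nrmP[r r0 hr] dw.
have hr' (s : RC0 R) : nrm (s - t) < r -> v s = w (s, x) := hr s.
have vt : v t = w (t, x) by apply: hr'; rewrite subrr nrm0.
have E0 : 0 < cabs (rc_proj t) by rewrite (cabs_cexp (t : C)) expR_gt0.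
have dtE : dt v t = Dt w (t, x) / rc_proj t.
  rewrite /dt; apply/cvg_lim => //; apply/cvgrPdist_le => e /C_posE[e' e'0 ->].
  set D := Dt w (t, x); set E := rc_proj t in E0 *.
  have E1 : E != 0 by apply/eqP => EE; rewrite EE cabs0 ltxx in E0.
  pose K := cabs D + 1; have K1 : 0 < K by rewrite ltr_wpDl// cabs_ge0.
  (* The first entry keeps the increment [dE] above half of its linear part; the second makes its
     error, multiplied by [D], at most half of the allowed total. *)
  pose a := Num.min (cabs E / 2) (e' * cabs E * cabs E / (4 * K)).
  have a0 : 0 < a by rewrite lt_min !(divr_gt0, mulr_gt0).
  pose b := e' * cabs E / 4; have b0 : 0 < b by rewrite !(divr_gt0, mulr_gt0).
  have [d1 d10 h1] := diff_est (cexp_diff (t : C)).1 a0.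
  have [d2 d20 h2] := diff_est dw b0.
  apply/nbhs_nrmP; exists (Num.min r (Num.min d1 d2)).
    by rewrite !lt_min r0 d10.
  move=> s; rewrite !lt_min => /and3P[sr s1 s2] st.
  pose h : C := s - t; have hs : nrm (s - t) = cabs h by [].
  have h0 : 0 < cabs h.
    rewrite lt_neqAle cabs_ge0 andbT eq_sym; apply: contra_neq st => /cabs_eq0 /eqP.
    by rewrite subr_eq0 => /eqP.
  have sE : (t : C) + h = s by rewrite addrC subrK.
  have H1 : cabs (rc_proj s - E - h * E) <= a * cabs h.
    by have := h1 h s1; rewrite (cexp_diff (t : C)).2 sE.
  have H2 : cabs (v s - v t - h * D) <= b * cabs h.
    have := h2 (h *: et : V).
    have -> : (t, x) + h *: et = (s, x).
      rewrite -[LHS]/((t : C) + h * 1, x + h *: 0) mulr1 scaler0 addr0.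
      by rewrite sE.
    have -> : nrm (h *: et) = cabs h.
      by rewrite nrmZ nrm_pair nrm0 [nrm _]cabs1 maxEge ler01 mulr1.
    by rewrite D_scale// vt hr'//; apply; exact: s2.
  rewrite normC_cabs rC_le.
  set dE := rc_proj s - E in H1 *; set dv := v s - v t in H2 *.
  have dEa : cabs (dE - h * E) <= cabs E / 2 * cabs h.
    by rewrite (le_trans H1)// ler_pM2r// ge_min lexx.
  have dEb : cabs (dE - h * E) <= e' * cabs E * cabs E / (4 * K) * cabs h.
    by rewrite (le_trans H1)// ler_pM2r// ge_min lexx orbT.
  have dEl : cabs h * cabs E / 2 <= cabs dE.
    have := cabsD dE (- (dE - h * E)); rewrite cabsN.
    have -> : dE - (dE - h * E) = h * E by ring.
    rewrite cabsM; have -> : cabs h * cabs E / 2 = cabs E / 2 * cabs h by ring.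
    have -> : cabs h * cabs E = cabs E / 2 * cabs h + cabs E / 2 * cabs h by field.
    lra.
  have dE0 : 0 < cabs dE by apply: lt_le_trans dEl; rewrite !(divr_gt0, mulr_gt0).
  have dE1 : dE != 0 by apply/eqP => EE; rewrite EE cabs0 ltxx in dE0.
  have -> : D / E - dv / dE = (D * (dE - h * E) - (dv - h * D) * E) / (E * dE).
    by field; rewrite E1 dE1.
  rewrite cabsM cabsV cabsM ler_pdivrMr ?mulr_gt0//.
  apply: (@le_trans _ _ (e' * (cabs E * (cabs h * cabs E / 2)))).
    rewrite (le_trans (cabsD _ _))// cabsN !cabsM.
    have X1 : cabs D * cabs (dE - h * E) <= e' * cabs E * cabs E / 4 * cabs h.
      apply: (@le_trans _ _ (K * cabs (dE - h * E))).
        by rewrite ler_wpM2r ?cabs_ge0// lerDl.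
      apply: (@le_trans _ _ (K * (e' * cabs E * cabs E / (4 * K) * cabs h))).
        by rewrite ler_pM2l.
      by rewrite le_eqVlt; apply/orP; left; apply/eqP; field; rewrite gt_eqF.
    have X2 : cabs (dv - h * D) * cabs E <= b * cabs h * cabs E.
      by rewrite ler_pM2r.
    have -> : e' * (cabs E * (cabs h * cabs E / 2)) =
       e' * cabs E * cabs E / 4 * cabs h + b * cabs h * cabs E by rewrite /b; field.
    exact: lerD.
  by rewrite ler_pM2l// ler_pM2l.
rewrite /tdt dtE mulrC divfK//.
by apply/eqP => EE; rewrite EE cabs0 ltxx in E0.
Qed.

Lemma iter_tdt (w : V -> C) (U : set V) j t x : open U -> holomorphic_on w U ->
  U (t, x) -> iter j (@tdt R) (fun s : RC0 R => w (s, x)) t = iter j Dt w (t, x).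
Proof.
move=> oU hw; elim: j t => [//|j IH] t Utx /=.
apply: (@dt_quot _ t (iter j Dt w) x); last exact: (@holo_iterDt U oU j w hw (t, x) Utx).
have [d d0 hd] := open_nrm oU Utx; apply/nbhs_nrmP; exists d => // s hs.
apply: IH; apply: hd.
rewrite -[X in nrm X]/((s - t, x - x)) subrr nrm_pair nrm0.
by rewrite gt_max hs.
Qed.

Definition jetv m u (p : V) : Zvec R m n :=
  \row_k (iter (idx_j (enum_val k)) Dt (DX (dlist (idx_a (enum_val k))) u) p).

Lemma jetE m (w : V -> C) (U : set V) t x : open U -> holomorphic_on w U ->
  U (t, x) -> jet m (fun t x => w (t, x)) t x = jetv m w (t, x).
Proof.
move=> oU hw Utx; apply/rowP => k; rewrite !mxE.
rewrite -(iter_tdt _ oU (holo_DX oU _ hw) Utx).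
congr (iter _ _ _ t); apply/funext => s; exact: mpartial_DX.
Qed.

(** Nagumo's lemma: on the disc of radius [d p / 2] the distance is still at least [d p / 2], so
    Cauchy's estimate there costs one power of [d] and the constant [2 ^+ q.+2]. The weight [w] is
    kept abstract, constant in [x]. *)
Lemma cts_nagumo (U : set V) (d w : V -> R) i q (f : V -> C) :
  holomorphic_on f U ->
  (forall p, U p -> 0 < d p /\ forall z : C, cabs z < d p ->
     [/\ U (p + z *: ex i), d p - cabs z <= d (p + z *: ex i) &
         w (p + z *: ex i) = w p]) ->
  (forall p, U p -> cabs (f p) <= w p / d p ^+ q) ->
  forall p, U p -> cabs (Dx i f p) <= 2 ^+ q.+2 * w p / d p ^+ q.+1.
Proof.
move=> hf hU hle p Up; have [d0 hz] := hU p Up.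
have w0 : 0 <= w p.
  have := le_trans (cabs_ge0 _) (hle p Up); rewrite pmulr_lge0//.
  by rewrite invr_gt0 exprn_gt0.
have -> : 2 ^+ q.+2 * w p / d p ^+ q.+1 = 2 * (w p / (d p / 2) ^+ q) / (d p / 2).
  rewrite expr_div_n 2![2 ^+ _.+1]exprS exprS; field.
  by rewrite gt_eqF//= !expf_neq0// gt_eqF.
have d2 : 0 < d p / 2 by rewrite divr_gt0.
have lt2 (z : C) : cabs z < d p / 2 -> cabs z < d p by lra.
apply: cauchy_dir => // z zd; have [Uz dz wz] := hz z (lt2 z zd); first exact: hf.
rewrite (le_trans (hle _ Uz))// wz ler_wpM2l//.
rewrite lef_pV2 ?posrE ?exprn_gt0//; last lra.
by apply: lerXn2r; rewrite ?nnegrE; lra.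
Qed.

End Jets.

Arguments et {R n}.
Arguments ex {R n} i.
Arguments Dt {R n} u _.
Arguments Dx {R n} i u _.

(** * First-order equations on pinched sectors *)

Section Calculus.
Variable R : realType.

Lemma is_derive_expaff (k a b x : R) :
  is_derive x 1 (fun x => k * expR (a + b * x)) (k * b * expR (a + b * x)).
Proof.
have h1 : is_derive x 1 (fun x : R => a + b * x) b.
  apply: is_derive_intro => e e0; exists 1 => // h _.
  have -> : a + b * (x + h) - (a + b * x) - h * b = 0 by ring.
  by rewrite normr0 mulr_ge0// ltW.
have h2 := @is_derive1_comp R expR (fun x => a + b * x) x _ _
  (is_derive_expR (a + b * x)) h1.
have := is_deriveZ k h2.
by rewrite -[_ *: _]/(k * (expR (a + b * x) * b)) [expR _ * b]mulrC mulrA.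
Qed.

End Calculus.

Section Omega.
Variable R : realType.
Local Notation C := (Cplx R).
Variable n : nat.
Local Notation V := (RC0 R * 'rV[C]_n)%type.
Local Notation Re := complex.Re.
Local Notation Im := complex.Im.

(** Product of the constants of [k] successive uses of Nagumo's lemma, starting from the power
    [q]. *)
Fixpoint nag (q k : nat) : R := if k is k'.+1 then 2 ^+ (q + k').+2 * nag q k' else 1.

Lemma nag_gt0 q k : 0 < nag q k.
Proof. by elim: k => [|k IH] //=; rewrite mulr_gt0// exprn_gt0. Qed.

Lemma nag_le q k k' : (k <= k')%N -> nag q k <= nag q k'.
Proof.
move=> /subnK <-; elim: (k' - k)%N => [|j IH] //=.
apply: (le_trans IH); apply: ler_peMl; first exact/ltW/nag_gt0.
by apply: exprn_ege1; rewrite ler1n.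
Qed.

Lemma nagumo (U : set V) (d w : V -> R) q (f : V -> C) (s : seq 'I_n) :
  open U -> holomorphic_on f U ->
  (forall p i, U p -> 0 < d p /\ forall z : C, cabs z < d p ->
     [/\ U (p + z *: ex i), d p - cabs z <= d (p + z *: ex i) &
         w (p + z *: ex i) = w p]) ->
  (forall p, U p -> cabs (f p) <= w p / d p ^+ q) ->
  forall p, U p -> cabs (DX s f p) <= nag q (size s) * w p / d p ^+ (q + size s).
Proof.
move=> oU hf hU hle; elim: s => [|i s IH] p Up /=; first by rewrite mul1r addn0 hle.
have := @cts_nagumo _ _ U d (fun p => nag q (size s) * w p) i (q + size s)
  (DX s f) (holo_DX oU s hf) _ IH p Up.
rewrite addnS mulrA; apply=> p' Up'.
have [d0 hz] := hU p' i Up'; split=> // z /hz[h1 h2 h3]; split=> //.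
by rewrite h3.
Qed.

Variable psi : R -> R.
Hypotheses (psi_ge0 : forall y, 0 <= psi y) (psi0 : psi 0 = 0)
  (psi_cvx : forall x y s : R, 0 <= s <= 1 ->
     psi ((1 - s) * x + s * y) <= (1 - s) * psi x + s * psi y)
  (psi_cont : continuous psi).

(* A pinched sector, convex in the logarithmic coordinate because [psi] is
   convex, and stable under translation by negative reals. *)
Definition Om (c : R) : set (RC0 R) :=
  [set t | Re t < - (c * (1 + `|Im t|) + psi (Im t))].

Lemma Om_lt c t : 0 <= c -> Om c t -> Re t < - c * (1 + `|Im t|).
Proof. by move=> c0; rewrite /Om /=; have := psi_ge0 (Im t); lra. Qed.

Lemma Om_ltc c t : 0 <= c -> Om c t -> Re t < - c.
Proof.
move=> c0 /(Om_lt c0); have := mulr_ge0 c0 (normr_ge0 (Im t)); lra.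
Qed.

Lemma Om_mono c c' : c <= c' -> Om c' `<=` Om c.
Proof.
move=> cc t; rewrite /Om /= => h; apply: lt_le_trans h _.
by rewrite lerN2 lerD2r ler_wpM2r// addr_ge0.
Qed.

Lemma Om_left c (t : C) (x : R) : 0 <= x -> Om c t -> Om c (t - rC x).
Proof.
move=> x0; rewrite /Om /= ReB ImB /= subr0 => h; apply: le_lt_trans h.
by rewrite gerBl.
Qed.

Lemma Om_base c : 0 <= c -> Om c (rC (- (c + 1))).
Proof. by move=> c0; rewrite /Om /= normr0 psi0; lra. Qed.

Lemma Om_cvx c (t t' : C) (s : R) : 0 <= c -> 0 <= s <= 1 -> Om c t -> Om c t' ->
  Om c (rC (1 - s) * t + rC s * t').
Proof.
move=> c0 hs; rewrite /Om /= ReD ImD !Re_rCM !Im_rCM => h h'.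
move: (psi_cvx (Im t) (Im t') hs); case/andP: hs => s0 s1.
have s1' : 0 <= 1 - s by rewrite subr_ge0.
have : `|(1 - s) * Im t + s * Im t'| <= (1 - s) * `|Im t| + s * `|Im t'|.
  by rewrite (le_trans (ler_normD _ _))// !normrM (ger0_norm s0) (ger0_norm s1').
set A := `|_ + _|; set P := psi (_ + _) => hA hP.
have cA : c * A <= c * ((1 - s) * `|Im t| + s * `|Im t'|) by rewrite ler_wpM2l.
set X := c * (1 + `|Im t|) + psi (Im t) in h.
set X' := c * (1 + `|Im t'|) + psi (Im t') in h'.
have : c * (1 + A) + P <= (1 - s) * X + s * X' by rewrite /X /X'; lra.
suff : (1 - s) * Re t + s * Re t' < (1 - s) * (- X) + s * (- X') by lra.
have [->|sne] := eqVneq s 0; first by rewrite subr0 !mul1r !mul0r !addr0.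
apply: ler_ltD; first by rewrite ler_wpM2l// ltW.
by rewrite ltr_pM2l// lt_neqAle eq_sym sne.
Qed.

Lemma Om_open c : open (Om c).
Proof.
apply/open_nrmP => t; rewrite /Om /= => ht.
pose g (y : R) := c * (1 + `|y|) + psi y.
have cg : {for Im t, continuous g}.
  apply: (@continuousD R R R (fun y => c * (1 + `|y|)) psi); last exact: psi_cont.
  apply: (@continuousM R R (cst c) (fun y => 1 + `|y|)); first exact: cst_continuous.
  apply: (@continuousD R R R (cst 1) (fun y => `|y|)); first exact: cst_continuous.
  exact: norm_continuous.
pose e := (- g (Im t) - Re t) / 2.
have e0 : 0 < e by rewrite divr_gt0// subr_gt0.
have [d /= d0 hd] : exists2 d : R, 0 < d & forall y, `|y - Im t| < d -> g y < g (Im t) + e.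
  have := cg; move/cvgrPdist_lt => /(_ e e0) /nbhs_ballP[d /= d0 hd].
  exists d => // y hy; have := hd y; rewrite /ball /= distrC => /(_ hy).
  by rewrite ltr_norml => /andP[h _]; lra.
exists (Num.min d e); first by rewrite lt_min d0.
move=> q; rewrite lt_min => /andP[q1 q2].
have i1 : `|Im q - Im t| < d.
  by apply: le_lt_trans q1; rewrite -(ImB (q : C) t); exact: cabs_ge_Im.
have i2 : `|Re q - Re t| < e.
  by apply: le_lt_trans q2; rewrite -(ReB (q : C) t); exact: cabs_ge_Re.
have e2 : 2 * e = - g (Im t) - Re t by rewrite /e; field.
have := hd _ i1; move: i2; rewrite ltr_norml => /andP[_ i2] h.
suff : Re q < - g (Im q) by [].
lra.
Qed.

Definition OmX c (X : set 'rV[C]_n) : set V := [set p | Om c p.1 /\ X p.2].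

Lemma nrm_fst (p : V) : cabs (p.1 : C) <= nrm p.
Proof. by case: p => a b; rewrite nrm_pair le_max lexx. Qed.

Lemma nrm_snd (p : V) : nrm p.2 <= nrm p.
Proof. by case: p => a b; rewrite nrm_pair le_max lexx orbT. Qed.

Lemma OmX_open c X : open X -> open (OmX c X).
Proof.
move=> oX; apply/open_nrmP => p [h1 h2].
have [d1 d10 hd1] := open_nrm (@Om_open c) h1; have [d2 d20 hd2] := open_nrm oX h2.
exists (Num.min d1 d2); first by rewrite lt_min d10.
move=> q; rewrite lt_min => /andP[q1 q2]; split; [apply: hd1 | apply: hd2].
  exact: le_lt_trans (nrm_fst (q - p)) q1.
exact: le_lt_trans (nrm_snd (q - p)) q2.
Qed.

Lemma fst_diff (p : V) : differentiable (fun p : V => p.1 : C) p /\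
  forall v, 'D_v (fun p : V => p.1 : C) p = v.1.
Proof.
apply: (@diff_intro _ _ _ _ _ (fun v : V => v.1 : C) 1) => //.
- by move=> v; rewrite mul1r; exact: nrm_fst.
move=> e e0; exists 1 => // h _.
have -> : ((p + h).1 : C) - p.1 - h.1 = 0.
  by rewrite -[(p + h).1]/((p.1 : C) + h.1); ring.
by rewrite nrm0 mulr_ge0 ?nrm_ge0// ltW.
Qed.

Lemma shift_et (p : V) (x : R) : p + rC x *: et = ((p.1 : C) + rC x, p.2).
Proof.
case: p => a b; rewrite -[LHS]/((a : C) + rC x * 1, b + rC x *: 0).
by rewrite mulr1 scaler0 addr0.
Qed.

Lemma scale_et (p : V) (z : C) : p + z *: et = ((p.1 : C) + z, p.2).
Proof.
case: p => a b; rewrite -[LHS]/((a : C) + z * 1, b + z *: 0).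
by rewrite mulr1 scaler0 addr0.
Qed.

Lemma cabs_cexpM (l t : C) : cabs (cexp (l * t)) = expR (Re l * Re t - Im l * Im t).
Proof. by rewrite cabs_cexp; case: l t => [a b] [x y]. Qed.

Lemma expt_diff (l : C) (p : V) : differentiable (fun p : V => cexp (l * (p.1 : C))) p /\
  'D_et (fun p : V => cexp (l * (p.1 : C))) p = l * cexp (l * (p.1 : C)).
Proof.
pose g (p : V) : C := l * p.1.
have [dg Dg] : differentiable g p /\ 'D_et g p = l.
  have [d1 D1] := fst_diff p; split.
    exact: (@differentiableM _ _ (cst l) (fun p : V => p.1 : C)).
  have := @deriveM _ _ (cst l) (fun p : V => p.1 : C) p et
    (derivable_cst _ _ _) (diff_derivable d1).
  rewrite derive_cst scaler0 addr0 D1 -[_ *: _]/(l * 1) mulr1; exact.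
have dc := cexp_diff (g p); split; first exact: (differentiable_comp dg dc.1).
rewrite deriveE; last exact: (differentiable_comp dg dc.1).
have -> : (fun p : V => cexp (l * (p.1 : C))) = (@cexp R : C -> C) \o g by [].
rewrite (diff_comp dg dc.1) /=; have -> : 'd g p et = l by rewrite -deriveE.
rewrite -deriveE; last exact: dc.1.
exact: dc.2.
Qed.

(** Conjugation by [exp (l t)] turns [d_t - l] into [d_t], which leaves a primitive to be found. *)
Lemma expt_conj (l : C) (U : set V) (f v : V -> C) : open U ->
  holomorphic_on v U ->
  (forall p, U p -> 'D_et v p = cexp (- l * (p.1 : C)) * f p) ->
  holomorphic_on (fun p => cexp (l * (p.1 : C)) * v p) U /\
  forall p, U p -> Dt (fun p => cexp (l * (p.1 : C)) * v p) p =
    l * (cexp (l * (p.1 : C)) * v p) + f p.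
Proof.
move=> oU hv Dv; split=> p Up.
  apply: (@differentiableM _ _ (fun p : V => cexp (l * (p.1 : C))) v); last exact: hv.
  by have [] := expt_diff l p.
have [d1 D1] := expt_diff l p.
have := @deriveM _ _ (fun p : V => cexp (l * (p.1 : C))) v p et
  (diff_derivable d1) (diff_derivable (hv p Up)).
rewrite Dv// D1 -![_ *: _]/(_ * _) => E; rewrite /Dt; rewrite [LHS]E.
have e1 : cexp (l * (p.1 : C)) * cexp (- l * (p.1 : C)) = 1.
  by rewrite -cexpD mulNr subrr cexp0.
have -> : cexp (l * (p.1 : C)) * (cexp (- l * (p.1 : C)) * f p) = f p.
  by rewrite mulrA e1 mul1r.
ring.
Qed.

(* One solution operator for [d_t - l] on functions bounded by [e^(b Re t)]:
   integrate from [-oo] when [Re l < b], from the base point [-(c + 1)] when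
   [Re l > b]. *)
Lemma ode1 (l : C) (b : R) : Re l != b ->
  exists2 c1 : R, 1 <= c1 & exists2 K : R, 0 <= K & forall c X f (B : R), c1 <= c ->
    open X -> holomorphic_on f (OmX c X) ->
    (forall p, OmX c X p -> cabs (f p) <= B * expR (b * Re p.1)) ->
    exists g : V -> C, [/\ holomorphic_on g (OmX c X),
      forall p, OmX c X p -> Dt g p = l * g p + f p &
      forall p, OmX c X p -> cabs (g p) <= K * B * expR (b * Re p.1)].
Proof.
set be := Re l; set om := Im l => bne.
pose ft (f : V -> C) (p : V) : C := cexp (- l * (p.1 : C)) * f p.
have ft_holo f U : holomorphic_on f U -> holomorphic_on (ft f) U.
  move=> hf p Up; apply: (@differentiableM _ _ (fun p : V => cexp (- l * (p.1 : C))) f).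
    by have [] := expt_diff (- l) p.
  exact: hf.
have ft_le f (B : R) (p : V) : cabs (f p) <= B * expR (b * Re p.1) ->
    cabs (ft f p) <= B * expR ((b - be) * Re p.1 + om * Im p.1).
  move=> h; rewrite /ft cabsM cabs_cexpM.
  have -> : Re (- l) = - be by rewrite ReN.
  have -> : Im (- l) = - om by rewrite ImN.
  apply: (@le_trans _ _ (expR (- be * Re p.1 - - om * Im p.1) * (B * expR (b * Re p.1)))).
    by rewrite ler_wpM2l ?expR_ge0.
  rewrite mulrCA -expRD le_eqVlt; apply/orP; left; apply/eqP; congr (_ * expR _); ring.
have B_ge0 c X f (B : R) : (forall p, OmX c X p -> cabs (f p) <= B * expR (b * Re p.1)) ->
    forall p, OmX c X p -> 0 <= B.
  move=> h p Up; have := le_trans (cabs_ge0 _) (h p Up).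
  by rewrite pmulr_lge0// expR_gt0.
have g_le (v : V -> C) (p : V) (M : R) : cabs (v p) <= M ->
    cabs (cexp (l * (p.1 : C)) * v p) <= expR (be * Re p.1 - om * Im p.1) * M.
  by move=> h; rewrite cabsM cabs_cexpM ler_wpM2l ?expR_ge0.
move: bne; rewrite neq_lt => /orP[lt_be|lt_b].
- pose mu := b - be; have mu0 : 0 < mu by rewrite subr_gt0.
  exists 1 => //; exists mu^-1; first by rewrite invr_ge0 ltW.
  move=> c X f B c1 oX hf fB; have oU := @OmX_open c X oX.
  have [||||v [v1 v2 v3]] := @primitive_left R V et (OmX c X) (ft f) mu oU.
  + move=> p t [h1 h2] t0; rewrite /shiftl -scaleNr -rCN shift_et rCN.
    by split=> //=; exact: Om_left.
  + exact: ft_holo.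
  + exact: mu0.
  + move=> p Up; have B0 := B_ge0 _ _ _ _ fB p Up.
    have [d d0 hd] := open_nrm oU Up.
    exists (Num.min d 1); first by rewrite lt_min d0 ltr01.
    exists (B * expR (mu * (`|Re p.1| + 1) + `|om| * (`|Im p.1| + 1))).
    move=> q t; rewrite lt_min => /andP[q1 q2] t0.
    have Uq := hd q q1.
    have Us : OmX c X (shiftl et q t).
      rewrite /shiftl -scaleNr -rCN shift_et rCN; case: Uq => h1 h2.
      by split=> //=; exact: Om_left.
    have := ft_le f B _ (fB _ Us).
    rewrite /shiftl -scaleNr -rCN shift_et /= ReD ImD /= addr0 -/mu.
    move=> H; apply: le_trans H _; rewrite -mulrA ler_wpM2l// -expRD ler_expR.
    have i1 : Re q.1 <= `|Re p.1| + 1.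
      have := cabs_ge_Re ((q.1 : C) - p.1); rewrite ReB.
      have := nrm_fst (q - p); rewrite -[(q - p).1]/((q.1 : C) - p.1).
      have := ler_norm (Re q.1 - Re p.1); have := ler_norm (Re p.1); lra.
    have i2 : `|Im q.1| <= `|Im p.1| + 1.
      have := cabs_ge_Im ((q.1 : C) - p.1); rewrite ImB.
      have := nrm_fst (q - p); rewrite -[(q - p).1]/((q.1 : C) - p.1).
      have := ler_normD (Im q.1 - Im p.1) (Im p.1); rewrite subrK; lra.
    have i3 : om * Im q.1 <= `|om| * (`|Im p.1| + 1).
      apply: (le_trans (ler_norm _)); rewrite normrM; exact: ler_wpM2l.
    have i4 : mu * Re q.1 <= mu * (`|Re p.1| + 1) by rewrite ler_pM2l.
    rewrite mulrDr mulrN; lra.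
  have [h1 h2] := expt_conj oU v1 v2.
  exists (fun p => cexp (l * (p.1 : C)) * v p); split=> // p Up.
  have B0 := B_ge0 _ _ _ _ fB p Up.
  pose a := mu * Re p.1 + om * Im p.1.
  have H : cabs (v p) <= B / mu * expR (a + mu * 0).
    apply: (v3 p (fun x => B / mu * expR (a + mu * x))
      (fun x => B / mu * mu * expR (a + mu * x)) Up).
    + by move=> x _; exact: is_derive_expaff.
    + by move=> x _; rewrite mulr_ge0 ?expR_ge0// divr_ge0// ltW.
    move=> x x0; have Us : OmX c X (p + rC x *: et).
      rewrite shift_et; case: Up => u1 u2; split=> //=.
      by rewrite -(opprK x) rCN; apply: Om_left; rewrite ?oppr_ge0.
    apply: le_trans (ft_le f B _ (fB _ Us)) _.
    rewrite divfK ?gt_eqF// shift_et /= ReD ImD /= addr0 le_eqVlt.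
    by apply/orP; left; apply/eqP; congr (_ * expR _); rewrite /a /mu; ring.
  apply: le_trans (g_le v p _ H) _.
  rewrite mulrCA -expRD [mu^-1 * B]mulrC le_eqVlt.
  by apply/orP; left; apply/eqP; congr (_ * expR _); rewrite /a /mu; ring.
pose mu := be - b; have mu0 : 0 < mu by rewrite subr_gt0.
(* Above this threshold the shape of [Om] makes [om * Im t] at most [mu / 2 * D] in absolute value:
   the factor coming from [Im l] uses up at most half of the exponential rate. *)
exists (Num.max 1 (2 * `|om| / mu)); first by rewrite le_max lexx.
exists (4 / mu * expR (2 * mu)).
  by rewrite mulr_ge0 ?expR_ge0// divr_ge0// ltW.
move=> c X f B; rewrite ge_max => /andP[c1 c2] oX hf fB; have oU := @OmX_open c X oX.
have c0 : 0 <= c by lra.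
pose t0 : C := rC (- (c + 1)).
pose ll (p : V) : C := (p.1 : C) - t0.
pose A (s : R) (p : V) : V := p - (rC (1 - s) * ll p) *: et.
have AE s (p : V) : A s p = (rC (1 - s) * t0 + rC s * (p.1 : C), p.2).
  rewrite /A -scaleNr scale_et; congr pair; rewrite /ll rCB rC1; ring.
have t0Om : Om c t0 := Om_base c0.
have dll p : differentiable ll p /\ 'D_et ll p = 1.
  have [d1 D1] := fst_diff p; split; first exact: differentiableB.
  have := @D_sub _ _ (fun p : V => p.1 : C) (cst t0) p et d1 (differentiable_cst _ _).
  by rewrite derive_cst subr0 D1.
have llE p (z : C) : ll (p + z *: et) = ll p + z.
  by rewrite /ll scale_et /=; ring.
have loc p : OmX c X p -> exists2 d : R, 0 < d & exists B : R,
    forall q s q', nrm (q - p) < d -> 0 <= s <= 1 -> nrm (q' - A s q) < d ->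
      OmX c X q' /\ cabs (ft f q') <= B.
  move=> [u1 u2]; have B0 := B_ge0 _ _ _ _ fB p (conj u1 u2).
  have [d1 d10 h1] := open_nrm (@Om_open c) u1.
  have [d2 d20 h2] := open_nrm (@Om_open c) t0Om.
  have [d3 d30 h3] := open_nrm oX u2.
  pose d := Num.min (Num.min (d1 / 2) d2) (Num.min (d3 / 2) 1).
  exists d; first by rewrite !lt_min d20 ltr01 !divr_gt0.
  pose M := cabs (p.1 : C) + cabs t0 + 3.
  exists (B * expR (mu * M + `|om| * M)).
  move=> q s q'; rewrite !lt_min => /and3P[/andP[q1 q2] q3 q4] hs.
  move=> /and3P[/andP[r1 r2] r3 r4].
  pose h := q' - A s q.
  have q'E : q' = A s q + h by rewrite addrC subrK.
  (* The perturbation [h] is added to both ends, so [q'.1] is a convex combination of a point near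
     [t0] and one near [p.1], both in the convex set [Om]. *)
  have qE1 : (q'.1 : C) = rC (1 - s) * (t0 + (h.1 : C)) + rC s * ((q.1 : C) + h.1).
    rewrite q'E AE -[(_ + h).1]/(rC (1 - s) * t0 + rC s * (q.1 : C) + (h.1 : C)).
    rewrite rCB rC1; ring.
  have hf1 := nrm_fst h; have hs2 := nrm_snd h.
  have qf1 : cabs ((q.1 : C) - p.1) <= nrm (q - p) by exact: nrm_fst (q - p).
  have Uq' : OmX c X q'.
    split.
      have -> : q'.1 = (rC (1 - s) * (t0 + (h.1 : C)) + rC s * ((q.1 : C) + h.1) : C).
        exact: qE1.
      apply: Om_cvx => //.
        by apply: h2; rewrite nrmC addrC addKr; exact: le_lt_trans hf1 r2.
      apply: h1; rewrite -[X in X < _]/(cabs (((q.1 : C) + h.1) - p.1)).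
      have -> : ((q.1 : C) + h.1) - p.1 = ((q.1 : C) - p.1) + h.1 by ring.
      rewrite -/h in r1; have := cabsD ((q.1 : C) - p.1) h.1; lra.
    apply: h3; rewrite q'E AE -[(_ + h).2]/(q.2 + h.2) addrAC.
    rewrite -/h in r3; have := nrmD (q.2 - p.2) h.2; have := nrm_snd (q - p).
    rewrite -[(q - p).2]/(q.2 - p.2); lra.
  split=> //; apply: le_trans (ft_le f B _ (fB _ Uq')) _.
  rewrite ler_wpM2l// ler_expR.
  have cM : cabs (q'.1 : C) <= M.
    rewrite qE1; case/andP: hs => s0 s1; have s1' : 0 <= 1 - s by rewrite subr_ge0.
    apply: (le_trans (cabsD _ _)); rewrite !cabsM !cabs_rC (ger0_norm s0) (ger0_norm s1').
    rewrite -/h in r4.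
    have b1 : cabs (t0 + h.1) <= M.
      have := cabsD t0 h.1; rewrite /M; have := cabs_ge0 (p.1 : C); lra.
    have b2 : cabs ((q.1 : C) + h.1) <= M.
      have := cabsD (q.1 : C) h.1; have := cabsD ((q.1 : C) - p.1) p.1.
      rewrite subrK /M; have := cabs_ge0 t0; lra.
    have := ler_wpM2l s1' b1; have := ler_wpM2l s0 b2; lra.
  have i1 : (b - be) * Re q'.1 <= mu * M.
    apply: (le_trans (ler_norm _)); rewrite normrM distrC (gtr0_norm mu0) ler_pM2l//.
    exact: le_trans (cabs_ge_Re _) cM.
  have i2 : om * Im q'.1 <= `|om| * M.
    apply: (le_trans (ler_norm _)); rewrite normrM ler_wpM2l//.
    exact: le_trans (cabs_ge_Im _) cM.
  lra.
have [v [v1 v2 v3]] := @primitive_segment R V et (OmX c X) (ft f) ll oU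
  (ft_holo _ _ hf) dll llE loc.
have [h1 h2] := expt_conj oU v1 v2.
exists (fun p => cexp (l * (p.1 : C)) * v p); split=> // p Up.
have B0 := B_ge0 _ _ _ _ fB p Up.
pose xi := Re p.1; pose y := Im p.1.
pose D := - c - xi.
have D0 : 0 < D by have := Om_ltc c0 Up.1; rewrite /D -/xi; lra.
have cy : c * `|y| <= D by have := Om_lt c0 Up.1; rewrite /D -/xi -/y; lra.
have yD : `|y| <= D by apply: le_trans cy; rewrite ler_peMl.
have omy : - (om * y) <= mu / 2 * D.
  apply: (le_trans (ler_norm _)); rewrite normrN normrM.
  have c3 : `|om| <= mu / 2 * c.
    by move: c2; rewrite ler_pdivrMr// mulrC; lra.
  apply: (@le_trans _ _ (mu / 2 * c * `|y|)); first by rewrite ler_wpM2r.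
  by rewrite -mulrA ler_pM2l// divr_gt0.
(* The exponent of the integrand grows by [ka - 2 * mu] along the segment. The extra [2 * mu] bounds
   the rate below by [mu / 2 * (D + 2)], comparable with the length of the segment; their ratio
   gives [4 / mu], at the price of [expR (2 * mu)]. *)
pose ka := mu * (- (c + 1) - xi) + om * y + 2 * mu.
have kaE : ka = mu * (D + 1) + om * y by rewrite /ka /D; ring.
have muD : 0 < mu * D by rewrite mulr_gt0.
have ka_ge : mu / 2 * (D + 2) <= ka by rewrite kaE; lra.
have ka0 : 0 < ka by apply: lt_le_trans ka_ge; rewrite mulr_gt0 ?divr_gt0//; lra.
have lle : cabs (ll p) <= 2 * (D + 2).
  apply: (le_trans (cabs_le_ReIm _)); rewrite /ll ReB ImB /= subr0 -/xi -/y.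
  have : `|xi - - (c + 1)| <= D + 1.
    by rewrite ler_norml; apply/andP; split; rewrite /D in D0 *; lra.
  lra.
have llk : cabs (ll p) <= 4 / mu * ka.
  apply: (le_trans lle); apply: (@le_trans _ _ (4 / mu * (mu / 2 * (D + 2)))).
    by rewrite le_eqVlt; apply/orP; left; apply/eqP; field; rewrite gt_eqF.
  by rewrite ler_pM2l// divr_gt0.
pose E0 := (b - be) * - (c + 1).
pose k := cabs (ll p) * B / ka.
have H : cabs (v p) <= k * expR (E0 + ka * 1) - k * expR (E0 + ka * 0).
  apply: (v3 p (fun x => k * expR (E0 + ka * x)) (fun x => k * ka * expR (E0 + ka * x)) Up).
    by move=> x _; exact: is_derive_expaff.
  move=> x hx; case/andP: (hx) => x0 x1.
  have Us : OmX c X (A x p).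
    by rewrite AE; case: Up => u1 u2; split=> //=; exact: Om_cvx.
  rewrite /k divfK ?gt_eqF// -mulrA ler_wpM2l ?cabs_ge0//.
  apply: le_trans (ft_le f B _ (fB _ Us)) _; rewrite AE /= ler_wpM2l// ler_expR.
  rewrite ReD ImD !Re_rCM !Im_rCM /= mulr0 add0r -/xi -/y /E0 /ka.
  have : 0 <= x * (2 * mu) by rewrite mulr_ge0// mulr_ge0// ltW.
  rewrite /mu; lra.
have k0 : 0 <= k by rewrite divr_ge0 ?mulr_ge0 ?cabs_ge0// ltW.
have H' : cabs (v p) <= k * expR (E0 + ka).
  apply: (le_trans H); rewrite mulr1 gerBl mulr_ge0// expR_ge0.
apply: le_trans (g_le v p _ H') _.
rewrite mulrCA -expRD.
have -> : be * Re p.1 - om * Im p.1 + (E0 + ka) = 2 * mu + b * Re p.1.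
  by rewrite /E0 /ka /mu -/xi -/y; ring.
rewrite expRD mulrA; apply: ler_wpM2r; first exact: expR_ge0.
have -> : 4 / mu * expR (2 * mu) * B = 4 / mu * B * expR (2 * mu) by ring.
apply: ler_wpM2r; first exact: expR_ge0.
rewrite /k mulrAC ler_wpM2r// ler_pdivrMr//.
Qed.

End Omega.

(** * Linear equations of order [m] in [t] *)

Section LinearODE.
Variable R : realType.
Local Notation C := (Cplx R).
Variable n : nat.
Local Notation V := (RC0 R * 'rV[C]_n)%type.
Local Notation Re := complex.Re.
Local Notation Im := complex.Im.
Variable psi : R -> R.
Hypotheses (psi_ge0 : forall y, 0 <= psi y) (psi0 : psi 0 = 0)
  (psi_cvx : forall x y s : R, 0 <= s <= 1 ->
     psi ((1 - s) * x + s * y) <= (1 - s) * psi x + s * psi y)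
  (psi_cont : continuous psi).
Local Notation OmX := (@OmX R n psi).

Lemma DtD (f g : V -> C) p : differentiable f p -> differentiable g p ->
  Dt (fun q => f q + g q) p = Dt f p + Dt g p.
Proof.
by move=> df dg; rewrite /Dt; apply: deriveD; exact: diff_derivable.
Qed.

Lemma D_cmul (V' : normedModType C) (a : C) (f : V' -> C) p v : differentiable f p ->
  differentiable (fun q => a * f q) p /\ 'D_v (fun q => a * f q) p = a * 'D_v f p.
Proof.
move=> df; split; first exact: (@differentiableM _ _ (cst a) f).
have := @deriveM _ _ (cst a) f p v (derivable_cst _ _ _) (diff_derivable df).
by rewrite derive_cst scaler0 addr0; exact.
Qed.

Lemma D_lincomb (V' : normedModType C) N (a : nat -> C) (F : nat -> V' -> C) p v :
  (forall i, (i < N)%N -> differentiable (F i) p) ->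
  differentiable (fun q => \sum_(i < N) a i * F i q) p /\
  'D_v (fun q => \sum_(i < N) a i * F i q) p = \sum_(i < N) a i * 'D_v (F i) p.
Proof.
elim: N => [|N IH] hF.
  have -> : (fun q => \sum_(i < 0) a i * F i q) = cst 0.
    by apply/funext => q; rewrite big_ord0.
  by rewrite derive_cst big_ord0.
have [d1 D1] := IH (fun i hi => hF i (ltnW hi)).
have [d2 D2] := D_cmul (a N) v (hF N (ltnSn N)).
have -> : (fun q => \sum_(i < N.+1) a i * F i q) =
  (fun q => \sum_(i < N) a i * F i q) + (fun q => a N * F N q).
  by apply/funext => q; rewrite big_ord_recr.
split; first exact: differentiableD.
rewrite deriveD; [|exact: diff_derivable|exact: diff_derivable].
by rewrite D1 D2 big_ord_recr.
Qed.

(** The factors [d_t - l] are inverted one after the other. The induction bounds all derivatives of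
    [w] but the highest, which is read off from the monic equation of one order less. *)
Lemma ode_const (ls : seq C) (b : R) : (forall l, l \in ls -> Re l != b) ->
  exists2 c1 : R, 1 <= c1 & exists2 K : R, 0 <= K & forall c X f (B : R), c1 <= c ->
    open X -> holomorphic_on f (OmX c X) ->
    (forall p, OmX c X p -> cabs (f p) <= B * expR (b * Re p.1)) ->
    exists w : V -> C, [/\ holomorphic_on w (OmX c X),
      forall p, OmX c X p ->
        \sum_(i < (size ls).+1) (\prod_(l <- ls) ('X - l%:P))`_i * iter i Dt w p = f p &
      forall j p, (j < size ls)%N -> OmX c X p ->
        cabs (iter j Dt w p) <= K * B * expR (b * Re p.1)].
Proof.
elim: ls => [|l ls IH] hls.
  exists 1 => //; exists 0 => // c X f B c1 oX hf fB; exists f; split=> // p _.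
  by rewrite big_ord1 big_nil coefC /= mul1r.
have [|c1 c1_ge1 [K1 K10 H1]] := @ode1 R n psi psi_ge0 psi0 psi_cvx psi_cont l b.
  by apply: hls; rewrite mem_head.
have [|c2 c2_ge1 [K2 K20 H2]] := IH.
  by move=> l' hl'; apply: hls; rewrite inE hl' orbT.
set m := size ls in H2 *; set P := \prod_(l <- ls) _ in H2.
pose S := \sum_(i < m) cabs P`_i.
have S0 : 0 <= S by apply: sumr_ge0 => i _; exact: cabs_ge0.
exists (Num.max c1 c2); first by rewrite le_max c1_ge1.
have KK0 : 0 <= 1 + K2 * (1 + S) by rewrite addr_ge0// mulr_ge0// addr_ge0.
exists (K1 * (1 + K2 * (1 + S))); first by rewrite mulr_ge0.
move=> c X f B; rewrite ge_max => /andP[hc1 hc2] oX hf fB.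
have oU := @OmX_open R n psi psi_cont c X oX.
have [g [g1 g2 g3]] := H1 c X f B hc1 oX hf fB.
have [w [w1 w2 w3]] := H2 c X g (K1 * B) hc2 oX g1 g3.
have sP : size P = m.+1 by rewrite size_prod_XsubC.
have PS : P`_m.+1 = 0 by rewrite nth_default// sP.
have Pm : P`_m = 1.
  have := monic_prod_XsubC ls xpredT id; rewrite -/P => /monicP.
  by rewrite /lead_coef sP.
exists w; split=> //.
- move=> p Up; rewrite big_cons -/P /= -/m.
  have cE i : (('X - l%:P) * P)`_i = (if i is i'.+1 then P`_i' else 0) - l * P`_i.
    by rewrite mulrBl coefB coefXM coefCM; case: i.
  rewrite (eq_bigr (fun i : 'I_m.+2 => (if val i is i'.+1 then P`_i' else 0) * iter i Dt w p
     - l * (P`_i * iter i Dt w p))); last first.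
    by move=> i _; rewrite cE mulrBl mulrA.
  rewrite sumrB -mulr_sumr [X in l * X]big_ord_recr /= PS mul0r addr0 w2//.
  rewrite big_ord_recl /= mul0r add0r.
  transitivity (Dt g p - l * g p); last by rewrite g2//; ring.
  congr (_ - _).
  transitivity (Dt (fun q => \sum_(i < m.+1) P`_i * iter i Dt w q) p).
    have [_] := @D_lincomb V m.+1 (fun i => P`_i) (fun i => iter i Dt w) p et
      (fun i _ => holo_iterDt oU i w1 Up).
    by rewrite /Dt => ->; apply: eq_bigr.
  exact: (@D_eq_on R _ _ _ _ p et oU Up w2).
move=> j p; rewrite /= -/m ltnS leq_eqVlt => hj Up.
have fp := fB p Up; have e0 := expR_gt0 (b * Re p.1).
have B0 : 0 <= B by have := le_trans (cabs_ge0 _) fp; rewrite pmulr_lge0.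
have low i : (i < m)%N -> cabs (iter i Dt w p) <= K2 * (K1 * B) * expR (b * Re p.1).
  by move=> hi; exact: w3.
have KB0 : 0 <= K1 * B * expR (b * Re p.1) by rewrite !mulr_ge0// ltW.
set T := K1 * B * expR (b * Re p.1) in KB0.
have lowT i : (i < m)%N -> cabs (iter i Dt w p) <= K2 * T.
  by move=> hi; apply: (le_trans (low i hi)); rewrite /T !mulrA lexx.
have -> : K1 * (1 + K2 * (1 + S)) * B * expR (b * Re p.1) = T * (1 + K2 * (1 + S)).
  by rewrite /T; ring.
case/orP: hj => [/eqP ->|/lowT h]; last first.
  rewrite (le_trans h)// mulrC ler_wpM2l// mulrDr mulr1 addrCA lerDl.
  by rewrite addr_ge0// mulr_ge0.
have -> : iter m Dt w p = g p - \sum_(i < m) P`_i * iter i Dt w p.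
  by rewrite -w2// big_ord_recr /= Pm mul1r [X in X - _]addrC addrK.
apply: (le_trans (cabsD _ _)); rewrite cabsN.
have h1 : cabs (g p) <= T by exact: g3.
have h2 : cabs (\sum_(i < m) P`_i * iter i Dt w p) <= S * (K2 * T).
  apply: (le_trans (cabs_sum _ _ _)); rewrite /S mulr_suml; apply: ler_sum => i _.
  by rewrite cabsM ler_wpM2l ?cabs_ge0// lowT.
have : 0 <= K2 * T by rewrite mulr_ge0.
have -> : T * (1 + K2 * (1 + S)) = T + K2 * T + S * (K2 * T) by ring.
lra.
Qed.

Lemma geo_luc (Wn : nat -> V -> C) (U : set V) (K : R) : 0 <= K ->
  (forall N p, U p -> cabs (Wn N.+1 p - Wn N p) <= K / 2 ^+ N.+1) ->
  open U -> exists W, luc Wn W U.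
Proof.
move=> K0 hW oU.
have ex p : U p -> exists l, forall i, cabs (Wn i p - l) <= K / 2 ^+ i.
  by move=> Up; apply: geo_cvg => // k; exact: hW.
pose W p := if pselect (U p) is left Up then projT1 (cid (ex p Up)) else 0.
exists W => p Up; have [d d0 hd] := open_nrm oU Up; exists d => // e e0.
have [N hN] := half_small K0 e0; exists N => k Nk q /hd Uq.
rewrite (le_trans _ (ltW (hN k Nk)))// /W; case: pselect => // Uq'.
exact: (projT2 (cid (ex q Uq'))).
Qed.

Lemma luc_pt (Wn : nat -> V -> C) W (U : set V) p (e : R) : luc Wn W U -> U p -> 0 < e ->
  exists N, forall k, (N <= k)%N -> cabs (Wn k p - W p) <= e.
Proof.
move=> cv Up e0; have [d d0 h] := cv p Up; have [N hN] := h e e0.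
by exists N => k Nk; apply: hN; rewrite ?subrr ?nrm0.
Qed.

(** The characteristic polynomial splits because the complex numbers are algebraically closed. *)
Lemma roots_of m (cn : nat -> C) : exists2 ls : seq C, size ls = m &
  forall i, (i <= m)%N -> (\prod_(l <- ls) ('X - l%:P))`_i =
    (i == m)%:R - (if (i < m)%N then cn i else 0).
Proof.
pose P : {poly R[i]} := 'X^m - \poly_(i < m) cn i.
have sP : size P = m.+1.
  by rewrite size_polyDl ?size_polyXn// size_polyN ltnS size_poly.
have lP : lead_coef P = 1.
  by rewrite /lead_coef sP /= coefB coefXn eqxx coef_poly ltnn subr0.
have [ls hls] := closed_field_poly_normal P.
rewrite lP scale1r in hls.
exists ls; first by apply: succn_inj; rewrite -sP hls size_prod_XsubC.
by move=> i im; rewrite -[LHS]/((\prod_(l <- ls) ('X - l%:P) : {poly R[i]})`_i) -hls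
  coefB coefXn coef_poly.
Qed.

Definition cvgC (a : nat -> C) (l : C) := forall e : R, 0 < e ->
  exists N, forall k, (N <= k)%N -> cabs (a k - l) <= e.

Lemma cvgC_add a b l l' : cvgC a l -> cvgC b l' -> cvgC (fun k => a k + b k) (l + l').
Proof.
move=> ha hb e e0; have e2 : 0 < e / 2 by rewrite divr_gt0.
have [N hN] := ha _ e2; have [M hM] := hb _ e2.
exists (maxn N M) => k; rewrite geq_max => /andP[Nk Mk].
have -> : a k + b k - (l + l') = (a k - l) + (b k - l') by ring.
by rewrite (le_trans (cabsD _ _))// [leRHS](splitr e) lerD ?hN ?hM.
Qed.

Lemma cvgC_mul a l z : cvgC a l -> cvgC (fun k => z * a k) (z * l).
Proof.
move=> ha e e0; have z1 : 0 < cabs z + 1 by rewrite ltr_wpDl// cabs_ge0.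
have [N hN] := ha _ (divr_gt0 e0 z1); exists N => k Nk.
rewrite -mulrBr cabsM (@le_trans _ _ ((cabs z + 1) * cabs (a k - l)))//.
  by rewrite ler_wpM2r ?cabs_ge0// lerDl.
by rewrite mulrC -ler_pdivlMr// hN.
Qed.

Lemma cvgC_sum N (a : nat -> nat -> C) (l : nat -> C) :
  (forall i, (i < N)%N -> cvgC (a i) (l i)) ->
  cvgC (fun k => \sum_(i < N) a i k) (\sum_(i < N) l i).
Proof.
elim: N => [|N IH] h.
  by rewrite big_ord0; move=> e e0; exists 0%N => k _; rewrite big_ord0 subrr cabs0 ltW.
rewrite big_ord_recr /= => e e0.
have [M hM] := cvgC_add (IH (fun i hi => h i (ltnW hi))) (h N (ltnSn N)) e0.
by exists M => k /hM; rewrite big_ord_recr.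
Qed.

Lemma cvgC_uniq a l l' : cvgC a l -> cvgC a l' -> l = l'.
Proof.
move=> h h'; apply/eqP; rewrite -subr_eq0; apply/eqP/cabs_eq0/eqP.
rewrite eq_le cabs_ge0 andbT; apply/ler_addgt0Pr => e e0; rewrite add0r.
have e2 : 0 < e / 2 by rewrite divr_gt0.
have [N hN] := h _ e2; have [M hM] := h' _ e2.
rewrite [leRHS](splitr e).
exact: cabs_tri (hN _ (leq_maxl N M)) (hM _ (leq_maxr N M)).
Qed.

Lemma cvgC_ext a b l : (forall k, a k = b k) -> cvgC a l -> cvgC b l.
Proof. by move=> ab; have -> : b = a by apply/funext => k; rewrite ab. Qed.

Lemma cvgC_half (a : nat -> C) l (K : R) : 0 <= K ->
  (forall k, cabs (a k - l) <= K / 2 ^+ k) -> cvgC a l.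
Proof.
move=> K0 h e e0; have [N hN] := half_small K0 e0; exists N => k Nk.
by rewrite (le_trans (h k))// ltW// hN.
Qed.

Lemma snd_diff (g : 'rV[C]_n -> C) (p : V) : differentiable g p.2 ->
  differentiable (fun p : V => g p.2) p.
Proof.
move=> dg; apply: (@differentiable_comp _ _ _ _ (fun p : V => p.2) g) => //.
suff [] : differentiable (fun p : V => p.2) p /\
   forall v, 'D_v (fun p : V => p.2) p = v.2 by [].
apply: (@diff_intro _ _ _ _ _ (fun v : V => v.2) 1) => //.
- by move=> v; rewrite mul1r; exact: nrm_snd.
move=> e e0; exists 1 => // h _.
have -> : (p + h).2 - p.2 - h.2 = 0.
  by rewrite -[(p + h).2]/(p.2 + h.2) [p.2 + _]addrC addrK subrr.
by rewrite nrm0 mulr_ge0 ?nrm_ge0// ltW.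
Qed.

Section Open.
Variable U : set V.
Hypothesis oU : open U.

Lemma iterDt_add j (f g : V -> C) p : holomorphic_on f U -> holomorphic_on g U ->
  U p -> iter j Dt (fun q => f q + g q) p = iter j Dt f p + iter j Dt g p.
Proof.
move=> hf hg; elim: j p => [//|j IH] p Up /=.
transitivity (Dt (fun q => iter j Dt f q + iter j Dt g q) p).
  exact: (@D_eq_on R _ _ _ U p et oU Up IH).
by apply: DtD; [exact: (holo_iterDt oU j hf) | exact: (holo_iterDt oU j hg)].
Qed.

Lemma iterDt0 j p : U p -> iter j Dt (fun=> 0 : C) p = 0.
Proof.
elim: j p => [//|j IH] p Up /=.
transitivity (Dt (fun=> 0 : C) p); first exact: (@D_eq_on R _ _ _ U p et oU Up IH).
exact: (@derive_cst _ _ _ (0 : C) p et).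
Qed.

Lemma DX0 s p : U p -> DX s (fun=> 0 : C) p = 0.
Proof.
elim: s p => [//|i s IH] p Up /=.
transitivity (Dx i (fun=> 0 : C) p); first exact: (@D_eq_on R _ _ _ U p (ex i) oU Up IH).
exact: (@derive_cst _ _ _ (0 : C) p (ex i)).
Qed.

Lemma DX_add s (f g : V -> C) p : holomorphic_on f U -> holomorphic_on g U ->
  U p -> DX s (fun q => f q + g q) p = DX s f p + DX s g p.
Proof.
move=> hf hg; elim: s p => [//|i s IH] p Up /=.
transitivity (Dx i (fun q => DX s f q + DX s g q) p).
  exact: (@D_eq_on R _ _ _ U p (ex i) oU Up IH).
exact: (@deriveD _ _ _ (DX s f) (DX s g) p (ex i)
  (diff_derivable (holo_DX oU s hf Up)) (diff_derivable (holo_DX oU s hg Up))).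
Qed.

Lemma holo_add (f g : V -> C) : holomorphic_on f U -> holomorphic_on g U ->
  holomorphic_on (fun q => f q + g q) U.
Proof. by move=> hf hg p Up; apply: differentiableD; [exact: hf | exact: hg]. Qed.

End Open.

Section VariableCoefficients.
Variables (m : nat) (cf : nat -> 'rV[C]_n -> C) (ls : seq C) (b : R).
Hypotheses (hm : (0 < m)%N) (sls : size ls = m)
  (hP : forall i, (i <= m)%N -> (\prod_(l <- ls) ('X - l%:P))`_i =
    (i == m)%:R - (if (i < m)%N then cf i 0 else 0))
  (hb : forall l, l \in ls -> Re l != b) (b0 : 0 <= b).

(* Perturbation of the constant coefficient operator at [x = 0] by a Neumann
   series: no loss of [x]-derivatives occurs. *)
Lemma ode_x : exists2 c1 : R, 1 <= c1 & exists2 eta : R, 0 < eta &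
  exists2 K : R, 0 <= K & forall c X f (B : R), c1 <= c ->
    open X -> (forall i, (i < m)%N -> holomorphic_on (cf i) X /\
      forall x, X x -> cabs (cf i x - cf i 0) <= eta) ->
    holomorphic_on f (OmX c X) ->
    (forall p, OmX c X p -> cabs (f p) <= B * expR (b * Re p.1)) ->
    exists w : V -> C, [/\ holomorphic_on w (OmX c X),
      forall p, OmX c X p ->
        iter m Dt w p = \sum_(i < m) cf i p.2 * iter i Dt w p + f p &
      forall j p, (j < m)%N -> OmX c X p ->
        cabs (iter j Dt w p) <= K * B * expR (b * Re p.1)].
Proof.
have [c1 c11 [K K0 H]] := ode_const hb; rewrite sls in H.
(* With this [eta] one has [m * K * eta <= 1 / 2], so each remainder of the Neumann series is at
   most half the previous one. *)
exists c1 => //; pose eta := (2 * (m%:R * K + 1))^-1.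
have mK : 0 < m%:R * K + 1 by rewrite ltr_wpDl// mulr_ge0.
have eta0 : 0 < eta by rewrite invr_gt0 mulr_gt0.
exists eta => //; exists (2 * K); first by rewrite mulr_ge0.
move=> c X f B cc1 oX hcf hf fB; have oU := @OmX_open R n psi psi_cont c X oX.
set U := OmX c X in hf fB oU *.
(* A point of the domain is what yields [0 <= B]; the empty domain is set apart. *)
have [[p0 Up0]|noU] := pselect (exists p, U p); last first.
  by exists f; split=> // [p Up|j p _ Up]; case: noU; exists p.
have B0 : 0 <= B.
  by have := le_trans (cabs_ge0 _) (fB p0 Up0); rewrite pmulr_lge0// expR_gt0.
pose cond k g := holomorphic_on g U /\
  forall p, U p -> cabs (g p) <= B / 2 ^+ k * expR (b * Re p.1).
pose good k g w := [/\ holomorphic_on w U,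
  forall p, U p -> iter m Dt w p - \sum_(i < m) cf i 0 * iter i Dt w p = g p &
  forall j p, (j < m)%N -> U p ->
    cabs (iter j Dt w p) <= K * (B / 2 ^+ k) * expR (b * Re p.1)].
have solve k g : cond k g -> exists w, good k g w.
  move=> [hg gB]; have [w [w1 w2 w3]] := H c X g _ cc1 oX hg gB.
  exists w; split=> // p Up; rewrite -w2// big_ord_recr /= hP// eqxx ltnn subr0 mul1r addrC.
  congr (_ + _); rewrite -sumrN; apply: eq_bigr => i _.
  by rewrite hP ?(ltnW (ltn_ord i))// ltn_ord ltn_eqF// sub0r mulNr.
pose S k g := if pselect (exists w, good k g w) is left h then projT1 (cid h) else g.
have hS k g : cond k g -> good k g (S k g).
  move=> /solve h; rewrite /S; case: pselect => // h'; exact: (projT2 (cid h')).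
(* What the operator frozen at [x = 0] leaves over; it is the right-hand side of the next
   equation. *)
pose rem (w : V -> C) (p : V) : C := \sum_(i < m) (cf i p.2 - cf i 0) * iter i Dt w p.
pose fix fs (k : nat) : V -> C := if k is k'.+1 then rem (S k' (fs k')) else f.
have hrem k g w : good k g w -> cond k.+1 (rem w).
  move=> [w1 w2 w3]; split.
    move=> p Up; have -> : rem w = \sum_(i < m) (fun p : V => (cf i p.2 - cf i 0) * iter i Dt w p).
      by apply/funext => q; rewrite fct_sumE.
    apply: differentiable_sum => i.
    apply: (@differentiableM _ _ (fun p : V => cf i p.2 - cf i 0) (iter i Dt w)).
      apply: differentiableB; last exact: differentiable_cst.
      by apply: snd_diff; apply: (hcf i (ltn_ord i)).1; case: Up.
    exact: (holo_iterDt oU i w1).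
  move=> p Up; apply: (le_trans (cabs_sum _ _ _)).
  set E := expR _.
  apply: (@le_trans _ _ (\sum_(i < m) eta * (K * (B / 2 ^+ k) * E))).
    apply: ler_sum => i _; rewrite cabsM.
    apply: ler_pM; rewrite ?cabs_ge0//; last exact: w3.
    by apply: (hcf i (ltn_ord i)).2; case: Up.
  rewrite sumr_const card_ord -[leLHS]mulr_natl.
  have T0 : 0 <= B / 2 ^+ k * E by rewrite !mulr_ge0 ?expR_ge0// invr_ge0 exprn_ge0.
  have -> : B / 2 ^+ k.+1 * E = 2^-1 * (B / 2 ^+ k * E).
    by rewrite exprS; field; rewrite expf_neq0.
  have -> : m%:R * (eta * (K * (B / 2 ^+ k) * E)) =
    (m%:R * K / (m%:R * K + 1)) * (2^-1 * (B / 2 ^+ k * E)).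
    by rewrite /eta; field; rewrite expf_neq0// gt_eqF.
  apply: ler_piMl; first by rewrite mulr_ge0.
  by rewrite ler_pdivrMr// mul1r lerDl.
have hfs k : cond k (fs k).
  elim: k => [|k IH]; first by split=> // p Up; rewrite expr0 divr1; exact: fB.
  exact: (hrem k (fs k) _ (hS k _ IH)).
pose ws k := S k (fs k).
have hws k : good k (fs k) (ws k) := hS k _ (hfs k).
pose fix W (N : nat) : V -> C := if N is N'.+1 then fun q => W N' q + ws N' q else fun=> 0.
have hW N : holomorphic_on (W N) U.
  elim: N => [|N IH]; first by move=> p _; exact: differentiable_cst.
  by apply: holo_add => //; have [] := hws N.
pose EqL (w : V -> C) p := iter m Dt w p - \sum_(i < m) cf i p.2 * iter i Dt w p.
have i0 j p : U p -> iter j Dt (fun=> 0 : C) p = 0 := @iterDt0 U oU j p.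
have EW N p : U p -> EqL (W N) p = f p - fs N p.
  move=> Up; elim: N => [|N IH].
    rewrite /EqL /= i0// subrr sub0r big1 ?oppr0// => i _; by rewrite i0// mulr0.
  have [w1 w2 _] := hws N.
  transitivity (EqL (W N) p + EqL (ws N) p).
    rewrite /EqL /= (iterDt_add oU _ (hW N) w1 Up).
    rewrite (eq_bigr (fun i : 'I_m => cf i p.2 * iter i Dt (W N) p + cf i p.2 * iter i Dt (ws N) p)).
      rewrite big_split /=; ring.
    by move=> i _; rewrite (iterDt_add oU _ (hW N) w1 Up) mulrDr.
  rewrite IH; have -> : EqL (ws N) p = fs N p - fs N.+1 p.
    rewrite -(w2 p Up) /EqL /= /rem -/(ws N).
    under [X in _ = _ - X]eq_bigr do rewrite mulrBl.
    rewrite sumrB; ring.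
  ring.
have E1 p : U p -> expR (b * Re p.1) <= 1.
  move=> [h _]; rewrite -expR0 ler_expR mulr_ge0_le0//.
  have c0 : 0 <= c by apply: le_trans cc1; exact: le_trans c11.
  by have := Om_ltc psi_ge0 c0 h; lra.
have pB (M : R) : 0 <= M -> 0 <= M * B by move=> ?; rewrite mulr_ge0.
have Wstep N p : U p -> cabs (W N.+1 p - W N p) <= 2 * K * B / 2 ^+ N.+1.
  move=> Up; rewrite /= addrC addKr; have [_ _ /(_ 0%N p hm Up) /= h] := hws N.
  apply: (le_trans h); apply: (@le_trans _ _ (K * (B / 2 ^+ N))).
    by rewrite ler_piMr ?E1// !mulr_ge0// invr_ge0 exprn_ge0.
  by rewrite le_eqVlt; apply/orP; left; apply/eqP; rewrite exprS; field; rewrite expf_neq0.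
have KB0 : 0 <= 2 * K * B by rewrite !mulr_ge0.
have [w cw] := geo_luc KB0 Wstep oU.
have cj j p : U p -> cvgC (fun N => iter j Dt (W N) p) (iter j Dt w p).
  by move=> Up e e0; exact: (@luc_pt (fun N => iter j Dt (W N)) (iter j Dt w) U p e
    (luc_iterDt oU j hW cw) Up e0).
exists w; split.
- exact: weierstrass oU hW cw.
- move=> p Up; apply/eqP; rewrite addrC -subr_eq; apply/eqP.
  have h1 : cvgC (fun N => EqL (W N) p) (EqL w p).
    apply: cvgC_add; first exact: cj.
    have h2 := cvgC_mul (-1) (cvgC_sum (N := m) (fun i _ => cvgC_mul (cf i p.2) (cj i p Up))).
    rewrite mulN1r in h2; apply: cvgC_ext h2 => N; by rewrite mulN1r.
  apply: (cvgC_uniq h1); apply: (@cvgC_half _ _ B B0) => N.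
  rewrite EW// addrC addKr cabsN; have [_ /(_ p Up) h] := hfs N.
  apply: (le_trans h); rewrite ler_piMr ?E1// divr_ge0// exprn_ge0.
move=> j p hj Up; apply: cabs_lim_le (cj j p Up) _; exists 0%N => N _.
set E := expR _; have E0 : 0 <= E by exact: expR_ge0.
have -> : 2 * K * B * E = 2 * (K * B * E) by ring.
(* The bound is strengthened by the tail of the geometric series so that adding the term of number
   [N] preserves it. *)
apply: (@le_trans _ _ (2 * (K * B * E) - 2 * (K * B * E) / 2 ^+ N)); last first.
  by rewrite gerBl divr_ge0 ?mulr_ge0// exprn_ge0.
elim: N => [|N IH]; first by rewrite /= i0// cabs0 expr0 divr1 subrr.
have [w1 _ w3] := hws N.
rewrite (iterDt_add oU _ (hW N) w1 Up) (le_trans (cabsD _ _))//.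
apply: (le_trans (lerD IH (w3 j p hj Up))); rewrite -/E exprS le_eqVlt.
by apply/orP; left; apply/eqP; field; rewrite expf_neq0.
Qed.

End VariableCoefficients.

End LinearODE.

(** * Coordinates and continuity of jets *)

Section JetFacts.
Variable R : realType.
Local Notation C := (Cplx R).
Variables m n : nat.
Local Notation V := (RC0 R * 'rV[C]_n)%type.
Local Notation Z := (Zvec R m n).

Fact k0_subproof (j : 'I_m) :
  ((j, [ffun=> ord0] : {ffun 'I_n -> 'I_m.+1}).1 +
   \sum_i (j, [ffun=> ord0] : {ffun 'I_n -> 'I_m.+1}).2 i <= m)%N.
Proof.
rewrite /= big1 ?addn0 => [|i _]; last by rewrite ffunE.
exact/ltnW/ltn_ord.
Qed.

(** The index [(j, 0)] of the pure [t]-derivative of order [j]. *)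
Definition k0 (j : 'I_m) : Idx m n :=
  exist _ (j, [ffun=> ord0] : {ffun 'I_n -> 'I_m.+1}) (k0_subproof j).

Definition zc (j : 'I_m) (z : Z) : C := z 0 (enum_rank (k0 j)).

Lemma jetvE (u : V -> C) p (k : Idx m n) :
  jetv m u p 0 (enum_rank k) = iter (idx_j k) Dt (DX (dlist (idx_a k)) u) p.
Proof. by rewrite mxE enum_rankK. Qed.

Lemma dlist_k0 j : dlist (idx_a (k0 j)) = [::].
Proof.
apply: size0nil; rewrite size_dlist big1// => i _.
by rewrite /idx_a /k0 /= ffunE.
Qed.

Lemma zc_jetv (u : V -> C) p j : zc j (jetv m u p) = iter j Dt u p.
Proof. by rewrite /zc jetvE dlist_k0. Qed.

Lemma idx_le (k : Idx m n) : (idx_j k + size (dlist (idx_a k)) <= m)%N.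
Proof. by rewrite size_dlist; exact: (valP k). Qed.

Lemma nrm_jetv_le (u : V -> C) p (M : R) : 0 <= M ->
  (forall (j : 'I_m) s, (j + size s <= m)%N -> cabs (iter j Dt (DX s u) p) <= M) ->
  nrm (jetv m u p) <= M.
Proof.
move=> M0 h; apply: nrm_row_le => // i; rewrite -(enum_valK i) jetvE.
exact/h/idx_le.
Qed.

Lemma row_diff (N : nat) (f : 'I_N -> V -> C) p : (forall k, differentiable (f k) p) ->
  differentiable (fun p => \row_k f k p) p.
Proof.
move=> df.
have -> : (fun p => \row_k f k p) = \sum_k (fun p => f k p *: delta_mx 0 k).
  apply/funext => q; rewrite fct_sumE {1}(row_sum_delta (\row_k f k q)).
  by apply: eq_bigr => k _; rewrite mxE.
by apply: differentiable_sum => k; exact: differentiableZl.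
Qed.

Lemma pair_diff (W W' : normedModType C) (f : V -> W) (g : V -> W') p :
  differentiable f p -> differentiable g p -> differentiable (fun p => (f p, g p)) p.
Proof. exact: differentiable_pair. Qed.

Section Open.
Variable U : set V.
Hypothesis oU : open U.

Lemma jetv_diff (u : V -> C) p : holomorphic_on u U -> U p ->
  differentiable (fun p => jetv m u p) p.
Proof.
move=> hu Up; apply: row_diff => k.
exact: (holo_iterDt oU _ (holo_DX oU _ hu) Up).
Qed.

Lemma jetvD (u v : V -> C) p : holomorphic_on u U -> holomorphic_on v U -> U p ->
  jetv m (fun q => u q + v q) p = jetv m u p + jetv m v p.
Proof.
move=> hu hv Up; apply/rowP => k; rewrite !mxE.
rewrite -(iterDt_add oU _ (holo_DX oU _ hu) (holo_DX oU _ hv) Up).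
elim: (nat_of_ord (idx_j (enum_val k))) p Up => [|j IH] p Up.
  exact: (DX_add oU _ hu hv Up).
exact: (@D_eq_on R _ _ _ U p et oU Up IH).
Qed.

Lemma jetv0 p : U p -> jetv m (fun=> 0 : C) p = 0.
Proof.
move=> Up; apply/rowP => k; rewrite !mxE.
transitivity (iter (idx_j (enum_val k)) Dt (fun=> 0 : C) p); last exact: (iterDt0 oU _ Up).
elim: (nat_of_ord (idx_j (enum_val k))) p Up => [|j IH] p Up.
  exact: (DX0 oU _ Up).
exact: (@D_eq_on R _ _ _ U p et oU Up IH).
Qed.

Lemma jetv_cvg (uk : nat -> V -> C) u p (e : R) : (forall k, holomorphic_on (uk k) U) ->
  luc uk u U -> U p -> 0 < e ->
  exists N, forall k, (N <= k)%N -> nrm (jetv m (uk k) p - jetv m u p) <= e.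
Proof.
move=> huk cv Up e0.
suff [N hN] : exists N, forall (i : 'I_#|Idx m n|) k, (N <= k)%N ->
    cabs ((jetv m (uk k) p - jetv m u p) 0 i) <= e.
  by exists N => k Nk; apply: nrm_row_le => [|i]; [exact: ltW | exact: hN].
have h i : exists N, forall k, (N <= k)%N -> cabs ((jetv m (uk k) p - jetv m u p) 0 i) <= e.
  have cv2 := luc_iterDt oU (idx_j (enum_val i)) (fun k => holo_DX oU _ (huk k))
    (luc_DX oU (dlist (idx_a (enum_val i))) huk cv).
  have [N hN] := luc_pt cv2 Up e0.
  by exists N => k /hN; rewrite !mxE.
pose N i := projT1 (cid (h i)).
exists (\max_i N i) => i k hk; apply: (projT2 (cid (h i))).
by apply: leq_trans hk; exact: (leq_bigmax i).
Qed.

End Open.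
End JetFacts.

(** * Approximate solutions of high order *)

Section Nonlinear.
Variable R : realType.
Local Notation C := (Cplx R).
Variables m n : nat.
Local Notation V := (RC0 R * 'rV[C]_n)%type.
Local Notation Z := (Zvec R m n).
Local Notation Re := complex.Re.
Variable psi : R -> R.
Hypotheses (psi_ge0 : forall y, 0 <= psi y) (psi0 : psi 0 = 0)
  (psi_cvx : forall x y s : R, 0 <= s <= 1 ->
     psi ((1 - s) * x + s * y) <= (1 - s) * psi x + s * psi y)
  (psi_cont : continuous psi).

Definition xball (r : R) : set 'rV[C]_n := [set x | nrm x < r].

Lemma xball_open r : open (xball r).
Proof.
apply/open_nrmP => x /= hx; exists (r - nrm x); first by rewrite subr_gt0.
move=> y hy; rewrite /xball /= -(subrK x y) (le_lt_trans (nrmD _ _))//; lra.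
Qed.

Definition Dom (c r : R) : set V := OmX psi c (xball r).

Lemma Dom_open c r : open (Dom c r).
Proof. exact: (@OmX_open R n psi psi_cont c _ (@xball_open r)). Qed.

Lemma Dom_sub c c' r r' : c <= c' -> r' <= r -> Dom c' r' `<=` Dom c r.
Proof.
move=> cc rr p [h1 h2]; split; first exact: Om_mono cc _ h1.
exact: lt_le_trans h2 rr.
Qed.

Variables (hm : (0 < m)%N) (F : V -> Z -> C) (cf : nat -> 'rV[C]_n -> C) (c0 r0 h : R).
Hypotheses (r00 : 0 < r0) (r01 : r0 <= 1) (h0 : 0 < h)
  (hF : forall p z, Dom c0 r0 p -> nrm z <= expR (4 * h * Re p.1) ->
     differentiable (fun q : V * Z => F q.1 q.2) (p, z))
  (hF0 : forall p, Dom c0 r0 p -> cabs (F p 0) <= expR (7 * h * Re p.1))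
  (hLip : forall p z z', Dom c0 r0 p -> nrm z <= expR (4 * h * Re p.1) ->
     nrm z' <= expR (4 * h * Re p.1) ->
     cabs (F p z - F p z' - \sum_(j < m) cf j p.2 * zc j (z - z')) <=
     expR (2 * h * Re p.1) * nrm (z - z'))
  (hcf : forall j, (j < m)%N -> holomorphic_on (cf j) (xball r0)).

Definition Res (u : V -> C) (p : V) : C := iter m Dt u p - F p (jetv m u p).

Lemma Dom_Re c r p : 1 <= c -> Dom c r p -> Re p.1 < - c.
Proof.
by move=> c1 [h1 _]; exact: (Om_ltc psi_ge0 (le_trans ler01 c1) h1).
Qed.

Lemma Res_holo (u : V -> C) (U : set V) : open U -> U `<=` Dom c0 r0 ->
  holomorphic_on u U -> (forall p, U p -> nrm (jetv m u p) <= expR (4 * h * Re p.1)) ->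
  holomorphic_on (Res u) U.
Proof.
move=> oU sU hu hj p Up; apply: differentiableB.
  exact: (holo_iterDt oU m hu Up).
apply: (@differentiable_comp _ _ _ _ (fun p => (p, jetv m u p))
  (fun q : V * Z => F q.1 q.2)).
  by apply: pair_diff; [exact: ex_diff | exact: (@jetv_diff R m n U oU u p hu Up)].
by apply: hF; [exact: sU | exact: hj].
Qed.

(** With [x = Re t], a constant factor costs an arbitrarily small power of [|t|] once [|t|] is small
    enough. *)
Lemma exp_absorb (A k : R) : 0 < k -> exists2 c : R, 1 <= c &
  forall x : R, x <= - c -> A * expR (k * x) <= 1.
Proof.
move=> k0; exists (Num.max 1 (`|A| / k)); first by rewrite le_max lexx.
move=> x; rewrite lerNr ge_max => /andP[x1 x2].
apply: (@le_trans _ _ (`|A| * expR (k * x))); first by rewrite ler_wpM2r ?expR_ge0// ler_norm.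
have Akx : `|A| <= - (k * x) by rewrite -mulrN mulrC -ler_pdivrMr.
rewrite -[k * x]opprK expRN ler_pdivrMr ?expR_gt0// mul1r.
by apply: (le_trans Akx); apply: le_trans (expR_ge1Dx _); rewrite lerDr.
Qed.

Lemma avoid (s : seq R) (a b : R) : a < b -> exists2 x, a <= x <= b & x \notin s.
Proof.
elim: s a b => [|y s IH] a b ab; first by exists a => //; rewrite lexx ltW.
pose c := (a + b) / 2; have [hc1 hc2] : a < c /\ c < b by rewrite /c; split; lra.
have [yc|cy] := leP y c.
  pose d := (c + b) / 2; have [hd1 hd2] : c < d /\ d < b by rewrite /d; split; lra.
  have [x /andP[x1 x2] xs] := IH _ _ hd2; exists x.
    by apply/andP; split=> //; apply: ltW; lra.
  by rewrite inE negb_or xs andbT; apply/eqP => xy; rewrite xy in x1; lra.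
have [x /andP[x1 x2] xs] := IH _ _ hc1; exists x.
  by apply/andP; split=> //; lra.
by rewrite inE negb_or xs andbT; apply/eqP => xy; rewrite xy in x2; lra.
Qed.

Lemma cf_close (eta : R) (r : R) : 0 < eta -> 0 < r -> r <= r0 -> exists2 r1 : R, 0 < r1 <= r &
  forall i x, (i < m)%N -> xball r1 x -> cabs (cf i x - cf i 0) <= eta.
Proof.
move=> eta0 rp rr.
have hN N : (N <= m)%N -> exists2 r1 : R, 0 < r1 <= r &
    forall i x, (i < N)%N -> xball r1 x -> cabs (cf i x - cf i 0) <= eta.
  elim: N => [|N IH] hN; first by exists r; rewrite ?rp ?lexx.
  have [r1 /andP[r10 r1r] h1] := IH (ltnW hN).
  have x0 : xball r0 0 by rewrite /xball /= nrm0.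
  have [d d0 hd] := diff_cont (hcf hN x0) eta0.
  exists (Num.min r1 d); first by rewrite lt_min r10 d0 ge_min r1r.
  move=> i x; rewrite ltnS leq_eqVlt => /orP[/eqP ->|iN].
    by rewrite /xball /= lt_min => /andP[_ xd]; apply/ltW/hd; rewrite subr0.
  by rewrite /xball /= lt_min => /andP[xr _]; exact: h1.
exact: hN.
Qed.

(** Only the residual exponent [b] improves from step to step; the jet exponent stays at [6 * h].
    The constant [A] may grow, since it is absorbed in the end. *)
Definition approx (b c r : R) (u : V -> C) := [/\ c0 <= c, 0 < r <= r0,
  holomorphic_on u (Dom c r) & exists2 A : R, 0 <= A &
    forall p, Dom c r p -> nrm (jetv m u p) <= A * expR (6 * h * Re p.1) /\
      cabs (Res u p) <= A * expR (b * Re p.1)].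

Lemma approx_start : approx (7 * h) c0 r0 (fun=> 0).
Proof.
split; first exact: lexx.
- by rewrite r00 lexx.
- by move=> p _; exact: differentiable_cst.
exists 1 => // p Dp; rewrite /Res (jetv0 m (@Dom_open c0 r0) Dp) nrm0.
rewrite (iterDt0 (@Dom_open c0 r0) _ Dp) sub0r cabsN !mul1r; split.
  exact: expR_ge0.
exact: hF0.
Qed.

(* The linearized equation with constant term [- Res u] is solved exactly; the
   exponent is first moved off the real parts of the characteristic roots. *)
Lemma approx_step b c r u : 7 * h <= b -> approx b c r u ->
  exists c' r' u', approx (b + h) c' r' u'.
Proof.
move=> hb [cc /andP[rp rr] hu [A A0 hA]].
have [ls sls hP] := roots_of m (fun i => cf i 0).
have bh : b - h < b by rewrite gtrBl.
(* Lowering the exponent by at most [h] avoids the characteristic roots; the Lipschitz factor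
   [expR (2 * h * Re t)] then still leaves a gain of [h]. *)
have [b' /andP[b'1 b'2] b's] := avoid [seq Re l | l <- ls] bh.
have b'l l : l \in ls -> Re l != b'.
  by move=> hl; apply: contraNneq b's => <-; exact: map_f.
have b'6 : 6 * h <= b' by lra.
have b'0 : 0 <= b' by apply: le_trans b'6; rewrite mulr_ge0// ltW.
have [c1 c11 [eta eta0 [K K0 hsol]]] := @ode_x R n psi psi_ge0 psi0 psi_cvx psi_cont
  m cf ls b' hm sls hP b'l b'0.
have [r1 /andP[r10 r1r] hr1] := cf_close eta0 rp rr.
have r1r0 : r1 <= r0 := le_trans r1r rr.
have r11 : r1 <= 1 := le_trans r1r0 r01.
(* At most [m] derivatives in [x] are taken by Nagumo's lemma on the disc of half radius, where the
   distance to the boundary is at least [r1 / 2]. *)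
pose A' := nag R 0 m * (K * A) * (2 / r1) ^+ m.
have A'0 : 0 <= A'.
  rewrite mulr_ge0 ?exprn_ge0 ?divr_ge0 ?mulr_ge0//; exact: ltW (nag_gt0 _ _ _) || exact: ltW.
have h2 : 0 < 2 * h by rewrite mulr_gt0.
have [c2 c21 hc2] := exp_absorb (A + A') h2.
pose c' := Num.max c (Num.max c1 c2).
have cc' : c <= c' by rewrite le_max lexx.
have c1c' : c1 <= c' by rewrite !le_max lexx orbT.
have c2c' : c2 <= c' by rewrite !le_max lexx !orbT.
have c'1 : 1 <= c' by exact: le_trans c11 c1c'.
have oU := @Dom_open c' r1; set U := Dom c' r1 in oU.
have sU : U `<=` Dom c r := Dom_sub cc' r1r.
have sU0 : U `<=` Dom c0 r0 := Dom_sub (le_trans cc cc') r1r0.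
have huU : holomorphic_on u U := holo_sub sU hu.
have Re0 p : U p -> Re p.1 < - c' by exact: Dom_Re.
have ReN0 p : U p -> Re p.1 <= 0.
  by move=> /Re0; have := c'1; lra.
have absorb p : U p -> (A + A') * expR (6 * h * Re p.1) <= expR (4 * h * Re p.1).
  move=> Up; have -> : 6 * h * Re p.1 = 2 * h * Re p.1 + 4 * h * Re p.1 by ring.
  rewrite expRD mulrA ler_piMl ?expR_ge0// hc2//.
  by apply: ltW; apply: (lt_le_trans (Re0 p Up)); rewrite lerN2.
have ju p : U p -> nrm (jetv m u p) <= A * expR (6 * h * Re p.1).
  by move=> /sU /hA[].
have ju4 p : U p -> nrm (jetv m u p) <= expR (4 * h * Re p.1).
  move=> Up; apply: (le_trans (ju p Up)); apply: le_trans (absorb p Up).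
  by rewrite ler_wpM2r ?expR_ge0// lerDl.
have hRes := Res_holo oU sU0 huU ju4.
have holc i : (i < m)%N -> holomorphic_on (cf i) (xball r1) /\
    forall x, xball r1 x -> cabs (cf i x - cf i 0) <= eta.
  move=> im; split; last by move=> x; exact: hr1.
  by apply: holo_sub (hcf im) => x hx; exact: lt_le_trans hx r1r0.
have hNRes : holomorphic_on (fun p => - Res u p) U.
  by move=> p Up; apply: differentiableN; exact: hRes.
have leNRes p : U p -> cabs (- Res u p) <= A * expR (b' * Re p.1).
  move=> Up; rewrite cabsN; have [_ h1] := hA p (sU p Up).
  apply: (le_trans h1); apply: ler_wpM2l => //; rewrite ler_expR.
  have := ReN0 p Up; have : 0 <= b - b' by rewrite subr_ge0.
  by move=> /mulr_ge0 X Y; have := X (- Re p.1); rewrite oppr_ge0 => /(_ Y); lra.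
have [v [v1 v2 v3]] := hsol c' (xball r1) _ A c1c' (@xball_open r1) holc hNRes leNRes.
pose U' := Dom c' (r1 / 2).
have r120 : 0 < r1 / 2 by rewrite divr_gt0.
have r12 : r1 / 2 <= r1 by lra.
have sU' : U' `<=` U := Dom_sub (lexx c') r12.
have KA0 : 0 <= K * A by rewrite mulr_ge0.
have jv p : U' p -> nrm (jetv m v p) <= A' * expR (b' * Re p.1).
  move=> Up'; have Up := sU' p Up'; apply: nrm_jetv_le.
    by rewrite mulr_ge0// expR_ge0.
  move=> j s js; rewrite (iterDt_DX oU _ _ v1 Up).
  have nag1 := @nagumo R n U (fun p => r1 - nrm p.2) (fun p => K * A * expR (b' * Re p.1))
    0 (iter j Dt v) s oU (holo_iterDt oU j v1).
  have {nag1}nag1 : cabs (DX s (iter j Dt v) p) <=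
      nag R 0 (size s) * (K * A * expR (b' * Re p.1)) / (r1 - nrm p.2) ^+ (0 + size s).
    apply: nag1 Up => [q i [q1 q2]|q Uq].
      have d0 : 0 < r1 - nrm q.2 by rewrite subr_gt0.
      split=> // z hz.
      have E2 : (q + z *: ex i).2 = q.2 + z *: delta_mx 0 i by [].
      have E1 : (q + z *: ex i).1 = q.1.
        by rewrite -[LHS]/(q.1 + z *: 0) scaler0 addr0.
      have nz : nrm (z *: delta_mx 0 i : 'rV[C]_n) = cabs z.
        by rewrite nrmZ nrm_delta mulr1.
      have H := nrmD q.2 (z *: delta_mx 0 i); rewrite nz in H.
      split; last by rewrite E1.
        by split; rewrite ?E1 ?E2//= /xball /=; lra.
      by rewrite E2; lra.
    by rewrite expr0 divr1; apply: v3.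
  apply: (le_trans nag1); rewrite add0n.
  set E := expR _; have E0 : 0 < E by exact: expR_gt0.
  have dge : r1 / 2 <= r1 - nrm p.2 by case: Up' => _; rewrite /xball /= => H; lra.
  have dpos : 0 < r1 - nrm p.2 by lra.
  have s1 : (size s <= m)%N := leq_trans (leq_addl _ _) js.
  have D1 : ((r1 - nrm p.2) ^+ size s)^-1 <= (2 / r1) ^+ m.
    apply: (@le_trans _ _ ((2 / r1) ^+ size s)).
      have r20 : 0 <= 2 / r1 by rewrite divr_ge0// ltW.
      have di0 : 0 <= (r1 - nrm p.2)^-1 by rewrite invr_ge0 ltW.
      rewrite -exprVn; apply: (lerXn2r (size s) di0 r20).
      by rewrite -[2 / r1]invf_div lef_pV2 ?posrE.
    by apply: ler_weXn2l => //; rewrite ler_pdivlMr// mul1r; lra.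
  rewrite -/A'; have -> : A' * E = nag R 0 m * (K * A * E) * (2 / r1) ^+ m.
    by rewrite /A'; ring.
  have KAE : 0 <= K * A * E by rewrite mulr_ge0// ltW.
  apply: (ler_pM _ _ _ D1).
  - exact: mulr_ge0 (ltW (nag_gt0 _ _ _)) KAE.
  - by rewrite invr_ge0 exprn_ge0// ltW.
  - by rewrite ler_wpM2r// nag_le.
have huv : holomorphic_on (fun q => u q + v q) U by exact: holo_add.
have jD p : U p -> jetv m (fun q => u q + v q) p = jetv m u p + jetv m v p.
  exact: (jetvD m oU huU v1).
exists c', (r1 / 2), (fun q => u q + v q); split.
- exact: le_trans cc cc'.
- by rewrite r120 (le_trans r12).
- exact: holo_sub sU' huv.
exists (A + A'); first by rewrite addr_ge0.
move=> p Up'; have Up := sU' p Up'.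
have e6 : expR (b' * Re p.1) <= expR (6 * h * Re p.1).
  rewrite ler_expR; have := ReN0 p Up; have : 0 <= b' - 6 * h by rewrite subr_ge0.
  by move=> /mulr_ge0 X Y; have := X (- Re p.1); rewrite oppr_ge0 => /(_ Y); lra.
have jv6 : nrm (jetv m v p) <= A' * expR (6 * h * Re p.1).
  by apply: (le_trans (jv p Up')); rewrite ler_wpM2l.
have jw6 : nrm (jetv m (fun q => u q + v q) p) <= (A + A') * expR (6 * h * Re p.1).
  by rewrite jD// (le_trans (nrmD _ _))// mulrDl lerD// ju.
split=> //.
have L := hLip (sU0 p Up) (le_trans jw6 (absorb p Up)) (ju4 p Up).
have jB : jetv m (fun q => u q + v q) p - jetv m u p = jetv m v p.
  by rewrite jD// addrAC subrr add0r.
rewrite jB in L.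
(* The linear equation for [v] cancels the old residual; what is left is the deviation of [F] from
   its linear part, which [hLip] controls. *)
have -> : Res (fun q => u q + v q) p = - (F p (jetv m (fun q => u q + v q) p)
   - F p (jetv m u p) - \sum_(j < m) cf j p.2 * zc j (jetv m v p)).
  rewrite /Res (iterDt_add oU m huU v1 Up) v2// /Res.
  have -> : \sum_(j < m) cf j p.2 * zc j (jetv m v p) =
      \sum_(i < m) cf i p.2 * iter i Dt v p.
    by apply: eq_bigr => j _; rewrite zc_jetv.
  ring.
rewrite cabsN; apply: (le_trans L).
apply: (@le_trans _ _ (expR (2 * h * Re p.1) * (A' * expR (b' * Re p.1)))).
  by rewrite ler_wpM2l ?expR_ge0// jv.
rewrite mulrCA -expRD; apply: (@le_trans _ _ (A' * expR ((b + h) * Re p.1))).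
  rewrite ler_wpM2l// ler_expR.
  have := ReN0 p Up; have : 0 <= b' - (b - h) by rewrite subr_ge0.
  by move=> /mulr_ge0 X Y; have := X (- Re p.1); rewrite oppr_ge0 => /(_ Y); lra.
by rewrite ler_wpM2r ?expR_ge0// lerDr.
Qed.

Lemma approx_exists N : exists c r u, approx (7 * h + N%:R * h) c r u.
Proof.
elim: N => [|N [c [r [u H]]]].
  by exists c0, r0, (fun=> 0); rewrite mul0r addr0; exact: approx_start.
have hb : 7 * h <= 7 * h + N%:R * h by rewrite lerDl mulr_ge0// ltW.
have [c' [r' [u' H']]] := approx_step hb H; exists c', r', u'.
by have -> : 7 * h + N.+1%:R * h = 7 * h + N%:R * h + h by rewrite -natr1; ring.
Qed.

End Nonlinear.

(** * Integration in [t] with a weighted distance *)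

Section CauchyKovalevskaya.
Variable R : realType.
Local Notation C := (Cplx R).
Variable n : nat.
Local Notation V := (RC0 R * 'rV[C]_n)%type.
Local Notation Re := complex.Re.
Variable psi : R -> R.
Hypothesis psi_cont : continuous psi.
Variable sg : R.
Hypothesis sg0 : 0 < sg.

(* The weight [kap * |t| ^ sg] makes the [x]-domain grow as [t -> 0], so that
   integrating in [t] from [0] gains back powers of the distance [dd] to the
   boundary lost by [x]-derivatives. *)
Definition dd (r kap : R) (p : V) : R := r - nrm p.2 - kap * expR (sg * Re p.1).

Definition Del (c r kap : R) : set V := [set p | Om psi c p.1 /\ 0 < dd r kap p].

Lemma Del_open c r kap : 0 < kap -> open (Del c r kap).
Proof.
move=> kap0; apply/open_nrmP => p [h1 h2].
have [d1 d10 hd1] := open_nrm (@Om_open R psi psi_cont c) h1.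
pose e := dd r kap p / 2; have e0 : 0 < e by rewrite divr_gt0.
have ek0 : 0 < e / kap / expR (sg * Re p.1) by rewrite !divr_gt0// expR_gt0.
set k := e / kap / expR (sg * Re p.1) in ek0.
(* Increasing [Re t] by [d2] multiplies [expR (sg * Re t)] by [1 + k], that is, adds exactly [e] to
   the weight. *)
pose d2 := ln (1 + k) / sg.
have d20 : 0 < d2 by rewrite divr_gt0// ln_gt0// ltrDl.
exists (Num.min d1 (Num.min d2 e)); first by rewrite !lt_min d10 d20.
move=> q; rewrite !lt_min => /and3P[q1 q2 q3]; split.
  by apply: hd1; exact: le_lt_trans (nrm_fst (q - p)) q1.
have i1 : Re q.1 < Re p.1 + d2.
  have := le_lt_trans (nrm_fst (q - p)) q2.
  move=> /(le_lt_trans (cabs_ge_Re _)); rewrite -[(q - p).1]/((q.1 : C) - p.1) ReB.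
  by rewrite ltr_norml => /andP[_]; lra.
have i2 : nrm q.2 < nrm p.2 + e.
  have := le_lt_trans (nrm_snd (q - p)) q3; rewrite -[(q - p).2]/(q.2 - p.2).
  by have := nrmD (q.2 - p.2) p.2; rewrite subrK; lra.
have i3 : kap * expR (sg * Re q.1) <= kap * expR (sg * Re p.1) + e.
  have : expR (sg * Re q.1) <= expR (sg * Re p.1) * (1 + k).
    have k10 : 0 < 1 + k by rewrite addr_gt0.
    rewrite -[leRHS]mulr1 -[1 + k](lnK k10) mulr1 -expRD ler_expR.
    have -> : sg * Re p.1 + ln (1 + k) = sg * (Re p.1 + d2).
      by rewrite mulrDr /d2 mulrC [sg * (_ / _)]mulrC divfK ?gt_eqF// mulrC.
    by rewrite ler_pM2l// ltW.
  move=> /(ler_wpM2l (ltW kap0)) H; apply: (le_trans H).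
  rewrite le_eqVlt; apply/orP; left; apply/eqP; rewrite /k; field.
  by rewrite !gt_eqF// expR_gt0.
have e2 : e + e = dd r kap p by rewrite /e; field.
by rewrite /dd; move: e2; rewrite /dd; lra.
Qed.

Lemma dd_shift r kap p (x : R) : 0 <= kap -> x <= 0 -> dd r kap p <= dd r kap (p + rC x *: et).
Proof.
move=> kap0 x0; rewrite shift_et /dd /= ReD /= lerB// ler_wpM2l// ler_expR.
by rewrite ler_pM2l// gerDl.
Qed.

Lemma Del_left c r kap p (x : R) : 0 <= kap -> x <= 0 -> Del c r kap p ->
  Del c r kap (p + rC x *: et).
Proof.
move=> kap0 x0 [h1 h2]; split; last exact: lt_le_trans h2 (dd_shift _ _ kap0 x0).
by rewrite shift_et /= -(opprK x) rCN; apply: Om_left; rewrite ?oppr_ge0.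
Qed.

Lemma Del_mono c r kap kap' : kap <= kap' -> Del c r kap' `<=` Del c r kap.
Proof.
move=> kk p [h1 h2]; split=> //; apply: (lt_le_trans h2).
by rewrite /dd lerB// ler_wpM2r// expR_ge0.
Qed.

Section Primitive.
Variables (c r kap : R).
Hypothesis kap0 : 0 < kap.
Let U := Del c r kap.
Let oU : open U. Proof. exact: Del_open. Qed.

Lemma is_derive_invpow (a b k : R) q (x : R) : 0 < a - b * expR (k * x) ->
  is_derive x 1 (fun x => ((a - b * expR (k * x)) ^+ q.+1)^-1)
    (q.+1%:R * (b * k * expR (k * x)) / (a - b * expR (k * x)) ^+ q.+2).
Proof.
set g := fun x => a - b * expR (k * x) => gx.
have dg : is_derive x 1 g (- (b * k * expR (k * x))).
  have := @is_derive_expaff R b 0 k x => d1.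
  have d2 := is_deriveB (is_derive_cst a x 1) d1.
  rewrite sub0r add0r in d2.
  have -> // : g = cst a - (fun x0 => b * expR (0 + k * x0)).
  by apply/funext => y; rewrite /g /= -[RHS]/(a - b * expR (0 + k * y)) add0r.
have gx0 : g x != 0 by rewrite gt_eqF.
have dgq := is_deriveX q.+1 dg.
rewrite exprfctE in dgq.
have gq : (fun y => g y ^+ q.+1) x != 0 by rewrite /= expf_neq0.
have := @is_deriveV R (fun y => g y ^+ q.+1) x _ 1 gq dgq.
set D := (X in is_derive _ _ _ X -> _) => H.
suff <- : D = q.+1%:R * (b * k * expR (k * x)) / (g x) ^+ q.+2 by exact: H.
have alg (y z w N : R) : y != 0 -> z != 0 ->
    - (y * z) ^- 2 * (N * z * - w) = N * w / (y * (y * z)).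
  by move=> y0 z0; field; rewrite z0 y0.
rewrite /D /= ![g x ^+ _.+1]exprS; apply: alg => //.
exact: expf_neq0.
Qed.

(** Two majorants for the same primitive. Since [dd] grows towards [t = 0], its power may be frozen,
    and integrating the exponential gains [1 / a]. Alternatively, the [t]-derivative of [dd ^- q.+1]
    contains [kap * sg * expR (sg * Re t) / dd ^+ q.+2]: one power of [dd] is regained, at the price
    of [|t| ^ sg]. *)
Lemma prim_step (f : V -> C) : holomorphic_on f U ->
  (exists a B q, 0 < a /\ forall p, U p -> cabs (f p) <= B * expR (a * Re p.1) / dd r kap p ^+ q) ->
  exists v : V -> C, [/\ holomorphic_on v U, forall p, U p -> Dt v p = f p,
    forall a B q, 0 < a ->
      (forall p, U p -> cabs (f p) <= B * expR (a * Re p.1) / dd r kap p ^+ q) ->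
      forall p, U p -> cabs (v p) <= B / a * expR (a * Re p.1) / dd r kap p ^+ q &
    forall a B q, sg <= a ->
      (forall p, U p -> cabs (f p) <= B * expR (a * Re p.1) / dd r kap p ^+ q.+2) ->
      forall p, U p -> cabs (v p) <=
        B / (kap * sg) * expR ((a - sg) * Re p.1) / dd r kap p ^+ q.+1].
Proof.
move=> hf [a0 [B0 [q0 [a00 f0]]]].
have B_ge0 a B q : (forall p, U p -> cabs (f p) <= B * expR (a * Re p.1) / dd r kap p ^+ q) ->
    forall p, U p -> 0 <= B.
  move=> fB p Up; have := le_trans (cabs_ge0 _) (fB p Up).
  by rewrite pmulr_lge0 ?invr_gt0 ?exprn_gt0 ?Up.2// pmulr_lge0 ?expR_gt0.
have [||v [v1 v2 v3]] := @primitive_left R V et U f a0 oU _ hf a00.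
- move=> p t Up t0; rewrite -shiftlN; apply: Del_left => //; first exact: ltW.
  by rewrite oppr_le0.
- move=> p Up; have Bp := B_ge0 _ _ _ f0 p Up.
  (* Openness is used for the smaller radius [r'], so that near [p] the distance stays at least half
     of its value at [p]. *)
  pose r' := r - dd r kap p / 2.
  have Up' : Del c r' kap p.
    by case: Up => u1 u2; split=> //; rewrite /dd /r' /dd; move: u2; rewrite /dd; lra.
  have [d d0 hd] := open_nrm (@Del_open c r' kap kap0) Up'.
  exists (Num.min d 1); first by rewrite lt_min d0 ltr01.
  exists (B0 * expR (a0 * (Re p.1 + 1)) / (dd r kap p / 2) ^+ q0) => q t.
  rewrite lt_min => /andP[q1 q2] t0.
  have [qO qd] := hd q q1.
  have dp2 : 0 < dd r kap p / 2 by rewrite divr_gt0// Up.2.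
  have dq : dd r kap p / 2 <= dd r kap q.
    by move: qd; rewrite {1}/dd /r' [dd r kap q]/dd; lra.
  have Uq : U q by split=> //; exact: lt_le_trans dq.
  have nt : - t <= 0 by rewrite oppr_le0.
  have Us := Del_left (ltW kap0) nt Uq.
  have := f0 _ Us; rewrite shiftlN => H; apply: (le_trans H).
  have -> : Re (shiftl et q t).1 = Re q.1 - t.
    by rewrite -shiftlN shift_et /= ReD.
  have ds : dd r kap p / 2 <= dd r kap (shiftl et q t).
    by rewrite -shiftlN; apply: (le_trans dq); apply: dd_shift => //; exact: ltW.
  have iq : Re q.1 <= Re p.1 + 1.
    have := le_lt_trans (nrm_fst (q - p)) q2.
    move=> /(le_lt_trans (cabs_ge_Re _)); rewrite -[(q - p).1]/((q.1 : C) - p.1) ReB.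
    by rewrite ltr_norml => /andP[_]; lra.
  rewrite [leRHS]mulrAC; apply: ler_pM.
  + by rewrite mulr_ge0// expR_ge0.
  + by rewrite invr_ge0 exprn_ge0// ltW// (lt_le_trans dp2).
  + rewrite -mulrA ler_wpM2l// -expRD ler_expR.
    have : a0 * Re q.1 <= a0 * (Re p.1 + 1) by rewrite ler_pM2l.
    by lra.
  have dq0 : 0 < dd r kap (shiftl et q t) := lt_le_trans dp2 ds.
  rewrite lef_pV2 ?posrE ?exprn_gt0//.
  by apply: lerXn2r => //; rewrite nnegrE ltW.
exists v; split=> //.
- move=> a B q a1 fB p Up; have Bp := B_ge0 _ _ _ fB p Up.
  pose D := dd r kap p; have D0 : 0 < D := Up.2.
  pose K := B / D ^+ q; have K0 : 0 <= K by rewrite divr_ge0// exprn_ge0// ltW.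
  have H : cabs (v p) <= K / a * expR (a * Re p.1 + a * 0).
    apply: (v3 p (fun x => K / a * expR (a * Re p.1 + a * x))
      (fun x => K / a * a * expR (a * Re p.1 + a * x)) Up).
    + by move=> x _; exact: is_derive_expaff.
    + by move=> x _; rewrite mulr_ge0 ?expR_ge0// divr_ge0// ltW.
    move=> x x0; have Us := Del_left (ltW kap0) x0 Up.
    apply: (le_trans (fB _ Us)); rewrite divfK ?gt_eqF//.
    have -> : Re (p + rC x *: et).1 = Re p.1 + x by rewrite shift_et /= ReD.
    rewrite -mulrDr /K [leRHS]mulrAC; apply: ler_wpM2l.
      by rewrite mulr_ge0// expR_ge0.
    have ds := dd_shift r p (ltW kap0) x0.
    rewrite lef_pV2 ?posrE ?exprn_gt0//; last exact: Us.2.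
    by apply: lerXn2r => //; rewrite nnegrE ltW//; exact: Us.2.
  apply: (le_trans H); rewrite mulr0 addr0 /K le_eqVlt; apply/orP; left; apply/eqP; ring.
move=> a B q a1 fB p Up; have Bp := B_ge0 _ _ _ fB p Up.
pose A := r - nrm p.2; pose b := kap * expR (sg * Re p.1).
have ddE x : dd r kap (p + rC x *: et) = A - b * expR (sg * x).
  by rewrite shift_et /dd /= ReD /= mulrDr expRD mulrA.
pose K := B / (kap * sg) * expR ((a - sg) * Re p.1).
have ks : 0 < kap * sg by rewrite mulr_gt0.
have K0 : 0 <= K by rewrite mulr_ge0 ?expR_ge0// divr_ge0// ltW.
have H : cabs (v p) <= K * ((A - b * expR (sg * 0)) ^+ q.+1)^-1.
  apply: (v3 p (fun x => K * ((A - b * expR (sg * x)) ^+ q.+1)^-1)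
    (fun x => K * (q.+1%:R * (b * sg * expR (sg * x)) / (A - b * expR (sg * x)) ^+ q.+2)) Up).
  + move=> x x0; have [_ Us] := Del_left (ltW kap0) x0 Up; rewrite ddE in Us.
    exact: (is_deriveZ K (@is_derive_invpow A b sg q x Us)).
  + move=> x x0; have [_ Us] := Del_left (ltW kap0) x0 Up; rewrite ddE in Us.
    by rewrite mulr_ge0// invr_ge0 exprn_ge0// ltW.
  move=> x x0; have Us := Del_left (ltW kap0) x0 Up.
  apply: (le_trans (fB _ Us)); have Us0 := Us.2; rewrite ddE in Us0 *.
  have -> : Re (p + rC x *: et).1 = Re p.1 + x by rewrite shift_et /= ReD.
  set E := (_ ^+ q.+2)^-1; have E0 : 0 <= E by rewrite invr_ge0 exprn_ge0// ltW.
  rewrite [leRHS](mulrA K); apply: ler_wpM2r => //.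
  have -> : K * (q.+1%:R * (b * sg * expR (sg * x))) =
      B * (q.+1%:R * expR (a * Re p.1 + sg * x)).
    have -> : a * Re p.1 + sg * x = (a - sg) * Re p.1 + sg * Re p.1 + sg * x by ring.
    rewrite !expRD /K /b; field.
    by rewrite !gt_eqF.
  apply: ler_wpM2l => //; apply: (@le_trans _ _ (expR (a * Re p.1 + sg * x))).
    rewrite ler_expR mulrDr lerD2l; have : 0 <= a - sg by rewrite subr_ge0.
    move=> /mulr_ge0 X; have := X (- x); rewrite oppr_ge0 => /(_ x0); lra.
  by apply: ler_peMl; rewrite ?expR_ge0// ler1n.
apply: (le_trans H); rewrite mulr0 expR0 mulr1 -/(dd r kap p).
by rewrite lexx.
Qed.

Lemma iterDt_eq_on j (f g : V -> C) p : U p -> (forall q, U q -> f q = g q) ->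
  iter j Dt f p = iter j Dt g p.
Proof.
move=> Up fg; elim: j p Up => [|j IH] p Up; first exact: fg.
exact: (@D_eq_on R _ _ _ U p et oU Up IH).
Qed.

Hypothesis r1 : r <= 1.

Lemma dd_le1 p : 0 < kap -> dd r kap p <= 1.
Proof.
move=> k0; have := nrm_ge0 p.2; have := expR_gt0 (sg * Re p.1) => /(mulr_gt0 k0).
move=> h1 h2; rewrite /dd -addrA -opprD; apply: le_trans r1; rewrite gerBl.
exact/addr_ge0/ltW.
Qed.

(** The derivative of order [i - j] is [f] integrated [j] times, and each integration trades
    [|t| ^ sg] for a power of [dd]. The condition [m%:R * sg <= M] leaves the exponent at least [sg]
    before each of the [m] integrations. *)
Lemma prim_iter m (f : V -> C) (A M : R) i : 1 <= M -> m%:R * sg <= M ->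
  holomorphic_on f U ->
  (forall p, U p -> cabs (f p) <= A * expR (M * Re p.1) / dd r kap p ^+ m.+1) ->
  (i <= m)%N -> exists v : V -> C, [/\ holomorphic_on v U,
    forall p, U p -> iter i Dt v p = f p,
    forall j p, (j < i)%N -> U p -> cabs (iter j Dt v p) <=
      A / M * expR (M * Re p.1) / dd r kap p ^+ m.+1 &
    forall j p, (j <= i)%N -> U p -> cabs (iter (i - j) Dt v p) <=
      A / (kap * sg) ^+ j * expR ((M - j%:R * sg) * Re p.1) / dd r kap p ^+ (m.+1 - j)].
Proof.
move=> M1 mM hf fA; have M0 : 0 < M := lt_le_trans ltr01 M1.
elim: i => [_|i IH im].
  exists f; split=> // j p; rewrite leqn0 => /eqP -> Up.
  by rewrite /= expr0 divr1 mul0r subr0 subn0; exact: fA.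
have [v [v1 v2 v3 v4]] := IH (ltnW im).
(* A crude bound at the full power makes the next primitive exist and gives it the gain [1 / M]. *)
have vM p : U p -> cabs (v p) <= A * expR (M * Re p.1) / dd r kap p ^+ m.+1.
  move=> Up; case: (i) v2 v3 => [|k] v2 v3; first by rewrite -[v p]/(iter 0 Dt v p) v2//; exact: fA.
  have := v3 0 p isT Up; rewrite /= => H; apply: (le_trans H).
  have fp := le_trans (cabs_ge0 _) (fA p Up); have d0 := Up.2.
  have A0 : 0 <= A.
    by move: fp; rewrite pmulr_lge0 ?invr_gt0 ?exprn_gt0// pmulr_lge0 ?expR_gt0.
  have -> : A / M * expR (M * Re p.1) / dd r kap p ^+ m.+1 =
     A * expR (M * Re p.1) / dd r kap p ^+ m.+1 / M by ring.
  by rewrite ler_pdivrMr// ler_peMr.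
have [|w [w1 w2 w3 w4]] := prim_step v1.
  by exists M, A, m.+1.
have wS j p : U p -> iter j.+1 Dt w p = iter j Dt v p.
  by move=> Up; rewrite iterSr; apply: iterDt_eq_on.
exists w; split=> //.
- by move=> p Up; rewrite wS// v2.
- move=> [|j] p ji Up; first exact: w3.
  by rewrite wS//; exact: v3.
move=> j p; rewrite leq_eqVlt => /orP[/eqP ->|ji] Up; last first.
  by rewrite subSn// wS//; exact: v4.
rewrite subnn /=.
have v5 q : U q -> cabs (v q) <= A / (kap * sg) ^+ i * expR ((M - i%:R * sg) * Re q.1) /
    dd r kap q ^+ (m - i.+1).+2.
  move=> Uq; have := v4 i q (leqnn i) Uq; rewrite subnn /=.
  by rewrite subnSK// subSn// ltnW.
have sgi : sg <= M - i%:R * sg.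
  apply: le_trans (_ : m%:R * sg - i%:R * sg <= _); last by rewrite lerB.
  by rewrite -mulrBl -natrB ?(ltnW im)// ler_peMl ?ler1n ?subn_gt0// ltW.
have := w4 _ _ _ sgi v5 p Up.
rewrite -subSn// exprSr -[A / _ / _]mulrA -invfM.
have -> : M - i%:R * sg - sg = M - i.+1%:R * sg by rewrite -natr1; ring.
by [].
Qed.

End Primitive.

End CauchyKovalevskaya.

Lemma nag_le2 (R : realType) q q' k : (q <= q')%N -> nag R q k <= nag R q' k.
Proof.
move=> qq; elim: k => [|k IH] //=; apply: ler_pM => //.
- exact: ltW (nag_gt0 _ _ _).
by apply: ler_weXn2l; rewrite ?ler1n// !ltnS leq_add2r.
Qed.

Lemma cabs_sum_le (R : realType) m (f : 'I_m -> Cplx R) (B : R) :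
  (forall i, cabs (f i) <= B) -> cabs (\sum_i f i) <= m%:R * B.
Proof.
move=> hf; apply: (le_trans (cabs_sum _ _ _)).
apply: (@le_trans _ _ (\sum_(i < m) B)); first by apply: ler_sum => i _.
by rewrite sumr_const card_ord mulr_natl.
Qed.

(** * Inversion of the principal part with full jet bounds *)

Section CKIteration.
Variable R : realType.
Local Notation C := (Cplx R).
Variables m n : nat.
Local Notation V := (RC0 R * 'rV[C]_n)%type.
Local Notation Z := (Zvec R m n).
Local Notation Re := complex.Re.
Variable psi : R -> R.
Hypotheses (psi_ge0 : forall y, 0 <= psi y) (psi_cont : continuous psi).
Variables (hm : (0 < m)%N) (h c r kap M : R).
Hypotheses (c1 : 1 <= c) (r1 : r <= 1) (h0 : 0 < h) (kap0 : 0 < kap) (M1 : 1 <= M).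
(** With this exponent [m] integrations cost exactly [|t| ^ (2 * h)], the factor supplied by the
    Lipschitz bound of the nonlinear part. *)
Let sg : R := 2 * h / m%:R.
Let m0 : (0 : R) < m%:R. Proof. by rewrite ltr0n. Qed.
Let sg0 : 0 < sg. Proof. by rewrite divr_gt0 ?mulr_gt0. Qed.
Let msg : m%:R * sg = 2 * h. Proof. by rewrite mulrC divfK// gt_eqF. Qed.
Hypotheses (kapsg : 1 <= kap * sg) (M2 : 2 * h <= M).
Let U : set V := Del psi sg c r kap.
Let oU : open U. Proof. exact: Del_open. Qed.
Let Re0 p : U p -> Re p.1 <= 0.
Proof.
move=> [U1 _]; have := Om_ltc psi_ge0 (le_trans ler01 c1) U1; have := c1; lra.
Qed.

(* Integration in [t] gains [1 / M] when no power of the distance is needed to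
   absorb [x]-derivatives, and [1 / (kap * sg)], at the price of [|t|^(-2h)],
   when the lost powers must be regained. *)
Lemma ck_integrate (f : V -> C) (A : R) : 0 <= A -> holomorphic_on f U ->
  (forall p, U p -> cabs (f p) <= A * expR (M * Re p.1) / dd sg r kap p ^+ m.+1) ->
  exists v : V -> C, [/\ holomorphic_on v U,
    forall p, U p -> iter m Dt v p = f p,
    forall j p, (j < m)%N -> U p -> cabs (iter j Dt v p) <=
      A / M * expR (M * Re p.1) / dd sg r kap p ^+ m.+1 &
    forall p, U p -> nrm (jetv m v p) <=
      nag R m.+1 m * A / (kap * sg) * expR ((M - 2 * h) * Re p.1) /
        dd sg r kap p ^+ m.+1].
Proof.
move=> A0 hf fA; have c00 : 0 <= c := le_trans ler01 c1.
have [|v [v1 v2 v3 v4]] := @prim_iter R n psi psi_cont sg sg0 c r kap kap0 m f A M m M1 _ hf fA (leqnn m).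
  by rewrite msg.
exists v; split=> // p Up; have d0 : 0 < dd sg r kap p := Up.2.
have d1 : dd sg r kap p <= 1 := dd_le1 _ r1 p kap0.
have ks0 : 0 < kap * sg by rewrite mulr_gt0.
apply: nrm_jetv_le => [|j s js].
  apply: divr_ge0; last by rewrite exprn_ge0// ltW.
  apply: mulr_ge0 (expR_ge0 _); apply: divr_ge0 (ltW ks0).
  exact: mulr_ge0 (ltW (nag_gt0 _ _ _)) A0.
rewrite (iterDt_DX oU _ _ v1 Up).
(* The [t]-derivative of order [j] comes from [i = m - j] integrations and has the power [m.+1 - i]
   of the distance; at most [i] derivatives in [x] then bring it back to at most [m.+1]. *)
pose i := (m - j)%N; have jm := ltn_ord j.
have si : (size s <= i)%N by rewrite leq_subRL// ltnW.
have im : (i <= m)%N := leq_subr _ _.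
have i0 : (0 < i)%N by rewrite subn_gt0.
have jE : (m - i)%N = j by rewrite subKn// ltnW.
pose w (q : V) := A / (kap * sg) ^+ i * expR ((M - i%:R * sg) * Re q.1).
have nag1 : cabs (DX s (iter j Dt v) p) <=
    nag R (m.+1 - i) (size s) * w p / dd sg r kap p ^+ (m.+1 - i + size s).
  apply: (@nagumo R n U (dd sg r kap) w _ _ s oU (holo_iterDt oU j v1)) => // [q k Uq|q Uq].
    split=> [|z hz]; first exact: Uq.2.
    have E2 : (q + z *: ex k).2 = q.2 + z *: delta_mx 0 k by [].
    have E1 : (q + z *: ex k).1 = q.1.
      by rewrite -[LHS]/(q.1 + z *: 0) scaler0 addr0.
    have nz : nrm (z *: delta_mx 0 k : 'rV[C]_n) = cabs z.
      by rewrite nrmZ nrm_delta mulr1.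
    have H := nrmD q.2 (z *: delta_mx 0 k); rewrite nz in H.
    have dz : dd sg r kap q - cabs z <= dd sg r kap (q + z *: ex k).
      by rewrite /dd E1 E2; lra.
    split=> //; last by rewrite /w E1.
    by split; [rewrite E1; exact: Uq.1 | apply: lt_le_trans dz; rewrite subr_gt0].
  by rewrite -jE; exact: v4.
apply: (le_trans nag1); apply: ler_pM.
- apply: mulr_ge0 (ltW (nag_gt0 _ _ _)) _; apply: mulr_ge0 (expR_ge0 _).
  by apply: divr_ge0 => //; exact/exprn_ge0/ltW.
- by rewrite invr_ge0 exprn_ge0// ltW.
- rewrite -[nag R m.+1 m * A / _]mulrA -[leRHS]mulrA; apply: ler_pM.
  + exact: ltW (nag_gt0 _ _ _).
  + by apply: mulr_ge0 (expR_ge0 _); apply: divr_ge0 => //; exact/exprn_ge0/ltW.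
  + apply: (le_trans (nag_le _ _ (leq_trans si im))).
    exact/nag_le2/leq_subr.
  apply: ler_pM.
  + by apply: divr_ge0 => //; exact/exprn_ge0/ltW.
  + exact: expR_ge0.
  + apply: ler_wpM2l => //; rewrite lef_pV2 ?posrE ?exprn_gt0//.
    by rewrite -[leLHS]expr1; apply: ler_weXn2l.
  rewrite ler_expR; have isg : i%:R * sg <= 2 * h.
    by rewrite -msg ler_pM2r// ler_nat.
  have : 0 <= (M - i%:R * sg) - (M - 2 * h) by lra.
  move=> /mulr_ge0 X; have := X (- Re p.1); rewrite oppr_ge0 => /(_ (Re0 Up)); lra.
rewrite lef_pV2 ?posrE ?exprn_gt0//; apply: ler_wiXn2l => //; first exact: ltW.
by rewrite -[X in (_ <= X)%N](subnK (leqW im)) leq_add2l.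
Qed.

End CKIteration.

(** * Convergence of the iteration on shrinking domains *)

Section Limit.
Variable R : realType.
Local Notation C := (Cplx R).
Variables m n : nat.
Local Notation V := (RC0 R * 'rV[C]_n)%type.
Local Notation Z := (Zvec R m n).
Local Notation Re := complex.Re.
Variable psi : R -> R.
Hypotheses (psi_ge0 : forall y, 0 <= psi y) (psi_cont : continuous psi).
Variables (hm : (0 < m)%N) (F : V -> Z -> C) (cf : nat -> 'rV[C]_n -> C) (c0 r0 h : R).
Hypotheses (c01 : 1 <= c0) (r01 : r0 <= 1) (h0 : 0 < h)
  (hF : forall p z, Dom psi c0 r0 p -> nrm z <= expR (4 * h * Re p.1) ->
     differentiable (fun q : V * Z => F q.1 q.2) (p, z))
  (hLip : forall p z z', Dom psi c0 r0 p -> nrm z <= expR (4 * h * Re p.1) ->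
     nrm z' <= expR (4 * h * Re p.1) ->
     cabs (F p z - F p z' - \sum_(j < m) cf j p.2 * zc j (z - z')) <=
     expR (2 * h * Re p.1) * nrm (z - z')).
Variables (c r kap M Kc : R).
Let sg : R := 2 * h / m%:R.
(** Contraction ratio of the residual. It satisfies [q * 2 ^+ P = 1 / 2], so it outweighs the factor
    [(2 ^+ k.+1) ^+ P] lost to the distance at step [k] and leaves a geometric series. *)
Let q : R := (2 ^+ m.+2)^-1.
Let P : nat := m.+1.
Hypotheses (cc : c0 <= c) (rr : r <= r0) (hKc : forall j x, (j < m)%N -> xball r x ->
    cabs (cf j x) <= Kc) (Kc0 : 0 <= Kc)
  (kap1 : 1 <= kap) (kapsg : 1 <= kap * sg) (kapq : nag R P m / (kap * sg) <= q / 2)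
  (M1 : 1 <= M) (Mq : m%:R * Kc / M <= q / 2) (M3 : 6 * h + P%:R * sg <= M).

(** The weights increase from [kap] and stay below [2 * kap], so the shrinking domains keep a common
    part. *)
Let kk k : R := kap * (2 - (2 ^+ k)^-1).
Let m0 : (0 : R) < m%:R. Proof. by rewrite ltr0n. Qed.
Let sg0 : 0 < sg. Proof. by rewrite divr_gt0 ?mulr_gt0. Qed.
Let q0 : 0 < q. Proof. by rewrite invr_gt0 exprn_gt0. Qed.
Let kap0 : 0 < kap. Proof. exact: lt_le_trans ltr01 kap1. Qed.
Let c1 : 1 <= c. Proof. exact: le_trans c01 cc. Qed.
Let r1 : r <= 1. Proof. exact: le_trans rr r01. Qed.

Let DD k : set V := Del psi sg c r (kk k).

Let kk_ge k : kap <= kk k.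
Proof.
apply: ler_peMr (ltW kap0) _; suff : (2 ^+ k)^-1 <= (1 : R) by lra.
by rewrite invf_le1 ?exprn_gt0// exprn_ege1// ler1n.
Qed.

Let kk_le2 k : kk k <= kap * 2.
Proof.
rewrite /kk ler_pM2l// gerBl invr_ge0; exact: exprn_ge0.
Qed.

Let kkS k : kk k.+1 - kk k = kap * (2 ^+ k.+1)^-1.
Proof. by rewrite /kk exprS; field; rewrite expf_neq0. Qed.

Let kk_mono k : kk k <= kk k.+1.
Proof.
rewrite -subr_ge0 kkS; apply: mulr_ge0; first exact: ltW.
by rewrite invr_ge0 exprn_ge0.
Qed.

Let kk0 k : 0 < kk k. Proof. exact: lt_le_trans kap0 (kk_ge k). Qed.

Let DDo k : open (DD k). Proof. exact: Del_open. Qed.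

Let DDS k : DD k.+1 `<=` DD k. Proof. exact/Del_mono. Qed.

Let DD_Dom k : DD k `<=` Dom psi c r.
Proof.
move=> p [h1 h2]; split=> //; rewrite /xball /=.
have : 0 < kk k * expR (sg * Re p.1) by rewrite mulr_gt0// expR_gt0.
by move: h2; rewrite /dd; lra.
Qed.

Let DD_Dom0 k : DD k `<=` Dom psi c0 r0.
Proof. by move=> p /DD_Dom; exact: Dom_sub. Qed.

Let Re0 (p : V) : Dom psi c r p -> Re p.1 <= 0.
Proof. by move=> /(Dom_Re psi_ge0 c1); have := c1; lra. Qed.

(** On the next domain the old distance exceeds the new one by the jump of the weight,
    [kap * (2 ^+ k.+1)^-1 * |t| ^ sg]; this bounds inverse powers of the distance by powers of
    [|t|]. *)
Let ddS k p : DD k.+1 p -> (2 ^+ k.+1)^-1 * expR (sg * Re p.1) <= dd sg r (kk k) p /\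
  dd sg r (kk k.+1) p <= dd sg r (kk k) p.
Proof.
move=> [h1 h2]; have E0 : 0 <= expR (sg * Re p.1) by exact: expR_ge0.
have S := kkS k; split.
  apply: (@le_trans _ _ (kap * (2 ^+ k.+1)^-1 * expR (sg * Re p.1))).
    by rewrite ler_wpM2r// ler_peMl// invr_ge0 exprn_ge0.
  by rewrite -S mulrBl; move: h2; rewrite /dd; lra.
by rewrite /dd lerB// ler_wpM2r.
Qed.

Lemma F_lip p z z' : Dom psi c r p -> nrm z <= expR (4 * h * Re p.1) ->
  nrm z' <= expR (4 * h * Re p.1) ->
  cabs (F p z - F p z') <= (m%:R * Kc + 1) * nrm (z - z').
Proof.
move=> Dp hz hz'; have := hLip (Dom_sub cc rr Dp) hz hz'.
set S := \sum_(j < m) _ => H.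
have hS : cabs S <= m%:R * Kc * nrm (z - z').
  rewrite -mulrA; apply: cabs_sum_le => j; rewrite cabsM.
  apply: ler_pM; rewrite ?cabs_ge0 ?nrm_row_coord//.
  by apply: hKc => //; exact: Dp.2.
have e1 : expR (2 * h * Re p.1) * nrm (z - z') <= nrm (z - z').
  apply: ler_piMl (nrm_ge0 _) _; rewrite -expR0 ler_expR.
  by rewrite mulr_ge0_le0 ?mulr_ge0 ?Re0// ltW.
rewrite -(subrK S (_ - F p z')); apply: (le_trans (cabsD _ _)).
by move: hS H e1; lra.
Qed.

(** The factor [1 - (2 ^+ k.+1)^-1] reserves room in the polydisc of radius [expR (4 * h * Re t)]
    for all later corrections. *)
Definition ckinv k (u : V -> C) := holomorphic_on u (DD k) /\ forall p, DD k p ->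
  nrm (jetv m u p) <= (1 - (2 ^+ k.+1)^-1) * expR (4 * h * Re p.1) /\
  cabs (Res F u p) <= q ^+ k * expR (M * Re p.1) / dd sg r (kk k) p ^+ P.

(** The correction inverts [(t d_t)^m] alone. The new residual then has two parts, each at most
    [q / 2] times the old bound: the nonlinear remainder because [kap] is large, the terms
    [c_j (t d_t)^j] because [M] is large. *)
Lemma ck_step k u : ckinv k u -> exists2 u', ckinv k.+1 u' &
  forall p, DD k.+1 p -> cabs (u' p - u p) <= 1 / 2 ^+ k.+1.
Proof.
move=> [hu hk].
have p2 j : (0 : R) < (2 ^+ j)^-1 by rewrite invr_gt0 exprn_gt0.
have ju4 p : DD k p -> nrm (jetv m u p) <= expR (4 * h * Re p.1).
  move=> Dp; have [H _] := hk p Dp; apply: (le_trans H).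
  by apply: ler_piMl (expR_ge0 _) _; rewrite gerBl ltW.
have hR := Res_holo hF (@DDo k) (@DD_Dom0 k) hu ju4.
have hNR : holomorphic_on (fun p => - Res F u p) (DD k).
  by move=> p Up; apply: differentiableN; exact: hR.
have leNR p : DD k p -> cabs (- Res F u p) <=
    q ^+ k * expR (M * Re p.1) / dd sg r (kk k) p ^+ P.
  by move=> Dp; rewrite cabsN; have [] := hk p Dp.
have kks : kap * sg <= kk k * sg by rewrite ler_pM2r// kk_ge.
have ks1 : 1 <= kk k * sg := le_trans kapsg kks.
have ks0 : 0 < kk k * sg := lt_le_trans ltr01 ks1.
have Psg : 0 <= P%:R * sg by rewrite mulr_ge0// ltW.
have M2 : 2 * h <= M by have := M3; have := h0; lra.
have qk0 : 0 <= q ^+ k by rewrite exprn_ge0// ltW.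
have [v [v1 v2 v3 v4]] := ck_integrate psi_ge0 psi_cont hm c1 r1 h0 (kk0 k)
  M1 ks1 M2 qk0 hNR leNR.
have kq : nag R P m / (kk k * sg) <= q / 2.
  apply: le_trans kapq; apply: ler_wpM2l; first exact/ltW/nag_gt0.
  by rewrite lef_pV2// posrE// mulr_gt0.
have jv p : DD k.+1 p -> nrm (jetv m v p) <= (2 ^+ k.+2)^-1 * expR (4 * h * Re p.1).
  move=> Dp; have [dlow _] := ddS Dp; have Dk := DDS Dp.
  apply: (le_trans (v4 p Dk)).
  set d := dd sg r (kk k) p in dlow *.
  have E0 : 0 < (2 ^+ k.+1)^-1 * expR (sg * Re p.1) by rewrite mulr_gt0// expR_gt0.
  have d0 : 0 < d := lt_le_trans E0 dlow.
  have dP : (d ^+ P)^-1 <= (2 ^+ k.+1) ^+ P * expR (- (P%:R * sg) * Re p.1).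
    apply: (@le_trans _ _ (((2 ^+ k.+1)^-1 * expR (sg * Re p.1)) ^+ P)^-1).
      rewrite lef_pV2 ?posrE ?exprn_gt0//.
      by apply: lerXn2r => //; rewrite nnegrE ltW.
    rewrite exprMn invfM exprVn invrK -expRM_natl -expRN.
    by rewrite le_eqVlt; apply/orP; left; apply/eqP; congr (_ * expR _); ring.
  have -> : nag R P m * q ^+ k / (kk k * sg) = q ^+ k * (nag R P m / (kk k * sg)) by ring.
  apply: (@le_trans _ _ (q ^+ k * (q / 2) * expR ((M - 2 * h) * Re p.1) *
      ((2 ^+ k.+1) ^+ P * expR (- (P%:R * sg) * Re p.1)))).
    apply: ler_pM.
    - apply: mulr_ge0 (expR_ge0 _); apply: mulr_ge0 qk0 _.
      exact: divr_ge0 (ltW (nag_gt0 _ _ _)) (ltW ks0).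
    - by rewrite invr_ge0 exprn_ge0// ltW.
    - by apply: ler_wpM2r; [exact: expR_ge0 | exact: ler_wpM2l].
    - exact: dP.
  have -> : q ^+ k * (q / 2) * expR ((M - 2 * h) * Re p.1) *
      ((2 ^+ k.+1) ^+ P * expR (- (P%:R * sg) * Re p.1)) =
      q ^+ k.+1 * (2 ^+ k.+1) ^+ P / 2 *
      (expR ((M - 2 * h) * Re p.1) * expR (- (P%:R * sg) * Re p.1)).
    rewrite [q ^+ k.+1]exprSr.
    by move: (q ^+ k) q (expR _) (expR _) (_ ^+ P) => *; ring.
  have -> : q ^+ k.+1 * (2 ^+ k.+1) ^+ P / 2 = (2 ^+ k.+2)^-1.
    rewrite -exprM mulnC exprM -exprMn.
    have -> : q * 2 ^+ P = 2^-1 by rewrite /q /P exprS; field; rewrite expf_neq0.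
    by rewrite -exprSr exprVn.
  rewrite -expRD; apply: ler_wpM2l; first exact: ltW.
  (* The exponent left over is [M - 2 * h - P * sg], at least [4 * h] by [M3]. *)
  rewrite ler_expR; have X := Re0 (DD_Dom Dk).
  have : 0 <= (M - 6 * h - P%:R * sg) by have := M3; lra.
  by move=> /mulr_ge0 Y; have := Y (- Re p.1); rewrite oppr_ge0 => /(_ X); lra.
have huS : holomorphic_on u (DD k.+1) := holo_sub (@DDS k) hu.
have hvS : holomorphic_on v (DD k.+1) := holo_sub (@DDS k) v1.
have jD p : DD k.+1 p -> jetv m (fun p => u p + v p) p = jetv m u p + jetv m v p.
  exact: (jetvD m (@DDo k.+1) huS hvS).
have jw p : DD k.+1 p -> nrm (jetv m (fun p => u p + v p) p) <=
    (1 - (2 ^+ k.+2)^-1) * expR (4 * h * Re p.1).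
  move=> Dp; rewrite jD//; apply: (le_trans (nrmD _ _)).
  have [H _] := hk p (DDS Dp); have := jv p Dp.
  move: H; have -> : (2 ^+ k.+1)^-1 = 2 * (2 ^+ k.+2)^-1 :> R.
    by rewrite [in RHS]exprS; field; rewrite expf_neq0.
  set E := expR _; set y := (2 ^+ k.+2)^-1; lra.
exists (fun p => u p + v p).
  split=> [|p Dp]; first exact: holo_add.
  split; first exact: jw.
  have Dk := DDS Dp.
  have jw4 : nrm (jetv m (fun p => u p + v p) p) <= expR (4 * h * Re p.1).
    apply: (le_trans (jw p Dp)).
    by apply: ler_piMl (expR_ge0 _) _; rewrite gerBl ltW.
  have L := hLip (DD_Dom0 Dk) jw4 (ju4 p Dk).
  have jB : jetv m (fun q => u q + v q) p - jetv m u p = jetv m v p.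
    by rewrite jD// addrAC subrr add0r.
  rewrite jB in L.
  have -> : Res F (fun q => u q + v q) p = - (F p (jetv m (fun q => u q + v q) p)
     - F p (jetv m u p) - \sum_(j < m) cf j p.2 * zc j (jetv m v p))
     - \sum_(j < m) cf j p.2 * iter j Dt v p.
    rewrite /Res (iterDt_add (@DDo k.+1) m huS hvS Dp) v2// /Res.
    have -> : \sum_(j < m) cf j p.2 * zc j (jetv m v p) =
        \sum_(i < m) cf i p.2 * iter i Dt v p.
      by apply: eq_bigr => j _; rewrite zc_jetv.
    ring.
  apply: (le_trans (cabsD _ _)); rewrite !cabsN.
  have [dlow dmon] := ddS Dp; have dS0 := Dp.2.
  set d := dd sg r (kk k) p in dlow dmon.
  have d0 : 0 < d := lt_le_trans dS0 dmon.
  pose T := q ^+ k * expR (M * Re p.1) / d ^+ P.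
  have dPi : 0 <= (d ^+ P)^-1 by rewrite invr_ge0 exprn_ge0// ltW.
  have T0 : 0 <= T.
    by rewrite /T; apply: mulr_ge0 dPi; apply: mulr_ge0 qk0 (expR_ge0 _).
  have i1 : cabs (F p (jetv m (fun q => u q + v q) p) - F p (jetv m u p)
      - \sum_(j < m) cf j p.2 * zc j (jetv m v p)) <= q / 2 * T.
    apply: (le_trans L); apply: (@le_trans _ _ (expR (2 * h * Re p.1) *
      (nag R P m * q ^+ k / (kk k * sg) * expR ((M - 2 * h) * Re p.1) / d ^+ P))).
      by apply: ler_wpM2l (expR_ge0 _) _ _ _; exact: v4.
    have -> : expR (2 * h * Re p.1) *
      (nag R P m * q ^+ k / (kk k * sg) * expR ((M - 2 * h) * Re p.1) / d ^+ P) =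
      nag R P m / (kk k * sg) *
      (q ^+ k * (expR (2 * h * Re p.1) * expR ((M - 2 * h) * Re p.1)) / d ^+ P) by ring.
    rewrite -expRD -mulrDl [2 * h + _]addrC subrK; exact: ler_wpM2r.
  have i2 : cabs (\sum_(j < m) cf j p.2 * iter j Dt v p) <= q / 2 * T.
    apply: (@le_trans _ _ (m%:R * (Kc * (T / M)))).
      apply: cabs_sum_le => j; rewrite cabsM; apply: ler_pM; rewrite ?cabs_ge0//.
        by apply: hKc => //; exact: (DD_Dom Dk).2.
      have -> : T / M = q ^+ k / M * expR (M * Re p.1) / d ^+ P by rewrite /T; ring.
      exact: v3.
    have -> : m%:R * (Kc * (T / M)) = m%:R * Kc / M * T by ring.
    exact: ler_wpM2r.
  apply: (le_trans (lerD i1 i2)).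
  have -> : q / 2 * T + q / 2 * T = q ^+ k.+1 * expR (M * Re p.1) / d ^+ P.
    by rewrite /T exprS; field; rewrite expf_neq0// gt_eqF.
  apply: ler_wpM2l; first by apply: mulr_ge0 (expR_ge0 _); rewrite exprn_ge0// ltW.
  rewrite lef_pV2 ?posrE ?exprn_gt0//.
  by apply: lerXn2r; rewrite ?nnegrE// ltW.
move=> p Dp; rewrite [u p + v p]addrC addrK.
have v0 : v p = zc (Ordinal hm) (jetv m v p) by rewrite zc_jetv.
rewrite v0 mul1r; apply: (le_trans (nrm_row_coord _ _)); apply: (le_trans (jv p Dp)).
apply: (@le_trans _ _ (2 ^+ k.+2)^-1).
  apply: ler_piMr; first exact: ltW.
  rewrite -expR0 ler_expR; apply: mulr_ge0_le0; last exact: Re0 (DD_Dom (DDS Dp)).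
  by rewrite mulr_ge0// ltW.
rewrite lef_pV2 ?posrE ?exprn_gt0//; apply: ler_weXn2l; rewrite ?ler1n//.
Qed.

Lemma ck_limit u0 : 0 < r -> ckinv 0 u0 -> exists c' r' u, [/\ c <= c', 0 < r' <= r,
  holomorphic_on u (Dom psi c' r') & forall p, Dom psi c' r' p ->
    nrm (jetv m u p) <= expR (4 * h * Re p.1) /\ Res F u p = 0].
Proof.
move=> r0' inv0.
have st k (u : {u | ckinv k u}) : {u' | ckinv k.+1 u' &
    forall p, DD k.+1 p -> cabs (u' p - sval u p) <= 1 / 2 ^+ k.+1}.
  by apply: cid2; apply: ck_step (svalP u).
pose fix sq k : {u | ckinv k u} := if k is k'.+1 then
  exist _ (s2val (st k' (sq k'))) (s2valP (st k' (sq k'))) else exist _ u0 inv0.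
pose uk k := sval (sq k).
have ukP k : ckinv k (uk k) := svalP (sq k).
have ukS k p : DD k.+1 p -> cabs (uk k.+1 p - uk k p) <= 1 / 2 ^+ k.+1.
  by move=> Dp; exact: (s2valP' (st k (sq k))).
(* Past [c2] even the limiting weight [2 * kap * |t| ^ sg] is at most [r / 2], so the domain of
   radius [r / 2] lies in all the [DD k], with a distance bounded below independently of [k]. *)
have [c2 c21 hc2] := exp_absorb (kap * 2 / (r / 2)) sg0.
pose c' := Num.max c c2; have cc' : c <= c' by rewrite le_max lexx.
have c2c' : c2 <= c' by rewrite le_max lexx orbT.
have r20 : 0 < r / 2 by rewrite divr_gt0.
have r2r : r / 2 <= r by lra.
pose W := Dom (n := n) psi c' (r / 2).
have oW : open W by exact: Dom_open.
have low k p : W p -> DD k p /\ r / 2 - nrm p.2 <= dd sg r (kk k) p.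
  move=> Wp; have [W1 W2] := Wp.
  have H : kk k * expR (sg * Re p.1) <= r / 2.
    apply: (@le_trans _ _ (kap * 2 * expR (sg * Re p.1))).
      by rewrite ler_wpM2r ?expR_ge0.
    have := hc2 (Re p.1); rewrite mulrAC ler_pdivrMr// mul1r; apply.
    have := Dom_Re psi_ge0 (le_trans c21 c2c') Wp; move=> /ltW /le_trans; apply.
    by rewrite lerN2.
  have d1 : r / 2 - nrm p.2 <= dd sg r (kk k) p by rewrite /dd; lra.
  split=> //; split; first exact: Om_mono cc' _ W1.
  by apply: lt_le_trans d1; rewrite subr_gt0.
have WD k : W `<=` DD k by move=> p /(low k)[].
have WDom : W `<=` Dom psi c r := Dom_sub cc' r2r.
have huk k : holomorphic_on (uk k) W := holo_sub (@WD k) (ukP k).1.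
have ukW k p : W p -> cabs (uk k.+1 p - uk k p) <= 1 / 2 ^+ k.+1.
  by move=> /(WD k.+1); exact: ukS.
have [u cv] := geo_luc ler01 ukW oW.
have hu := weierstrass oW huk cv.
exists c', (r / 2), u; split=> //; first by rewrite r20.
move=> p Wp.
have jk4 k : nrm (jetv m (uk k) p) <= expR (4 * h * Re p.1).
  have [H _] := (ukP k).2 p (WD k p Wp); apply: (le_trans H).
  apply: ler_piMl (expR_ge0 _) _; rewrite gerBl invr_ge0; exact: exprn_ge0.
have ju4 : nrm (jetv m u p) <= expR (4 * h * Re p.1).
  apply/ler_addgt0Pr => e e0; have [N hN] := jetv_cvg m oW huk cv Wp e0.
  rewrite -[jetv m u p](subKr (jetv m (uk N) p)).
  apply: (le_trans (nrmD _ _)); rewrite nrmN; apply: lerD (jk4 N) (hN N (leqnn N)).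
split=> //; apply: cabs_eq0; apply/eqP; rewrite eq_le cabs_ge0 andbT.
apply/ler_addgt0Pr => e e0; rewrite add0r.
pose L := m%:R * Kc + 1; have L0 : 0 < L by rewrite ltr_wpDl// mulr_ge0.
have e30 : 0 < e / 3 by rewrite divr_gt0.
have eL0 : 0 < e / 3 / L by rewrite divr_gt0.
pose d := r / 2 - nrm p.2; have d0 : 0 < d by rewrite subr_gt0 Wp.2.
have dP0 : 0 <= (d ^+ P)^-1 by rewrite invr_ge0 exprn_ge0// ltW.
have [N1 h1] := luc_pt (luc_iterDt oW m huk cv) Wp e30.
have [N2 h2] := jetv_cvg m oW huk cv Wp eL0.
have [N3 h3] := half_small dP0 e30.
pose k := maxn N1 (maxn N2 N3).
have k1 : (N1 <= k)%N := leq_maxl _ _.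
have k2 : (N2 <= k)%N by rewrite /k maxnCA leq_maxl.
have k3 : (N3 <= k)%N by rewrite /k maxnA leq_maxr.
have i1 := h1 k k1; have i2 := h2 k k2; have i3 := h3 k k3.
have [Dk dk] := low k p Wp; have [_ i4] := (ukP k).2 p Dk.
have i5 : cabs (Res F (uk k) p) <= e / 3.
  apply: (le_trans i4); apply: le_trans (ltW i3).
  rewrite mulrC; apply: ler_pM => //.
  - by rewrite invr_ge0 exprn_ge0// ltW// (lt_le_trans d0).
  - by apply: mulr_ge0 (expR_ge0 _); rewrite exprn_ge0// ltW.
  - have dd0 : 0 < dd sg r (kk k) p := lt_le_trans d0 dk.
    rewrite lef_pV2 ?posrE ?exprn_gt0//.
    by apply: lerXn2r; rewrite ?nnegrE// ltW.
  apply: (@le_trans _ _ (q ^+ k)).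
    apply: ler_piMr; first by rewrite exprn_ge0// ltW.
    rewrite -expR0 ler_expR; apply: mulr_ge0_le0; last exact: Re0 (WDom _ Wp).
    exact: le_trans ler01 M1.
  have qn : q \is Num.nneg by rewrite nnegrE ltW.
  rewrite -exprVn; apply: lerXn2r => //; first by rewrite nnegrE invr_ge0.
  rewrite lef_pV2 ?posrE ?exprn_gt0//.
  by rewrite -[leLHS]expr1; apply: ler_weXn2l; rewrite ?ler1n.
have i6 : cabs (F p (jetv m (uk k) p) - F p (jetv m u p)) <= e / 3.
  apply: (le_trans (F_lip (WDom _ Wp) (jk4 k) ju4)).
  by rewrite mulrC -ler_pdivlMr.
have -> : Res F u p = Res F (uk k) p + (- (iter m Dt (uk k) p - iter m Dt u p)
    + (F p (jetv m (uk k) p) - F p (jetv m u p))) by rewrite /Res; ring.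
apply: (le_trans (cabsD _ _)).
have := cabsD (- (iter m Dt (uk k) p - iter m Dt u p))
  (F p (jetv m (uk k) p) - F p (jetv m u p)).
rewrite cabsN; move: i1 i5 i6; rewrite /=; lra.
Qed.

End Limit.

(** * Choice of the parameters of the iteration *)

Section Solution.
Variable R : realType.
Local Notation C := (Cplx R).
Variables m n : nat.
Local Notation V := (RC0 R * 'rV[C]_n)%type.
Local Notation Z := (Zvec R m n).
Local Notation Re := complex.Re.
Variable psi : R -> R.
Hypotheses (psi_ge0 : forall y, 0 <= psi y) (psi0 : psi 0 = 0)
  (psi_cvx : forall x y s : R, 0 <= s <= 1 ->
     psi ((1 - s) * x + s * y) <= (1 - s) * psi x + s * psi y)
  (psi_cont : continuous psi).
Variables (hm : (0 < m)%N) (F : V -> Z -> C) (cf : nat -> 'rV[C]_n -> C) (c0 r0 h : R).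
Hypotheses (c01 : 1 <= c0) (r00 : 0 < r0) (r01 : r0 <= 1) (h0 : 0 < h)
  (hF : forall p z, Dom psi c0 r0 p -> nrm z <= expR (4 * h * Re p.1) ->
     differentiable (fun q : V * Z => F q.1 q.2) (p, z))
  (hF0 : forall p, Dom psi c0 r0 p -> cabs (F p 0) <= expR (7 * h * Re p.1))
  (hLip : forall p z z', Dom psi c0 r0 p -> nrm z <= expR (4 * h * Re p.1) ->
     nrm z' <= expR (4 * h * Re p.1) ->
     cabs (F p z - F p z' - \sum_(j < m) cf j p.2 * zc j (z - z')) <=
     expR (2 * h * Re p.1) * nrm (z - z'))
  (hcf : forall j, (j < m)%N -> holomorphic_on (cf j) (xball r0)).

Lemma solution : exists c r u, [/\ c0 <= c, 0 < r <= r0,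
  holomorphic_on u (Dom psi c r) & forall p, Dom psi c r p ->
    nrm (jetv m u p) <= expR (4 * h * Re p.1) /\ Res F u p = 0].
Proof.
have [r1 /andP[r10 r1r] hr1] := cf_close r00 hcf ltr01 r00 (lexx r0).
pose Kc := 1 + \sum_(j < m) cabs (cf j 0).
have Kc0 : 0 <= Kc by rewrite addr_ge0// sumr_ge0// => j _; exact: cabs_ge0.
have hKc j x : (j < m)%N -> xball r1 x -> cabs (cf j x) <= Kc.
  move=> jm xr; have := hr1 j x jm xr; have := cabsD (cf j x - cf j 0) (cf j 0).
  rewrite subrK; have : cabs (cf j 0) <= \sum_(j < m) cabs (cf j 0).
    rewrite (bigD1 (Ordinal jm))//= lerDl sumr_ge0// => i _; exact: cabs_ge0.
  rewrite /Kc; lra.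
have m0 : (0 : R) < m%:R by rewrite ltr0n.
pose sg : R := 2 * h / m%:R; have sg0 : 0 < sg by rewrite divr_gt0 ?mulr_gt0.
pose q : R := (2 ^+ m.+2)^-1; have q0 : 0 < q by rewrite invr_gt0 exprn_gt0.
have q20 : 0 < q / 2 by rewrite divr_gt0.
pose N0 := nag R m.+1 m; have N00 : 0 < N0 := nag_gt0 _ _ _.
(* Makes [kap * sg] at least [1 + N0 / (q / 2)], which covers both [kapsg] and [kapq]. *)
pose kap := 1 + (1 + N0 / (q / 2)) / sg.
have Nq : 0 < N0 / (q / 2) by rewrite divr_gt0.
have kap1 : 1 <= kap by rewrite lerDl divr_ge0 ?addr_ge0// ltW.
have ks : 1 + N0 / (q / 2) <= kap * sg.
  by rewrite -ler_pdivrMr// lerDr.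
have kapsg : 1 <= kap * sg by apply: le_trans ks; rewrite lerDl ltW.
have kapq : N0 / (kap * sg) <= q / 2.
  rewrite ler_pdivrMr ?(lt_le_trans ltr01)// mulrC -ler_pdivrMr//.
  by apply: le_trans ks; rewrite lerDr.
(* A sum of the three nonnegative lower bounds required by [M1], [Mq] and [M3]. *)
pose M := 1 + (m%:R * Kc / (q / 2) + (6 * h + m.+1%:R * sg)).
have t1 : 0 <= m%:R * Kc / (q / 2).
  by apply: divr_ge0 (ltW q20); exact: mulr_ge0.
have t2 : 0 <= 6 * h + m.+1%:R * sg by rewrite addr_ge0// mulr_ge0// ltW.
have M1 : 1 <= M by rewrite /M; lra.
have M3 : 6 * h + m.+1%:R * sg <= M by rewrite /M; lra.
have Mq : m%:R * Kc / M <= q / 2.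
  rewrite ler_pdivrMr ?(lt_le_trans ltr01)// [leRHS]mulrC -ler_pdivrMr//.
  by rewrite /M; lra.
(* The extra power [|t|] beyond [M] absorbs the constant of the approximate solution. *)
have [N hN] : exists N : nat, M + 1 <= 7 * h + N%:R * h.
  exists (Num.bound ((M + 1) / h)).
  have := archi_boundP (_ : 0 <= (M + 1) / h); rewrite divr_ge0 ?(ltW h0)//; last lra.
  move=> /(_ isT); rewrite ltr_pdivrMr// => H; have := h0; lra.
have [c [r [u [cc /andP[rp rr] hu [A A0 hA]]]]] :=
  approx_exists psi_ge0 psi0 psi_cvx psi_cont hm r00 r01 h0 hF hF0 hLip hcf N.
have h2 : 0 < 2 * h by rewrite mulr_gt0.
(* The factor 2 because the invariant at [k = 0] allows only half of [expR (4 * h * Re t)]. *)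
have [c2 c21 hc2] := exp_absorb (2 * A) h2.
have [c3 c31 hc3] := exp_absorb A ltr01.
pose c' := Num.max c (Num.max c2 c3).
have cc' : c <= c' by rewrite le_max lexx.
have c2c' : c2 <= c' by rewrite !le_max lexx orbT.
have c3c' : c3 <= c' by rewrite !le_max lexx !orbT.
pose r' := Num.min r r1.
have r'0 : 0 < r' by rewrite lt_min rp.
have r'r : r' <= r by rewrite ge_min lexx.
have r'1 : r' <= r1 by rewrite ge_min lexx orbT.
have r'r0 : r' <= r0 := le_trans r'r rr.
have c0c' : c0 <= c' := le_trans cc cc'.
have hKc' j x : (j < m)%N -> xball r' x -> cabs (cf j x) <= Kc.
  by move=> jm xr; apply: hKc => //; exact: lt_le_trans xr r'1.
pose ck := @ck_limit R m n psi psi_ge0 psi_cont hm F cf c0 r0 h c01 r01 h0 hF hLip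
  c' r' kap M Kc c0c' r'r0 hKc' Kc0 kap1 kapsg kapq M1 Mq M3 u r'0.
have sD : Del psi sg c' r' (kap * (2 - (2 ^+ 0)^-1)) `<=` (Dom psi c' r' : set V).
  move=> p [p1 p2]; split=> //; rewrite /xball /=.
  have E : 0 < kap * (2 - (2 ^+ 0)^-1) * expR (sg * Re p.1).
    rewrite mulr_gt0 ?expR_gt0// expr0 invr1 mulr_gt0 ?(lt_le_trans ltr01)//.
    by lra.
  by move: p2; rewrite /dd; lra.
have [|c4 [r4 [w [w1 /andP[w20 w2] w3 w4]]]] := ck; last first.
  exists c4, r4, w; split=> //; first exact: le_trans c0c' w1.
  by rewrite w20 (le_trans w2).
split=> [p /sD Dp|p Up]; first exact: hu (Dom_sub cc' r'r Dp).
have Dp := sD p Up; have [ju Ru] := hA p (Dom_sub cc' r'r Dp).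
have ReL := Dom_Re psi_ge0 (le_trans c01 c0c') Dp.
have Re2 : Re p.1 <= - c2 by apply: ltW; apply: (lt_le_trans ReL); rewrite lerN2.
have Re3 : Re p.1 <= - c3 by apply: ltW; apply: (lt_le_trans ReL); rewrite lerN2.
have Re0 : Re p.1 <= 0 by move: Re2 c21; lra.
split.
  apply: (le_trans ju); have -> : 6 * h * Re p.1 = 2 * h * Re p.1 + 4 * h * Re p.1 by ring.
  rewrite expRD mulrA ler_wpM2r ?expR_ge0//.
  have := hc2 _ Re2; rewrite -mulrA expr1; set X := A * _ => H.
  have -> : 1 - 2^-1 = 2^-1 :> R by field.
  by rewrite -ler_pdivlMl ?invr_gt0// in H *; move: H; rewrite ?invrK; lra.
have d0 : 0 < dd sg r' (kap * (2 - (2 ^+ 0)^-1)) p := Up.2.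
apply: (le_trans Ru); apply: (@le_trans _ _ (expR (M * Re p.1))).
  apply: (@le_trans _ _ (A * expR ((M + 1) * Re p.1))).
    apply: ler_wpM2l => //; rewrite ler_expR.
    have : 0 <= 7 * h + N%:R * h - (M + 1) by rewrite subr_ge0.
    by move=> /mulr_ge0 X; have := X (- Re p.1); rewrite oppr_ge0 => /(_ Re0); lra.
  rewrite mulrDl addrC expRD mulrA; apply: ler_piMl (expR_ge0 _) _.
  exact: hc3.
rewrite expr0 mul1r; apply: ler_peMr (expR_ge0 _) _.
rewrite invf_ge1 ?exprn_gt0//; apply: exprn_ile1; first exact: ltW.
apply: dd_le1; first exact: le_trans r'r0 r01.
by rewrite expr0 invr1; have := kap1; lra.
Qed.

End Solution.

(** * A convex profile dominating a given sequence *)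

Section LocallyFiniteSum.
Variables (R : realType) (a : nat -> R).
Hypothesis a_ge0 : forall k, 0 <= a k.

Definition hinge k (y : R) : R := a k * Num.max 0 (`|y| - k%:R).

(* Convex and continuous, and at least [a k] for [|y| >= k + 1]: it puts a convex
   domain inside the union of the regions where bounds that depend on the
   sector are available. *)
Definition hinges y : R := \sum_(k < Num.bound `|y|) hinge k y.

Lemma hinge_ge0 k y : 0 <= hinge k y.
Proof. by rewrite mulr_ge0// le_max lexx. Qed.

Lemma hinges_ge0 y : 0 <= hinges y.
Proof. by apply: sumr_ge0 => k _; exact: hinge_ge0. Qed.

Lemma hinges0 : hinges 0 = 0.
Proof.
rewrite /hinges big1// => -[k _] _ /=; rewrite /hinge normr0 sub0r.
by rewrite max_l ?mulr0// oppr_le0.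
Qed.

(** Terms of index at least [|y|] vanish, so values at several points can be compared term by term
    over a common length. *)
Lemma hingesE N y : `|y| <= N%:R -> hinges y = \sum_(k < N) hinge k y.
Proof.
have aux N1 d : `|y| <= N1%:R -> \sum_(k < d + N1) hinge k y = \sum_(k < N1) hinge k y.
  move=> yN; elim: d => [//|d IH]; rewrite addSn big_ord_recr /= IH.
  rewrite [hinge _ _](_ : _ = 0) ?addr0// /hinge max_l ?mulr0// subr_le0.
  by apply: (le_trans yN); rewrite ler_nat leq_addl.
move=> yN; have yb : `|y| <= (Num.bound `|y|)%:R.
  by apply/ltW/archi_boundP.
by rewrite /hinges -(aux _ N yb) addnC (aux _ _ yN).
Qed.

Lemma hinges_ge k y : k.+1%:R <= `|y| -> a k <= hinges y.
Proof.
move=> ky; have yb : `|y| < (Num.bound `|y|)%:R by exact: archi_boundP.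
have kb : (k < Num.bound `|y|)%N.
  by rewrite -(ltr_nat R) (le_lt_trans _ yb)// (le_trans _ ky)// ler_nat.
rewrite /hinges (bigD1 (Ordinal kb))//=; apply: (@le_trans _ _ (hinge k y)).
  by apply: ler_peMr => //; rewrite le_max lerBrDl natr1 ky orbT.
by rewrite lerDl sumr_ge0// => i _; exact: hinge_ge0.
Qed.

Lemma hinges_cvx (x y s : R) : 0 <= s <= 1 ->
  hinges ((1 - s) * x + s * y) <= (1 - s) * hinges x + s * hinges y.
Proof.
move=> /andP[s0 s1]; set z := _ * x + _.
have s1' : 0 <= 1 - s by rewrite subr_ge0.
have zle : `|z| <= (1 - s) * `|x| + s * `|y|.
  by apply: (le_trans (ler_normD _ _)); rewrite !normrM (ger0_norm s0) (ger0_norm s1').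
pose N := (Num.bound `|x| + Num.bound `|y| + Num.bound `|z|)%N.
have [xN yN zN] : [/\ `|x| <= N%:R, `|y| <= N%:R & `|z| <= N%:R].
  have B (u : R) : `|u| <= (Num.bound `|u|)%:R by apply/ltW/archi_boundP.
  split; [apply: le_trans (B x) _|apply: le_trans (B y) _|apply: le_trans (B z) _].
  - by rewrite ler_nat /N -addnA leq_addr.
  - by rewrite ler_nat /N addnAC leq_addl.
  - by rewrite ler_nat /N leq_addl.
rewrite (hingesE xN) (hingesE yN) (hingesE zN) !mulr_sumr -big_split /=.
apply: ler_sum => k _; rewrite /hinge.
rewrite [leRHS](_ : _ = a k * ((1 - s) * Num.max 0 (`|x| - k%:R) + s * Num.max 0 (`|y| - k%:R))); last by ring.
apply: ler_wpM2l => //; rewrite ge_max; apply/andP; split.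
  by apply: addr_ge0; apply: mulr_ge0; rewrite // le_max lexx.
have hx : `|x| - k%:R <= Num.max 0 (`|x| - k%:R) by rewrite le_max lexx orbT.
have hy : `|y| - k%:R <= Num.max 0 (`|y| - k%:R) by rewrite le_max lexx orbT.
have := ler_wpM2l s1' hx; have := ler_wpM2l s0 hy; move: zle; lra.
Qed.

Lemma hinges_cont : continuous hinges.
Proof.
move=> y; apply/cvgrPdist_lt => e e0.
pose N := (Num.bound (`|y| + 1)); have yN : `|y| + 1 < N%:R.
  by apply: archi_boundP; rewrite addr_ge0.
pose A := 1 + \sum_(k < N) a k; have A0 : 0 < A.
  by rewrite ltr_pwDl// sumr_ge0.
have eA : 0 < e / A by rewrite divr_gt0.
apply/nbhs_ballP; exists (Num.min 1 (e / A)); first by rewrite /= lt_min ltr01.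
move=> z; rewrite /ball /= lt_min => /andP[z1 z2].
have zN : `|z| <= N%:R.
  have := ler_normD (z - y) y; rewrite subrK distrC; move: z1 yN; lra.
have yN' : `|y| <= N%:R by move: yN; lra.
rewrite (hingesE zN) (hingesE yN') -sumrB.
apply: (@le_lt_trans _ _ (A * `|y - z|)); last by rewrite mulrC -ltr_pdivlMr.
apply: (le_trans (ler_norm_sum _ _ _)); rewrite /A mulrDl mul1r mulr_suml.
apply: (@le_trans _ _ (\sum_(i < N) a i * `|y - z|)); last by rewrite lerDr.
apply: ler_sum => k _; rewrite /hinge -mulrBr normrM ger0_norm//; apply: ler_wpM2l => //.
have h1 : `| `|y| - `|z| | <= `|y - z| by exact: ler_dist_dist.
move: h1; rewrite !ler_norml => /andP[h1 h2]; apply/andP.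
have [u1|u1] := lerP (`|y| - k%:R) 0; have [u2|u2] := lerP (`|z| - k%:R) 0;
  by have := normr_ge0 (y - z); split; lra.
Qed.

(** [k] is the integer part of [|Im t|]. For [k = 0] the constant [c0] already exceeds [H 0]; for a
    successor, the hinge of the preceding index has reached its full height. *)
Lemma Om_hinges (H : nat -> R) (c0 : R) t : 1 <= c0 -> H 0 <= c0 ->
  (forall k, H k.+1 <= a k) -> Om hinges c0 t ->
  exists2 k : nat, `|complex.Im t| < k.+1%:R & complex.Re t < - H k.
Proof.
move=> c01 Hc Ha Ot; exists (Num.truncn `|complex.Im t|).
  by have /andP[] := Num.Theory.truncn_itv (normr_ge0 (complex.Im t)).
have /andP[k1 _] := Num.Theory.truncn_itv (normr_ge0 (complex.Im t)).
have c0_ge0 : 0 <= c0 := le_trans ler01 c01.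
have := Om_ltc hinges_ge0 c0_ge0 Ot.
case: (Num.truncn _) k1 => [_|k k1] h; first by apply: (lt_le_trans h); rewrite lerN2.
have := Ot; rewrite /Om /= => h2; apply: (lt_le_trans h2); rewrite lerN2.
apply: (le_trans (Ha k)); apply: (le_trans (hinges_ge k1)).
by rewrite lerDr mulr_ge0// addr_ge0.
Qed.

End LocallyFiniteSum.

(** * Extracting common bounds on a sector *)

Section SectorBounds.
Variable R : realType.
Local Notation C := (Cplx R).

Lemma sup_on_ubound (T : Type) (A : set T) (f : T -> C) (M : R) x :
  (sup_on A f <= M%:E)%E -> A x -> cabs (f x) <= M.
Proof.
move=> h Ax; rewrite -lee_fin; apply: le_trans h; apply: ereal_sup_ubound.
by exists x.
Qed.

Lemma pos_continuous_min (eps : R -> R) (th : R) : pos_continuous eps -> 0 <= th ->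
  exists2 d : R, 0 < d & forall y, `|y| <= th -> d <= eps y.
Proof.
move=> [ce e0] th0; have le : - th <= th by rewrite (le_trans _ th0)// oppr_le0.
have [x _ hx] := EVT_min le (continuous_subspaceT ce).
by exists (eps x) => // y; rewrite ler_norml => hy; apply: hx; rewrite in_itv.
Qed.

(** Monotonicity in the constant allows the maximum of the constants and the minimum of the radii
    over a finite index set. *)
Lemma common_bigO (I : finType) (S : set (RC0 R)) (Q : I -> R -> RC0 R -> Prop) :
  (forall i K K' t, K <= K' -> Q i K t -> Q i K' t) ->
  (forall i, exists K d : R, 0 < d /\ forall t, S t -> rc_abs t < d -> Q i K t) ->
  exists K d : R, 0 < d /\ forall t, S t -> rc_abs t < d -> forall i, Q i K t.
Proof.
move=> Qm hQ.
suff [K [d [d0 h]]] : exists K d : R, 0 < d /\ forall t, S t -> rc_abs t < d ->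
    forall i, i \in enum I -> Q i K t.
  by exists K, d; split=> // t St td i; apply: h => //; rewrite mem_enum.
elim: (enum I) => [|j s [K [d [d0 h]]]]; first by exists 0, 1.
have [K' [d' [d'0 h']]] := hQ j.
exists (Num.max K K'), (Num.min d d'); split; first by rewrite lt_min d0.
move=> t St; rewrite lt_min => /andP[td td'] i; rewrite inE => /orP[/eqP ->|hi].
  by apply: Qm (h' t St td'); rewrite le_max lexx orbT.
by apply: Qm (h t St td i hi); rewrite le_max lexx.
Qed.

End SectorBounds.

(** * Lipschitz bounds from partial derivatives *)

Section RowCalculus.
Variable R : realType.
Local Notation C := (Cplx R).
Variable N : nat.
Implicit Types (g : 'rV[C]_N -> C) (z w : 'rV[C]_N).

Lemma D_row g z w : differentiable g z ->
  'D_w g z = \sum_i w 0 i * 'D_(delta_mx 0 i) g z.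
Proof.
move=> dg; rewrite {1}(row_sum_delta w) deriveE// linear_sum.
by apply: eq_bigr => i _; rewrite linearZ deriveE.
Qed.

Lemma linform_diff (b : 'I_N -> C) z :
  differentiable (fun y : 'rV[C]_N => \sum_i b i * y 0 i) z /\
  forall w, 'D_w (fun y : 'rV[C]_N => \sum_i b i * y 0 i) z = \sum_i b i * w 0 i.
Proof.
have lin a (v w : 'rV[C]_N) : \sum_i b i * (a *: v + w) 0 i =
    a *: (\sum_i b i * v 0 i : C) + \sum_i b i * w 0 i.
  rewrite (_ : a *: _ = \sum_i a * (b i * v 0 i)); last exact: mulr_sumr.
  by rewrite -big_split; apply: eq_bigr => i _; rewrite !mxE /=; ring.
apply: (@diff_intro R _ _ _ z (fun w => \sum_i b i * w 0 i) (\sum_i cabs (b i))).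
- exact: lin.
- move=> v; rewrite nrmC mulr_suml; apply: (le_trans (cabs_sum _ _ _)).
  apply: ler_sum => i _; rewrite cabsM; apply: ler_wpM2l; first exact: cabs_ge0.
  exact: nrm_row_coord.
move=> e e0; exists 1 => // v _; have := lin 1 z v; rewrite !scale1r => ->.
have alg (x y : C) : x + y - x - y = 0 by ring.
by rewrite alg nrm0 mulr_ge0 ?nrm_ge0// ltW.
Qed.

(** Subtracting the linear form [b] leaves small partial derivatives. It serves twice: with [b = 0]
    for the first derivatives of [F] in [Z], then with the limiting coefficients for [F] itself. *)
Lemma lip_row g (b : 'I_N -> C) (rho B : R) z z' : 0 <= B ->
  (forall y, nrm y <= rho -> differentiable g y /\
     forall i, cabs ('D_(delta_mx 0 i) g y - b i) <= B) ->
  nrm z <= rho -> nrm z' <= rho ->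
  cabs (g z - g z' - \sum_i b i * (z - z') 0 i) <= N%:R * B * nrm (z - z').
Proof.
move=> B0 hg hz hz'; set l := fun y : 'rV[C]_N => \sum_i b i * y 0 i.
have seg (x : R) : 0 <= x <= 1 -> nrm (z' + rC x *: (z - z')) <= rho.
  move=> /andP[x0 x1]; have x1' : 0 <= 1 - x by rewrite subr_ge0.
  have -> : z' + rC x *: (z - z') = rC (1 - x) *: z' + rC x *: z.
    by rewrite rCB rC1 scalerBl scale1r scalerBr addrA addrAC.
  apply: (le_trans (nrmD _ _)); rewrite !nrmZ !cabs_rC !ger0_norm//.
  have := ler_wpM2l x0 hz; have := ler_wpM2l x1' hz'; lra.
have lE : \sum_i b i * (z - z') 0 i = l z - l z'.
  by rewrite /l -sumrB; apply: eq_bigr => i _; rewrite !mxE mulrBr.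
have -> : g z - g z' - \sum_i b i * (z - z') 0 i =
    (g (z' + (z - z')) - l (z' + (z - z'))) - (g z' - l z').
  by rewrite lE [z' + _]addrC subrK; ring.
apply: (@lip_line R _ (fun y => g y - l y) z' (z - z')) => x /seg hx.
  by apply: differentiableB; [exact: (hg _ hx).1 | exact: (linform_diff b _).1].
set y := z' + _ in hx *; have [dg hD] := hg y hx; have [dl Dl] := linform_diff b y.
rewrite (D_sub _ dg dl) Dl D_row// -sumrB.
rewrite -mulrA; apply: cabs_sum_le => i.
rewrite [b i * _]mulrC -mulrBr cabsM mulrC.
by apply: ler_pM; rewrite ?cabs_ge0 ?nrm_row_coord.
Qed.

End RowCalculus.

(** * From the assumptions on sectors to uniform bounds *)

Section Reduction.
Variables (R : realType) (m n : nat).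
Local Notation C := (Cplx R).
Local Notation V := (RC0 R * 'rV[C]_n)%type.
Local Notation Z := (Zvec R m n).
Local Notation Re := complex.Re.
Local Notation Im := complex.Im.
Variables (F : RC0 R -> 'rV[C]_n -> Z -> C) (eps : R -> R) (R0 L : R).
Hypotheses (heps : pos_continuous eps) (hL : 0 < L)
  (hF : holomorphic_on
          (fun p : RC0 R * 'rV[C]_n * Z => F p.1.1 p.1.2 p.2)
          (pinched eps `*` polydisc R0 `*` polydisc L)).
Variable h : R.
Hypothesis h0 : 0 < h.
Variable c : 'I_m -> 'rV[C]_n -> C.
Hypothesis (hC2 : forall theta : R, 0 < theta -> forall k l : Idx m n,
    [/\ bigO_sector theta
          (fun t => sup_on (polydisc R0) (fun x => F t x 0))
          (fun t => rc_abs t `^ (8 * h)),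
        idx_deg k = 0%N ->
          bigO_sector theta
            (fun t => sup_on (polydisc R0)
               (fun x => dZ k (F t x) 0 - c (idx_j k) x))
            (fun t => rc_abs t `^ (8 * h)),
        (0 < idx_deg k)%N ->
          bigO_sector theta
            (fun t => sup_on (polydisc R0) (fun x => dZ k (F t x) 0))
            (fun t => rc_abs t `^ (8 * h))
      & bigO_sector theta
          (fun t => sup_on (polydisc R0 `*` polydisc L)
             (fun p => dZ k (dZ l (F t p.1)) p.2))
          (fun=> 1)]).

(** The limit of the derivative of [F] in [Z_k] at [Z = 0] as [t -> 0]; it merges the cases
    [|alpha| = 0] and [|alpha| > 0] of the assumptions. *)
Definition lincoef (k : Idx m n) (x : 'rV[C]_n) : C :=
  if idx_deg k == 0%N then c (idx_j k) x else 0.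

Definition bounds_at (A B : R) (t : RC0 R) (k l : Idx m n) :=
  [/\ forall x, polydisc R0 x -> cabs (F t x 0) <= A,
      forall x, polydisc R0 x -> cabs (dZ k (F t x) 0 - lincoef k x) <= A
    & forall x z, polydisc R0 x -> polydisc L z -> cabs (dZ k (dZ l (F t x)) z) <= B].

(** No constants appear: each bound has given up a factor [|t| ^ h], so the condition has the same
    form on all sectors. *)
Definition good (t : RC0 R) := pinched eps t /\
  forall k l, bounds_at (expR (7 * h * Re t)) (expR (- h * Re t)) t k l.

Lemma bounds_mono A A' B B' t k l : A <= A' -> B <= B' ->
  bounds_at A B t k l -> bounds_at A' B' t k l.
Proof.
move=> AA BB [h1 h2 h3]; split=> *;
  [exact: le_trans (h1 _ _) AA | exact: le_trans (h2 _ _) AA | exact: le_trans (h3 _ _ _ _) BB].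
Qed.

Lemma bounds_sector (theta : R) k l : 0 < theta -> exists K d : R, 0 < d /\
  forall t, sector theta t -> rc_abs t < d ->
    bounds_at (K * expR (8 * h * Re t)) K t k l.
Proof.
move=> th0; have [[K1 [d1 [d10 h1]]] h2 h3 [K4 [d4 [d40 h4]]]] := hC2 th0 k l.
have [K2 [d2 [d20 {h3}h2]]] : bigO_sector theta
    (fun t => sup_on (polydisc R0) (fun x => dZ k (F t x) 0 - lincoef k x))
    (fun t => rc_abs t `^ (8 * h)).
  rewrite /lincoef; case: eqP => [/h2 //|/eqP]; rewrite -lt0n => /h3.
  rewrite (_ : (fun t => sup_on (polydisc R0) (fun x => dZ k (F t x) 0 - 0)) =
    fun t => sup_on (polydisc R0) (fun x => dZ k (F t x) 0))//.
  by apply/funext => t; congr sup_on; apply/funext => x; rewrite subr0.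
have E t : rc_abs t `^ (8 * h) = expR (8 * h * Re t).
  by rewrite /rc_abs -expRM mulrC.
exists (Num.max K1 (Num.max K2 K4)), (Num.min d1 (Num.min d2 d4)).
split=> [|t St]; first by rewrite !lt_min d10 d20.
rewrite !lt_min => /and3P[t1 t2 t4].
have E0 := expR_ge0 (8 * h * Re t).
split=> [x Rx|x Rx|x z Rx Lz].
- apply: (le_trans (sup_on_ubound (h1 t St t1) Rx)); rewrite E ler_wpM2r//.
  by rewrite le_max lexx.
- apply: (le_trans (sup_on_ubound (h2 t St t2) Rx)); rewrite E ler_wpM2r//.
  by rewrite !le_max lexx orbT.
have := @sup_on_ubound R _ _ _ _ (x, z) (h4 t St t4) (conj Rx Lz).
move=> /= H; apply: (le_trans H); rewrite mulr1.
by rewrite !le_max lexx !orbT.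
Qed.

(** On one strip the constants are fixed, and a small [|t|] absorbs them: [8 * h] drops to [7 * h],
    and [O(1)] becomes the exponent [- h]. The threshold [H] depends on the strip, whence the
    pinched domain. *)
Lemma good_strip (k : nat) : exists H : R, forall t, `|Im t| < k.+1%:R -> Re t < - H ->
  good t.
Proof.
have k0 : (0 : R) < k.+1%:R by rewrite ltr0n.
pose Q (i : Idx m n * Idx m n) (K : R) (t : RC0 R) :=
  bounds_at (K * expR (8 * h * Re t)) K t i.1 i.2.
have [|i|K [d [d0 hK]]] := @common_bigO R _ (sector k.+1%:R) Q.
- move=> i K K' t KK; apply: bounds_mono => //; rewrite ler_wpM2r// expR_ge0//.
- exact: bounds_sector.
have [d' d'0 hd'] := pos_continuous_min heps (ltW k0).
have [c2 c21 hc2] := exp_absorb K h0.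
exists (Num.max c2 (Num.max (- ln d) (- ln d'))) => t it.
rewrite ltrNr !gt_max => /and3P[t1 t2 t3].
have td : rc_abs t < d.
  by rewrite /rc_abs -(lnK d0) ltr_expR; move: t2; rewrite ltrN2.
have td' : rc_abs t < d'.
  by rewrite /rc_abs -(lnK d'0) ltr_expR; move: t3; rewrite ltrN2.
have Kh : K * expR (h * Re t) <= 1 by apply: hc2; rewrite lerNr ltW.
split.
  rewrite /pinched /= expR_gt0; apply: (lt_le_trans td'); exact/hd'/ltW.
move=> i j; apply: bounds_mono (hK t it td (i, j)).
  have -> : 8 * h * Re t = h * Re t + 7 * h * Re t by ring.
  by rewrite expRD mulrA; apply: ler_piMl (expR_ge0 _) _.
by rewrite mulNr expRN -[leRHS]mul1r ler_pdivlMr// expR_gt0.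
Qed.

(** The linear theory indexes coefficients by natural numbers; the value is 0 from [m] on. *)
Definition cfn (j : nat) (x : 'rV[C]_n) : C := oapp (fun i => c i x) 0 (insub j).

Lemma cfnE (j : 'I_m) x : cfn j x = c j x.
Proof. by rewrite /cfn valK. Qed.

Lemma k0_idx (k : Idx m n) : idx_deg k = 0%N -> k0 n (idx_j k) = k.
Proof.
move=> dk; apply: val_inj; rewrite /= /idx_j; case: k dk => -[j a] /= p dk.
congr pair; apply/ffunP => i; rewrite ffunE; apply: val_inj => /=.
by move/eqP: dk; rewrite /idx_deg sum_nat_eq0 => /forallP/(_ i)/eqP <-.
Qed.

Lemma lincoef_sum x (w : Z) :
  \sum_i lincoef (enum_val i) x * w 0 i = \sum_(j < m) cfn j x * zc j w.
Proof.
rewrite (reindex (@enum_rank (Idx m n))); last first.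
  by apply: onW_bij; exact: enum_rank_bij.
rewrite (bigID (fun k => idx_deg k == 0%N)) /= [X in _ + X]big1 ?addr0; last first.
  by move=> k dk; rewrite enum_rankK /lincoef (negbTE dk) mul0r.
rewrite (reindex_onto (@k0 m n) (@idx_j m n)); last by move=> k /eqP; exact: k0_idx.
apply: eq_big => [j|j _].
  apply/andP; split; apply/eqP => //.
  by rewrite /idx_deg -size_dlist dlist_k0.
by rewrite enum_rankK /lincoef cfnE /zc /idx_deg -size_dlist dlist_k0.
Qed.

Let N := #|Idx m n|.

(** Second derivatives of size [|t| ^ (- h)] on [|Z| <= |t| ^ (4 * h)] move the first ones by
    [N * |t| ^ (3 * h)]; the deviation at [Z = 0] adds [|t| ^ (7 * h)]. A last factor [|t| ^ h]
    absorbs [N * (N + 1)] and leaves [2 * h]. *)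
Lemma good_lip t x (z z' : Z) : good t -> Re t <= 0 -> polydisc R0 x ->
  expR (4 * h * Re t) < L -> N%:R * (N%:R + 1) * expR (h * Re t) <= 1 ->
  nrm z <= expR (4 * h * Re t) -> nrm z' <= expR (4 * h * Re t) ->
  cabs (F t x z - F t x z' - \sum_(j < m) cfn j x * zc j (z - z')) <=
    expR (2 * h * Re t) * nrm (z - z').
Proof.
move=> [tp tb] t0 Rx EL Nh hz hz'.
pose g := F t x; have oL : open (polydisc (R := R) (d := N) L).
  have -> : @polydisc R N L = [set z : Z | nrm (z - 0) < L].
    by apply/funext => y; apply/propext; rewrite /= subr0; exact: polydiscE.
  exact: ball_open.
have hg : holomorphic_on g (@polydisc R N L).
  move=> y Ly; apply: (@differentiable_comp _ _ _ _ (fun z : Z => ((t, x), z))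
    (fun p : RC0 R * 'rV[C]_n * Z => F p.1.1 p.1.2 p.2)); last first.
    by apply: hF; split.
  apply: differentiable_pair; [exact: differentiable_cst | exact: ex_diff].
have sL y : nrm y <= expR (4 * h * Re t) -> @polydisc R N L y.
  by move=> hy; apply/polydiscE => //; exact: le_lt_trans hy EL.
have z0 : nrm (0 : Z) <= expR (4 * h * Re t) by rewrite nrm0 expR_ge0.
have hD i : holomorphic_on ('D_(delta_mx 0 i) g) (@polydisc R N L) := holo_D oL hg _.
have dZE i (G : Z -> C) : dZ (enum_val i) G = 'D_(delta_mx 0 i) G by rewrite /dZ /partial enum_valK.
have N0 : (0 : R) <= N%:R by [].
pose B := (N%:R + 1) * expR (3 * h * Re t).
have B0 : 0 <= B by apply: mulr_ge0 (expR_ge0 _); rewrite addr_ge0.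
have bD y i : nrm y <= expR (4 * h * Re t) ->
    cabs ('D_(delta_mx 0 i) g y - lincoef (enum_val i) x) <= B.
  move=> hy.
  have b1 : cabs ('D_(delta_mx 0 i) g y - 'D_(delta_mx 0 i) g 0) <= N%:R * expR (3 * h * Re t).
    have := @lip_row R N ('D_(delta_mx 0 i) g) (fun=> 0) (expR (4 * h * Re t))
      (expR (- h * Re t)) y 0 (expR_ge0 _) _ hy z0.
    rewrite big1 => [|j _]; last by rewrite mul0r.
    rewrite !subr0 => H; apply: (le_trans (H _)) => {H}.
      move=> y' hy'; split; first exact: hD (sL y' hy').
      move=> l; rewrite subr0; have [_ _ H] := tb (enum_val l) (enum_val i).
      have := H x y' Rx (sL y' hy'); rewrite -/g (dZE i g) dZE; exact.
    rewrite -mulrA; apply: ler_wpM2l => //.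
    have -> : 3 * h * Re t = - h * Re t + 4 * h * Re t by ring.
    by rewrite expRD; apply: ler_wpM2l => //; exact: expR_ge0.
  have [_ b2 _] := tb (enum_val i) (enum_val i); have {b2} := b2 x Rx.
  rewrite -/g dZE => b2.
  have b3 : expR (7 * h * Re t) <= expR (3 * h * Re t).
    rewrite ler_expR; have := mulr_ge0 (ltW h0) (_ : 0 <= - Re t).
    by rewrite oppr_ge0 => /(_ t0); lra.
  rewrite -(subrKA ('D_(delta_mx 0 i) g 0)); apply: (le_trans (cabsD _ _)).
  by rewrite /B mulrDl mul1r; apply: lerD => //; exact: le_trans b2 b3.
have := @lip_row R N g (fun i => lincoef (enum_val i) x) (expR (4 * h * Re t)) B z z' B0 _ hz hz'.
rewrite lincoef_sum => H; apply: (le_trans (H _)) => {H}.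
  by move=> y hy; split=> [|i]; [exact: hg (sL y hy) | exact: bD].
apply: ler_wpM2r; first exact: nrm_ge0.
have -> : N%:R * B = N%:R * (N%:R + 1) * expR (h * Re t) * expR (2 * h * Re t).
  by rewrite -[RHS]mulrA -expRD /B mulrA; congr (_ * expR _); ring.
by apply: ler_piMl => //; exact: expR_ge0.
Qed.

End Reduction.

Theorem theorem4p1 (R : realType) (m n : nat) (hm : (0 < m)%N) (hn : (0 < n)%N)
  (F : RC0 R -> 'rV[Cplx R]_n -> Zvec R m n -> Cplx R)
  (eps : R -> R) (R0 L : R)
  (heps : pos_continuous eps) (hR0 : 0 < R0) (hL : 0 < L)
  (hF : holomorphic_on
          (fun p : RC0 R * 'rV[Cplx R]_n * Zvec R m n => F p.1.1 p.1.2 p.2)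
          (pinched eps `*` polydisc R0 `*` polydisc L))
  (s : R) (hs : 0 < s)
  (c : 'I_m -> 'rV[Cplx R]_n -> Cplx R)
  (hc : forall j, holomorphic_on (c j) (polydisc R0))
  (hC2 : forall theta : R, 0 < theta -> forall k l : Idx m n,
    [/\ bigO_sector theta
          (fun t => sup_on (polydisc R0) (fun x => F t x 0))
          (fun t => rc_abs t `^ s),
        idx_deg k = 0%N ->
          bigO_sector theta
            (fun t => sup_on (polydisc R0)
               (fun x => dZ k (F t x) 0 - c (idx_j k) x))
            (fun t => rc_abs t `^ s),
        (0 < idx_deg k)%N ->
          bigO_sector theta
            (fun t => sup_on (polydisc R0) (fun x => dZ k (F t x) 0))
            (fun t => rc_abs t `^ s)
      & bigO_sector theta
          (fun t => sup_on (polydisc R0 `*` polydisc L)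
             (fun p => dZ k (dZ l (F t p.1)) p.2))
          (fun=> 1)]) :
  exists (eps1 : R -> R) (r1 : R) (u : RC0 R -> 'rV[Cplx R]_n -> Cplx R),
    Otilde_plus eps1 r1 u /\ solves_on F eps R0 L eps1 r1 u.
Proof.
pose h := s / 8; have h0 : 0 < h by rewrite divr_gt0.
have sE : s = 8 * h by rewrite /h mulrC divfK.
rewrite {}sE in hC2.
have [H hH] : exists H : nat -> R, forall k t, `|complex.Im t| < k.+1%:R ->
    complex.Re t < - H k -> good F eps R0 L h c t.
  have e k := good_strip heps h0 hC2 k.
  by exists (fun k => projT1 (cid (e k))) => k; exact: (projT2 (cid (e k))).
(* The shift by one: the hinge of index [k] attains its height only for [|Im t| >= k + 1], where
   [H k.+1] is the threshold needed. *)
pose a k := `|H k.+1|; have a0 k : 0 <= a k by exact: normr_ge0.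
pose psi := hinges a; have psi_ge0 := hinges_ge0 a0; have psi0 := hinges0 a.
have psi_cvx := hinges_cvx a0; have psi_cont := hinges_cont a0.
pose N : R := #|Idx m n|%:R.
have h4 : 0 < 4 * h by rewrite mulr_gt0.
have [c1 c11 hc1] := exp_absorb (2 / L) h4.
have [c2 c21 hc2] := exp_absorb (N * (N + 1)) h0.
(* [H 0] serves the strip around the real axis, [c1] keeps the jets below [L], and [c2] absorbs the
   dimension factor of [good_lip]. *)
pose c0 := Num.max 1 (Num.max (H 0%N) (Num.max c1 c2)).
have c01 : 1 <= c0 by rewrite le_max lexx.
have c0H : H 0%N <= c0 by rewrite !le_max lexx orbT.
have c0c1 : c1 <= c0 by rewrite !le_max lexx !orbT.
have c0c2 : c2 <= c0 by rewrite !le_max lexx !orbT.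
have gd t : Om psi c0 t -> good F eps R0 L h c t.
  move=> Ot; have [k k1 k2] := Om_hinges a0 c01 c0H (fun k => ler_norm (H k.+1)) Ot.
  exact: hH k1 k2.
have ReO t : Om psi c0 t -> complex.Re t < - c0.
  by apply: Om_ltc => //; exact: le_trans ler01 c01.
have EL t : Om psi c0 t -> expR (4 * h * complex.Re t) < L.
  move=> /ReO tl; have := hc1 (complex.Re t); rewrite mulrAC ler_pdivrMr// mul1r => H1.
  have := expR_gt0 (4 * h * complex.Re t).
  have : complex.Re t <= - c1 by apply: ltW; apply: (lt_le_trans tl); rewrite lerN2.
  by move=> /H1; lra.
(* A radius at most 1 keeps all distances to the boundary at most 1, so their negative powers are
   ordered by the exponent. *)
pose r0 := Num.min R0 1; have r00 : 0 < r0 by rewrite lt_min hR0 ltr01.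
have r01 : r0 <= 1 by rewrite ge_min lexx orbT.
have xR x : xball r0 x -> polydisc R0 x.
  by move=> xr; apply/polydiscE => //; apply: (lt_le_trans xr); rewrite ge_min lexx.
pose G (p : RC0 R * 'rV[Cplx R]_n) (z : Zvec R m n) := F p.1 p.2 z.
have hG p z : Dom psi c0 r0 p -> nrm z <= expR (4 * h * complex.Re p.1) ->
    differentiable (fun q : RC0 R * 'rV[Cplx R]_n * Zvec R m n => G q.1 q.2) (p, z).
  move=> [p1 p2] hz; apply: hF; split; first by split; [exact: (gd _ p1).1 | exact: xR].
  by apply/polydiscE => //; exact: le_lt_trans hz (EL _ p1).
have hG0 p : Dom psi c0 r0 p -> cabs (G p 0) <= expR (7 * h * complex.Re p.1).
  move=> [p1 p2]; have [_ gb] := gd _ p1; have k := k0 n (Ordinal hm).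
  by have [b1 _ _] := gb k k; apply: b1; exact: xR.
have hGL p z z' : Dom psi c0 r0 p -> nrm z <= expR (4 * h * complex.Re p.1) ->
    nrm z' <= expR (4 * h * complex.Re p.1) ->
    cabs (G p z - G p z' - \sum_(j < m) cfn c j p.2 * zc j (z - z')) <=
    expR (2 * h * complex.Re p.1) * nrm (z - z').
  move=> [p1 p2] hz hz'; have Rl := ReO _ p1.
  apply: (@good_lip R m n F eps R0 L hL hF h h0 c p.1 p.2 z z' (gd _ p1)) => //.
  - by move: Rl; lra.
  - exact: xR.
  - exact: EL.
  by apply: hc2; apply: ltW; apply: (lt_le_trans Rl); rewrite lerN2.
have hcf j : (j < m)%N -> holomorphic_on (cfn c j) (xball r0).
  move=> jm x /xR; have -> : cfn c j = c (Ordinal jm).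
    by apply/funext => y; rewrite -cfnE.
  exact: hc.
have [cc [r [u [cc0 /andP[rp rr] hu huP]]]] :=
  solution psi_ge0 psi0 psi_cvx psi_cont hm c01 r00 r01 h0 hG hG0 hGL hcf.
(* The defining inequality of [Om], exponentiated, bounds the modulus by a function of the
   argument. *)
pose eps1 (y : R) := expR (- (cc * (1 + `|y|) + psi y)).
have eps1E t : pinched eps1 t <-> Om psi cc t.
  by rewrite /pinched /= expR_gt0 /= ltr_expR.
have UE t (x : 'rV[Cplx R]_n) : pinched eps1 t -> polydisc r x -> Dom psi cc r (t, x).
  by move=> /eps1E h1 /(polydiscE x rp) h2.
have oU := @Dom_open R n psi psi_cont cc r.
have ep1 : pos_continuous eps1.
  split=> [y|y]; last exact: expR_gt0.
  apply: (@continuous_comp _ _ _ (fun y => - (cc * (1 + `|y|) + psi y)) expR); last first.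
    exact: continuous_expR.
  apply: (@continuousN R R R).
  apply: (@continuousD R R R (fun y => cc * (1 + `|y|)) psi); last exact: psi_cont.
  apply: (@continuousM R R (cst cc) (fun y => 1 + `|y|)); first exact: cst_continuous.
  apply: (@continuousD R R R (cst 1) (fun y => `|y|)); first exact: cst_continuous.
  exact: norm_continuous.
exists eps1, r, (fun t x => u (t, x)); split.
  split=> //.
    move=> p [p1 p2]; rewrite (_ : (fun p => _) = u); last by apply/funext => -[].
    by apply: hu; case: p p1 p2 => t x; exact: UE.
  exists (4 * h); split=> // r' theta /andP[r'0 r'r] th0.
  (* On a fixed sector [eps1] is bounded below, so all small [t] of the sector lie in the domain. *)
  have [d d0 hd] := pos_continuous_min ep1 (ltW th0).
  exists 1, d; split=> // t St td.
  have tp : pinched eps1 t.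
    rewrite /pinched /= expR_gt0; apply: (lt_le_trans td).
    by apply: hd; exact: ltW.
  apply: ge_ereal_sup => _ [x xr <-]; rewrite lee_fin mul1r.
  have Dx : Dom psi cc r (t, x).
    by apply: UE => // i; exact: lt_trans (xr i) r'r.
  have [ju _] := huP _ Dx.
  (* The solution is the coordinate [(0, 0)] of its jet, an index available because [m > 0]; the jet
     bound thus gives the exponent [4 * h]. *)
  have -> : u (t, x) = zc (Ordinal hm) (jetv m u (t, x)) by rewrite zc_jetv.
  apply: (le_trans (nrm_row_coord _ _)); apply: (le_trans ju).
  by rewrite /rc_abs -expRM mulrC.
move=> t x tp xr; have Dx := UE t x tp xr; have [ju Ru] := huP _ Dx.
have [D1 D2] : Dom psi c0 r0 (t, x) := Dom_sub cc0 rr Dx.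
rewrite (jetE m oU hu Dx) (iter_tdt m oU hu Dx); split.
- exact: (gd _ D1).1.
- exact: xR.
- by apply/polydiscE => //; exact: le_lt_trans ju (EL _ D1).
by apply/eqP; rewrite -subr_eq0; apply/eqP.
Qed.
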